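(* Let $Y$ be a Lévy process in $\mathbb{R}^d$ with generating triplet $(A,N,b)$ and with $h(0^+)=\infty$. Each of the following (mutually equivalent) conditions (C1)–(C4) is equivalent to (C6). (C1) The density $p(t,x)$ of $Y_t$ exists and there are $T_1\in(0,\infty]$, $c_1>0$ such that $\sup_{x\in\mathbb{R}^d}p(t,x)\le c_1[h^{-1}(1/t)]^{-d}$ for all $0<t<T_1$. (C2) There are $T_2\in(0,\infty]$, $c_2>0$ such that $\int_{\mathbb{R}^d}e^{-t\,\mathrm{Re}[\Psi(z)]}dz\le c_2[h^{-1}(1/t)]^{-d}$ for all $0<t<T_2$. (C3) There are $T_3\in(0,\infty]$, $c_3\in(0,1]$, $\alpha_3\in(0,2]$ such that $c_3\Psi^*(|x|)\le \mathrm{Re}[\Psi(x)]$ for all $|x|>1/T_3$, and $\Psi^*(\lambda r)\ge c_3\lambda^{\alpha_3}\Psi^*(r)$ for all $\lambda\ge1$, $r>1/T_3$. (C4) There are $T_4\in(0,\infty]$, $c_4\in[1,\infty)$ such that $\Psi^*(|x|)\le c_4\big(\langle x,Ax\rangle+\int_{|\langle x,z\rangle|<1}|\langle x,z\rangle|^2N(dz)\big)$ for all $|x|>1/T_4$. (C6) The density $p(t,x)$ of $Y_t$ exists and there are $T_6\in(0,\infty]$, $c_6\in[1,\infty)$ such that for every $0<t<T_6$ there exists $x_t\in\mathbb{R}^d$ with $|x_t|\le c_6h^{-1}(1/t)$ such that for every $|y|\le(1/c_6)h^{-1}(1/t)$, $$p\big(t,\,y+x_t+t\,b_{[h^{-1}(1/t)]}\big)\ge(1/c_6)\sup_{x\in\mathbb{R}^d}p(t,x).$$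 Moreover, (C3) with constants $T_3,c_3,\alpha_3$ implies (C6) with a constant $c_6$ depending only on $d,\alpha_3,c_3$ and with $T_6=1/h(T_3/c_6)$. If $T_3<\infty$ in (C3), then (C6) holds for every $T_6>0$ with a constant $c_6$ depending only on $d,\alpha_3,c_3,T_3,T_6,h$.
   Context: $Y=(Y_t)_{t\ge0}$ is a Lévy process in $\mathbb{R}^d$, $d\in\mathbb{N}$, with generating triplet $(A,N,b)$: $A$ is a symmetric non-negative definite $d\times d$ matrix, $b\in\mathbb{R}^d$, and $N$ is a Lévy measure (Borel measure with $N(\{0\})=0$, $\int(1\wedge|z|^2)N(dz)<\infty$). The characteristic exponent $\Psi$ is given by $\mathbb{E}e^{i\langle x,Y_t\rangle}=e^{-t\Psi(x)}$, $$\Psi(x)=\langle x,Ax\rangle-i\langle x,b\rangle-\int_{\mathbb{R}^d}\big(e^{i\langle x,z\rangle}-1-i\langle x,z\rangle\mathbf{1}_{|z|<1}\big)N(dz).$$ For $r>0$, $h(r)=r^{-2}\|A\|+\int_{\mathbb{R}^d}\big(1\wedge\frac{|x|^2}{r^2}\big)N(dx)$, $\Psi^*(r)=\sup_{|z|\le r}\mathrm{Re}[\Psi(z)]$, and $$b_r=b+\int_{\mathbb{R}^d}z\big(\mathbf{1}_{|z|<r}-\mathbf{1}_{|z|<1}\big)N(dz);$$ $b_{[h^{-1}(1/t)]}$ means $b_r$ with $r=h^{-1}(1/t)$. Standing assumption: $h(0^+)=\infty$; then $h$ is a continuous strictly decreasing bijection of $(0,\infty)$ onto $(0,\infty)$ with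 inverse $h^{-1}$. Conventions: $1/\infty=0$, $h(\infty)=0$, $1/0=\infty$. $p(t,\cdot)$ is the density of the law of $Y_t$ with respect to Lebesgue measure (if $e^{-t\Psi}$ is integrable, it is the continuous one given by Fourier inversion). *)

(* Defs.v *)
From HB Require Import structures.
From mathcomp Require Import all_boot all_order all_algebra.
From mathcomp Require Import all_classical all_reals all_analysis.
From mathcomp Require Import complex.

Set Implicit Arguments.
Unset Strict Implicit.
Unset Printing Implicit Defensive.

Import Order.TTheory GRing.Theory Num.Theory.
Import numFieldNormedType.Exports.

Local Open Scope classical_set_scope.
Local Open Scope ring_scope.
Local Open Scope complex_scope.

(* R^n is the type of column vectors, with the product sigma-algebra of the
   coordinates (over R, the Borel sets of R^n). *)

Definition cV_display : measure_display -> measure_display.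
Proof. exact. Qed.

Section measurable_cV.
Context {d} {T : sigmaRingType d} (n : nat).

Let coord : 'I_n -> 'cV[T]_n -> T := fun i x => x i ord0.

Let cV_set0 : g_sigma_preimage coord set0.
Proof. exact: sigma_algebra0. Qed.

Let cV_setC A : g_sigma_preimage coord A -> g_sigma_preimage coord (~` A).
Proof. exact: sigma_algebraC. Qed.

Let cV_bigcup (F : (set 'cV[T]_n)^nat) :
  (forall i, g_sigma_preimage coord (F i)) ->
  g_sigma_preimage coord (\bigcup_i (F i)).
Proof. exact: sigma_algebra_bigcup. Qed.

HB.instance Definition _ := @isMeasurable.Build (cV_display d)
  'cV[T]_n (g_sigma_preimage coord) cV_set0 cV_setC cV_bigcup.

End measurable_cV.

Lemma measurable_coord d (T : sigmaRingType d) n (i : 'I_n) :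
  measurable_fun [set: 'cV[T]_n] (fun x => x i ord0).
Proof.
move=> _ Y mY; rewrite setTI; apply: sub_sigma_algebra => /=.
rewrite -bigcup_seq/=; exists i => /=; first by rewrite mem_index_enum.
by exists Y => //; rewrite setTI.
Qed.

Lemma measurable_fun_cVP d1 d2 (T1 : measurableType d1)
    (T2 : measurableType d2) n (f : T1 -> 'cV[T2]_n) :
  (forall i, measurable_fun [set: T1] (fun x => f x i ord0)) ->
  measurable_fun [set: T1] f.
Proof.
move=> mf _ A mA; rewrite setTI.
suff H : measurable `<=` [set B : set 'cV[T2]_n | measurable (f @^-1` B)].
  exact: H.
apply: smallest_sub.
  split=> /=.
  - by rewrite preimage_set0.
  - by move=> B mB; rewrite setTD preimage_setC; exact: measurableC.
  - by move=> F mF; rewrite preimage_bigcup; exact: bigcup_measurable.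
rewrite -bigcup_seq => B [i _ [C mC <-]] /=.
by rewrite setTI; have := mf i measurableT _ mC; rewrite setTI.
Qed.

(* Lebesgue measure on R^n, by recursion on n, identifying R x R^n with
   R^n.+1. *)
Section lebesgue_cV.
Variable R : realType.

Section step.
Variable n : nat.

Definition cV_cons (p : measurableTypeR R * 'cV[R]_n) : 'cV[R]_n.+1 :=
  \col_i (if unlift ord0 i is Some j then p.2 j ord0 else p.1).

Definition cV_uncons (x : 'cV[R]_n.+1) : measurableTypeR R * 'cV[R]_n :=
  (x ord0 ord0, \col_i x (lift ord0 i) ord0).

Lemma cV_consK : cancel cV_cons cV_uncons.
Proof.
move=> [a x]; rewrite /cV_uncons /cV_cons mxE unlift_none; congr pair.
by apply/colP => i; rewrite !mxE liftK.
Qed.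

Lemma cV_unconsK : cancel cV_uncons cV_cons.
Proof.
by move=> x; apply/colP => i; rewrite mxE; case: unliftP => [j|] ->;
  rewrite ?mxE.
Qed.

Lemma measurable_cV_cons : measurable_fun setT cV_cons.
Proof.
apply: measurable_fun_cVP => i; rewrite /cV_cons.
under eq_fun do rewrite mxE.
case: unliftP => [j|] _; last exact: (@measurable_fst _ _ (measurableTypeR R)).
exact: (measurableT_comp (@measurable_coord _ R _ j)
  (@measurable_snd _ _ (measurableTypeR R) 'cV[R]_n)).
Qed.

Lemma measurable_cV_uncons : measurable_fun setT cV_uncons.
Proof.
apply: measurable_fun_pair; first exact: (measurable_coord ord0).
apply: measurable_fun_cVP => i.
by under eq_fun do rewrite mxE; exact: measurable_coord.
Qed.

HB.instance Definition _ :=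
  isMeasurableFun.Build _ _ _ _ cV_cons measurable_cV_cons.

Variable mu : {sigma_finite_measure set 'cV[R]_n -> \bar R}.

Definition lebesgue_cV_step : set 'cV[R]_n.+1 -> \bar R :=
  pushforward (@lebesgue_measure R \x mu)%E cV_cons.

Let step0 : lebesgue_cV_step set0 = 0%E.
Proof. exact: measure0. Qed.

Let step_ge0 A : (0 <= lebesgue_cV_step A)%E.
Proof. exact: measure_ge0. Qed.

Let step_sigma_additive : semi_sigma_additive lebesgue_cV_step.
Proof. exact: measure_semi_sigma_additive. Qed.

HB.instance Definition _ := isMeasure.Build _ _ _ lebesgue_cV_step
  step0 step_ge0 step_sigma_additive.

Let step_sigma_finite : sigma_finite setT lebesgue_cV_step.
Proof.
pose m1 : {sigma_finite_measure set (measurableTypeR R) -> \bar R} :=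
  @lebesgue_measure R.
have /sigma_finiteP[F [TF ndF Foo]] := sigma_finiteT m1.
have /sigma_finiteP[G [TG ndG Goo]] := sigma_finiteT mu.
exists (fun k => cV_uncons @^-1` (F k `*` G k)).
  rewrite predeqE => x; split=> // _.
  have [i _ Fi] : (\bigcup_i F i) (cV_uncons x).1 by rewrite -TF.
  have [j _ Gj] : (\bigcup_i G i) (cV_uncons x).2 by rewrite -TG.
  exists (maxn i j) => //; split.
    by move: Fi; exact/subsetPset/ndF/leq_maxl.
  by move: Gj; exact/subsetPset/ndG/leq_maxr.
move=> k; have [mF Fk] := Foo k; have [mG Gk] := Goo k; split.
  rewrite -[X in measurable X]setTI; apply: measurable_cV_uncons => //.
  exact: measurableX.
rewrite /lebesgue_cV_step /pushforward -comp_preimage.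
rewrite (_ : cV_uncons \o cV_cons = id); last first.
  by apply/funext => p /=; rewrite cV_consK.
by rewrite (product_measure1E m1)// lte_mul_pinfty// ge0_fin_numE.
Qed.

HB.instance Definition _ :=
  Measure_isSigmaFinite.Build _ _ _ lebesgue_cV_step step_sigma_finite.

End step.

Fixpoint lebesgue_cV (n : nat) : {sigma_finite_measure set 'cV[R]_n -> \bar R} :=
  match n with
  | 0 => \d_(0 : 'cV[R]_0)
  | n.+1 => lebesgue_cV_step (lebesgue_cV n)
  end.

End lebesgue_cV.
Arguments lebesgue_cV {R} n.

Lemma lebesgue_cV_box (R : realType) n (A : 'I_n -> set R) :
  (forall i, measurable (A i)) ->
  lebesgue_cV n [set x : 'cV[R]_n | forall i, A i (x i ord0)]
  = (\prod_(i < n) lebesgue_measure (A i))%E.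
Proof.
elim: n A => [|n IHn] A mA.
  by rewrite big_ord0 /= diracE mem_set //=; case.
rewrite big_ord_recl -IHn // -product_measure1E; first last.
  rewrite (_ : mkset _ = \bigcap_(i in [set: 'I_n])
      ((fun x : 'cV[R]_n => x i ord0) @^-1` A (lift ord0 i))); last first.
    by apply/seteqP; split => x /= H i; [move=> _|]; exact: H.
  apply: fin_bigcap_measurable => [|i _]; first exact: finite_finset.
  by rewrite -[X in measurable X]setTI; exact: measurable_coord.
  exact: mA.
rewrite /= /lebesgue_cV_step /pushforward.
rewrite (_ : cV_cons (n:=n) @^-1` _ = A ord0 `*`
    [set x : 'cV[R]_n | forall i, A (lift ord0 i) (x i ord0)]) //.
apply/seteqP; split => -[a x] /= => [H|[Aa Ax] i].
  split; first by have := H ord0; rewrite mxE unlift_none.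
  by move=> i; have := H (lift ord0 i); rewrite mxE liftK.
by rewrite mxE; case: unliftP => [j|] ->.
Qed.

Section complex_integral.
Variable R : realType.

Definition cexp (z : R[i]) : R[i] :=
  (expR (complex.Re z) * cos (complex.Im z)) +i*
  (expR (complex.Re z) * sin (complex.Im z)).

Context {disp : measure_display} {T : measurableType disp}.
Variable mu : {measure set T -> \bar R}.

Definition cintegrable (f : T -> R[i]) : Prop :=
  mu.-integrable setT (fun x => (complex.Re (f x))%:E) /\
  mu.-integrable setT (fun x => (complex.Im (f x))%:E).

Definition cintegral (f : T -> R[i]) : R[i] :=
  (\int[mu]_x complex.Re (f x)) +i* (\int[mu]_x complex.Im (f x)).

End complex_integral.

Section euclidean.
Variables (R : realType) (d : nat).
Implicit Types x y : 'cV[R]_d.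

Definition dotp x y : R := \sum_(i < d) x i ord0 * y i ord0.

Definition enorm x : R := Num.sqrt (dotp x x).

Definition eball (r : R) : set 'cV[R]_d := [set x | enorm x < r].

(* The operator norm for the Euclidean norm; `|A| would be the sup norm of the
   entries. *)
Definition opnorm (A : 'M[R]_d) : R :=
  sup [set enorm (A *m x) | x in [set x | enorm x <= 1]].

End euclidean.

Record levy_triplet (R : realType) (d : nat) := LevyTriplet {
  gauss : 'M[R]_d;
  jump : {measure set 'cV[R]_d -> \bar R};
  drift : 'cV[R]_d;
  gauss_sym : gauss^T = gauss;
  gauss_ge0 : forall x, 0 <= dotp x (gauss *m x);
  jump0 : jump [set 0] = 0%E;
  jump_fin : (\int[jump]_z (Num.min 1 (enorm z ^+ 2))%:E < +oo)%E
}.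

Section exponent.
Variables (R : realType) (d : nat) (g : levy_triplet R d).

Definition Psi (x : 'cV[R]_d) : R[i] :=
  (dotp x (gauss g *m x))%:C - 'i%C * (dotp x (drift g))%:C
  - cintegral (jump g) (fun z => cexp ('i%C * (dotp x z)%:C) - 1
                                 - 'i%C * (dotp x z)%:C * \1_(eball 1) z).

Definition Psistar (r : R) : R :=
  sup [set complex.Re (Psi z) | z in [set z : 'cV[R]_d | enorm z <= r]].

Definition h (r : R) : R :=
  r ^- 2 * opnorm (gauss g)
  + \int[jump g]_x Num.min 1 (enorm x ^+ 2 / r ^+ 2).

(* h on ]0, +oo], with h(+oo) = 0 *)
Definition h_ext (r : \bar R) : \bar R := if r is s%:E then (h s)%:E else 0%E.

(* h is a bijection of ]0, +oo[ onto itself as soon as h tends to +oo at 0^'+;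
   the values of hinv are meaningful only in that case. *)
Definition hinv : R -> R := 'pinv_(fun=> 0) `]0, +oo[ h.

Definition drift_r (r : R) : 'cV[R]_d :=
  drift g + \col_i \int[jump g]_z
    (z i ord0 * (\1_(eball r) z - \1_(eball 1) z)).

End exponent.

Section levy_process.
Context {R : realType} {d : nat} {disp : measure_display}
  {Omega : measurableType disp}.
Variables (P : probability Omega R) (Y : R -> Omega -> 'cV[R]_d).

Definition increment_in (s t : R) (B : set 'cV[R]_d) : set Omega :=
  [set w | B (Y t w - Y s w)].

(* Only the values Y t with 0 <= t are constrained. *)
Record levy_process : Prop := {
  levy_measurable : forall t, 0 <= t -> measurable_fun setT (Y t);
  levy_start : {ae P, forall w, Y 0 w = 0};
  levy_indep : forall (n : nat) (s : nat -> R) (B : nat -> set 'cV[R]_d),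
    0 <= s 0 -> (forall i, s i <= s i.+1) -> (forall i, measurable (B i)) ->
    P (\bigcap_(i < n) increment_in (s i) (s i.+1) (B i)) =
    (\prod_(i < n) P (increment_in (s i) (s i.+1) (B i)))%E;
  levy_stationary : forall (s t : R) (B : set 'cV[R]_d),
    0 <= s -> 0 <= t -> measurable B ->
    P (increment_in s (s + t) B) = P (increment_in 0 t B);
  levy_stoch_continuous : forall t eps : R, 0 <= t -> 0 < eps ->
    P [set w | eps < enorm (Y s w - Y t w)]
      @[s --> within [set s | 0 <= s] (nbhs t)] --> 0%E;
  levy_cadlag : {ae P, forall w,
    (forall t, 0 <= t -> Y s w @[s --> t^'+] --> Y t w) /\
    (forall t, 0 < t -> cvg (Y s w @[s --> t^'-]))}
}.

Definition levy_process_with (g : levy_triplet R d) : Prop :=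
  levy_process /\
  forall t x, 0 <= t ->
    cintegral P (fun w => cexp ('i%C * (dotp x (Y t w))%:C))
    = cexp (- t%:C * Psi g x).

End levy_process.

Section conditions.
Context {R : realType} {d : nat}.

Definition fourier_inversion (g : levy_triplet R d) (t : R) (x : 'cV[R]_d) :
    R[i] :=
  ((2 * pi) ^- d)%:C *
  cintegral (lebesgue_cV d)
    (fun z => cexp (- 'i%C * (dotp x z)%:C) * cexp (- t%:C * Psi g z)).

(* p t is a density of the law of Y t for every t > 0; it is the one given by
   Fourier inversion whenever exp(-t Psi) is integrable, and an arbitrary
   version otherwise. *)
Definition transition_density disp (Omega : measurableType disp)
    (P : probability Omega R) (Y : R -> Omega -> 'cV[R]_d)
    (g : levy_triplet R d) (p : R -> 'cV[R]_d -> R) : Prop :=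
  forall t, 0 < t ->
  [/\ measurable_fun setT (p t),
      (forall x, 0 <= p t x),
      (forall B, measurable B ->
         P (Y t @^-1` B) = \int[lebesgue_cV d]_(x in B) (p t x)%:E)%E &
      cintegrable (lebesgue_cV d) (fun z => cexp (- t%:C * Psi g z)) ->
      forall x, (p t x)%:C = fourier_inversion g t x].

Definition esup (f : 'cV[R]_d -> R) : \bar R :=
  ereal_sup (range (fun x => (f x)%:E)).

Section C1_C6.
Context {disp : measure_display} {Omega : measurableType disp}.
Variables (P : probability Omega R) (Y : R -> Omega -> 'cV[R]_d).
Variable g : levy_triplet R d.

Definition C1 : Prop :=
  exists p, transition_density P Y g p /\
  exists (T1 : \bar R) (c1 : R), [/\ (0 < T1)%E, 0 < c1 &
    forall t : R, 0 < t -> (t%:E < T1)%E ->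
      (esup (p t) <= (c1 * hinv g t^-1 ^- d)%:E)%E].

Definition C2 : Prop :=
  exists (T2 : \bar R) (c2 : R), [/\ (0 < T2)%E, 0 < c2 &
    forall t : R, 0 < t -> (t%:E < T2)%E ->
      (\int[lebesgue_cV d]_z (expR (- t * complex.Re (Psi g z)))%:E
       <= (c2 * hinv g t^-1 ^- d)%:E)%E].

(* In the scope of extended reals, +oo^-1 = 0 and 0^-1 = +oo. *)
Definition C3_with (T3 : \bar R) (c3 alpha3 : R) : Prop :=
  (forall x : 'cV[R]_d, (T3^-1 < (enorm x)%:E)%E ->
     c3 * Psistar g (enorm x) <= complex.Re (Psi g x)) /\
  (forall lambda r : R, 1 <= lambda -> (T3^-1 < r%:E)%E ->
     c3 * lambda `^ alpha3 * Psistar g r <= Psistar g (lambda * r)).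

Definition C3 : Prop :=
  exists (T3 : \bar R) (c3 alpha3 : R),
    [/\ (0 < T3)%E, 0 < c3 <= 1, 0 < alpha3 <= 2 & C3_with T3 c3 alpha3].

Definition C4 : Prop :=
  exists (T4 : \bar R) (c4 : R), [/\ (0 < T4)%E, 1 <= c4 &
    forall x : 'cV[R]_d, (T4^-1 < (enorm x)%:E)%E ->
      Psistar g (enorm x) <=
      c4 * (dotp x (gauss g *m x) +
            \int[jump g]_(z in [set z | `|dotp x z| < 1]) `|dotp x z| ^+ 2)].

Definition C6_with (T6 : \bar R) (c6 : R) : Prop :=
  exists p, transition_density P Y g p /\
  forall t : R, 0 < t -> (t%:E < T6)%E ->
    exists xt : 'cV[R]_d, enorm xt <= c6 * hinv g t^-1 /\
    forall y : 'cV[R]_d, enorm y <= c6^-1 * hinv g t^-1 ->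
      (c6^-1%:E * esup (p t)
       <= (p t (y + xt + t *: drift_r g (hinv g t^-1)))%:E)%E.

Definition C6 : Prop :=
  exists (T6 : \bar R) (c6 : R), [/\ (0 < T6)%E, 1 <= c6 & C6_with T6 c6].

End C1_C6.
End conditions.

(* Main.v *)
(** Write [psi = Re Psi] and let [r] stand for [hinv (1 / t)].  Everything is
    compared with (C3).  Under (C3), [t psi(z)] dominates [(r |z|)^alpha] for
    [r |z| >= 1], so [exp(-t psi) (1 + r |z|)] has integral [O(r^-d)]; by
    Fourier inversion the density is then [O(r^-d)] and Lipschitz with constant
    [O(r^-d-1)].  Moreover [Y_t] is the sum of [n = n(d)] independent
    increments, each within [O(r)] of its drift [(t / n) b_r] with probability
    at least 1/2, so the density is at least a multiple of [r^-d] somewhere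
    within [O(r)] of [t b_r], and by the Lipschitz bound on a whole ball: this
    is (C6).  Integrating (C6) over that ball bounds the density as in (C1).
    Testing the density bound of (C1) against Cauchy kernels gives
    [int exp(-2 t psi) = O(r^-d)], also a consequence of (C2).  Volume
    comparison then yields (C3): [psi] is at most [2 k^2 psi(x) + O(1/t)] on the
    disjoint cubes around the multiples [k x], so [psi(x)] cannot be much
    smaller than [Psistar |x|], and [Psistar] must double when its argument is
    multiplied by a large constant.  (C3) and (C4) are compared through
    [<x,Ax> + int min(1, <x,z>^2) N(dz)], whose increments from [x] to [2 x] are
    controlled by the right-hand side of (C4). *)
Require Import Defs.
From HB Require Import structures.
From mathcomp Require Import all_boot all_order all_algebra.
From mathcomp Require Import all_classical all_reals all_analysis.
From mathcomp Require Import measurable_realfun.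
From mathcomp Require Import ring lra complex.
Import Order.TTheory GRing.Theory Num.Theory.
Import numFieldNormedType.Exports.
Local Open Scope classical_set_scope.
Local Open Scope ring_scope.
Set Implicit Arguments.
Unset Strict Implicit.
Unset Printing Implicit Defensive.

(** * Laplace and Cauchy kernels *)

(** All the Fourier analysis rests on one explicit pair: the product of the [expR (- e |z_i|)] and
    its transform, a product of Cauchy kernels. Both factor over the coordinates, so integrals over
    ['cV_d] reduce to elementary antiderivatives. The same pair gives the inversion theorem, the
    concentration of the increments, the bound of [h] by [Psistar] and the majorant of the moment
    integral. Characteristic functions appear only through the real integrals of [cos (<z, X> + a)],
    whose free shift [a] carries real and imaginary parts at once. The time [t] is cut into [n]
    pieces because [t * h r = 1] contains no smallness: the estimate for the mass away from the
    drift is a dimensional constant times [s * h r] at time [s], and is at most 1/2 only for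
    [s = t / n]; independence then costs a factor [2^-n]. Time, space and frequency are tied to a
    single scale because [h (1 / rho)] and [Psistar rho] are comparable with constants depending on
    [d] only. The constants are assembled from [d], [alpha] and [c3] before any process is given, as
    the uniform clauses demand. *)

Lemma measurable_cos {R : realType} : measurable_fun setT (@cos R).
Proof. by apply: continuous_measurable_fun; exact: continuous_cos. Qed.

Lemma measurable_sin {R : realType} : measurable_fun setT (@sin R).
Proof. by apply: continuous_measurable_fun; exact: continuous_sin. Qed.

Lemma mEFin {R : realType} d (T : measurableType d) (f : T -> R) :
  measurable_fun setT f -> measurable_fun setT (fun x => (f x)%:E).
Proof. by move=> mf; apply/measurable_EFinP. Qed.

Lemma oneDcos_ge0 {R : realType} (x : R) : 0 <= 1 + cos x.
Proof. by rewrite -lerBlDl sub0r cos_geN1. Qed.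

(** * Integration over column vectors, one coordinate at a time *)

Section cV_integration.
Context {R : realType}.
Local Notation mu := (@lebesgue_measure R).

Lemma measurable_dotp d disp (T : measurableType disp) (f g : T -> 'cV[R]_d) :
  measurable_fun setT f -> measurable_fun setT g ->
  measurable_fun setT (fun x => dotp (f x) (g x)).
Proof.
move=> mf mg; rewrite /dotp.
under eq_fun do rewrite -big_enum/=.
apply: measurable_sum => i.
by apply: measurable_funM; [exact: (measurableT_comp (measurable_coord i) mf)|
  exact: (measurableT_comp (measurable_coord i) mg)].
Qed.

Lemma measurable_prod_coord d disp (T : measurableType disp)
    (g : 'I_d -> R -> R) (f : T -> 'cV[R]_d) :
  (forall i, measurable_fun setT (g i)) -> measurable_fun setT f ->
  measurable_fun setT (fun x => \prod_(i < d) g i (f x i ord0)).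
Proof.
move=> mg mf; under eq_fun do rewrite -big_enum/=.
apply: measurable_prod => i _.
by apply: (measurableT_comp (mg i)); exact: (measurableT_comp (measurable_coord i) mf).
Qed.

Lemma measurable_prod_coordT d (g : 'I_d -> R -> R) :
  (forall i, measurable_fun setT (g i)) ->
  measurable_fun setT (fun x : 'cV[R]_d => \prod_(i < d) g i (x i ord0)).
Proof. by move=> mg; apply: (measurable_prod_coord mg); exact: measurable_id. Qed.

Lemma cV_cons0 n (a : R) (x : 'cV[R]_n) : cV_cons (a, x) ord0 ord0 = a.
Proof. by rewrite mxE unlift_none. Qed.

Lemma cV_consS n (a : R) (x : 'cV[R]_n) i :
  cV_cons (a, x) (lift ord0 i) ord0 = x i ord0.
Proof. by rewrite mxE liftK. Qed.

Lemma dotp_cV_cons n (u : 'cV[R]_n.+1) (a : R) (x : 'cV[R]_n) :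
  dotp u (cV_cons (a, x)) =
  u ord0 ord0 * a + dotp (cV_uncons u).2 x.
Proof.
rewrite /dotp big_ord_recl cV_cons0; congr (_ + _).
by apply: eq_bigr => i _; rewrite cV_consS mxE.
Qed.

Lemma ge0_integral_cVS n (f : 'cV[R]_n.+1 -> \bar R) :
  measurable_fun setT f -> (forall x, 0 <= f x)%E ->
  (\int[lebesgue_cV n.+1]_z f z =
   \int[mu]_a \int[lebesgue_cV n]_x f (cV_cons (a, x)))%E.
Proof.
move=> mf f0.
rewrite ge0_integral_pushforward//.
rewrite preimage_setT fubini_tonelli1//.
  exact: (measurableT_comp mf (@measurable_cV_cons R n)).
by move=> x /=.
Qed.

Lemma ge0_integral_cV0 (f : 'cV[R]_0 -> \bar R) :
  measurable_fun setT f -> (forall x, 0 <= f x)%E ->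
  (\int[lebesgue_cV 0]_z f z = f 0%R)%E.
Proof. by move=> mf f0; rewrite integral_dirac// diracT mul1e. Qed.

Lemma ge0_integral_prod_coord n (g : 'I_n -> R -> R) :
  (forall i, measurable_fun setT (g i)) -> (forall i x, 0 <= g i x) ->
  (\int[lebesgue_cV n]_z (\prod_(i < n) g i (z i ord0))%:E =
   \prod_(i < n) \int[mu]_x (g i x)%:E)%E.
Proof.
elim: n g => [|n IHn] g mg g0.
  rewrite ge0_integral_cV0; first by rewrite !big_ord0.
    by apply/measurable_EFinP; apply: measurable_prod_coordT.
  by move=> x; rewrite big_ord0.
rewrite ge0_integral_cVS; first last.
- by move=> x; rewrite lee_fin prodr_ge0.
- by apply/measurable_EFinP; apply: measurable_prod_coordT.
rewrite big_ord_recl -IHn//.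
rewrite -ge0_integralZr//; first last.
- by apply: integral_ge0 => x _; rewrite lee_fin prodr_ge0.
- by move=> x _; rewrite lee_fin.
- by apply/measurable_EFinP; exact: (mg ord0).
apply: eq_integral => a _.
rewrite -ge0_integralZl//; first last.
- by rewrite lee_fin.
- by move=> x _; rewrite lee_fin prodr_ge0.
- apply/measurable_EFinP.
  by apply: (@measurable_prod_coordT n (fun i => g (lift ord0 i))).
apply: eq_integral => x _; rewrite big_ord_recl cV_cons0 -EFinM.
by congr (_ * _)%:E; apply: eq_bigr => i _; rewrite cV_consS.
Qed.

End cV_integration.

(** * The Laplace-Cauchy transform pair in dimension one *)

Section laplace_cauchy_1d.
Context {R : realType}.
Local Notation mu := (@lebesgue_measure R).

Lemma expR_damped_cvg0 (e x a b c : R) : 0 < e ->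
  expR (- (e * z)) * (b * sin (x * z + a) + c * cos (x * z + a)) @[z --> +oo]
  --> (0 : R).
Proof.
move=> e0.
have E0 : expR (- (e * z)) * (`|b| + `|c|) @[z --> +oo] --> (0 : R).
  rewrite -[X in _ --> X](mul0r (`|b| + `|c|)); apply: cvgMr_tmp.
  apply: (@cvg_comp _ _ _ (fun z : R => e * z) (fun z => expR (- z)) _ +oo).
    by apply: gt0_cvgMry => //; exact: cvg_id.
  exact: cvgr_expR.
apply/cvgr0Pnorm_lt => eps eps0.
move/cvgr0Pnorm_lt : E0 => /(_ _ eps0) H.
near=> z.
have: `|expR (- (e * z)) * (`|b| + `|c|)| < eps by near: z.
apply: le_lt_trans; rewrite !normrM ler_wpM2l//.
rewrite (le_trans (ler_normD _ _))// [leRHS]ger0_norm ?addr_ge0//.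
by rewrite !normrM lerD// ler_piMr// ?sin_max ?cos_max.
Unshelve. all: by end_near. Qed.

Lemma continuous_expR_cos (e x a : R) : continuous (fun z : R =>
  expR (- (e * z)) * (1 + cos (x * z + a))).
Proof.
move=> z; apply: cvgM.
  apply: continuous_comp; last exact: continuous_expR.
  apply: cvgN; apply: cvgMl_tmp; exact: cvg_id.
apply: cvgD; first exact: cvg_cst.
apply: continuous_comp; last exact: continuous_cos.
apply: cvgD; last exact: cvg_cst.
apply: cvgMl_tmp; exact: cvg_id.
Qed.

(** The summand 1 keeps the integrand nonnegative, so that the fundamental theorem of calculus on a
    half-line, and later Tonelli's theorem, apply; [Rintegral_laplace_cV_cos] removes it at the
    end. *)
Lemma integral0y_expR_cos (e x a : R) : 0 < e ->
  (\int[mu]_(z in `[0%R, +oo[) (expR (- (e * z)) * (1 + cos (x * z + a)))%:E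
   = (e^-1 + (e * cos a - x * sin a) / (e ^+ 2 + x ^+ 2))%:E)%E.
Proof.
move=> e0.
have D0 : e ^+ 2 + x ^+ 2 != 0.
  by rewrite gt_eqF// ltr_pwDl ?sqr_ge0// exprn_gt0.
(* The oscillating part is the real part of [exp ((- e + i x) z + i a) / (- e + i x)]. *)
pose F z := expR (- (e * z)) * (- e^-1) + expR (- (e * z)) *
  (x / (e ^+ 2 + x ^+ 2) * sin (x * z + a) +
   - e / (e ^+ 2 + x ^+ 2) * cos (x * z + a)).
have dF (z : R) : is_derive z 1 F (expR (- (e * z)) * (1 + cos (x * z + a))).
  rewrite /F; apply: is_derive_eq.
  rewrite /GRing.scale/= !mulr1 !mulr0 !add0r !addr0.
  by field; rewrite D0 gt_eqF.
rewrite (@ge0_continuous_FTC2y _ _ F 0 0)//.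
- rewrite -EFinB; congr EFin.
  rewrite /F !mulr0 oppr0 expR0 !mul1r !add0r; by field; rewrite D0 gt_eqF.
- exact/continuous_subspaceT/continuous_expR_cos.
- rewrite -[X in _ --> X](addr0 (0:R)); apply: cvgD; last exact: expR_damped_cvg0.
  have := @expR_damped_cvg0 e 0 0 0 (- e^-1) e0.
  by under eq_fun do rewrite !mul0r !add0r cos0 mulr1.
- apply: cvg_at_right_filter; apply: differentiable_continuous.
  by apply/derivable1_diffP.
- by move=> z _; rewrite derive1E; exact: derive_val.
Qed.

Definition laplace_kernel (e z : R) : R := expR (- (e * `|z|)).

(** The Fourier transform of [laplace_kernel e]. Its mass is [2 * pi] for every [e > 0] and it
    concentrates at 0 as [e] tends to 0, whence its use as a mollifier. *)
Definition cauchy_kernel (e x : R) : R := 2 * e / (e ^+ 2 + x ^+ 2).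

Lemma laplace_kernel_ge0 e z : 0 <= laplace_kernel e z.
Proof. exact: expR_ge0. Qed.

Lemma laplace_kernel_le1 e z : 0 <= e -> laplace_kernel e z <= 1.
Proof. by move=> e0; rewrite expR_le1 oppr_le0 mulr_ge0. Qed.

Lemma cauchy_kernel_ge0 e x : 0 <= e -> 0 <= cauchy_kernel e x.
Proof. by move=> e0; rewrite divr_ge0 ?addr_ge0 ?sqr_ge0// mulr_ge0. Qed.

Lemma cauchy_kernel_le e x : 0 < e -> cauchy_kernel e x <= 2 / e.
Proof.
move=> e0; rewrite /cauchy_kernel.
rewrite ler_pdivrMr ?ltr_pwDl ?sqr_ge0 ?exprn_gt0//.
rewrite (_ : 2 * e = 2 / e * e ^+ 2); last by field; rewrite gt_eqF.
by rewrite ler_wpM2l ?lerDl ?sqr_ge0// divr_ge0 ?ltW.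
Qed.

Lemma measurable_laplace_kernel e : measurable_fun setT (laplace_kernel e).
Proof.
apply: measurableT_comp => //; apply: measurable_funN.
by apply: measurable_funM => //.
Qed.

Lemma measurable_cauchy_kernel e : e != 0 -> measurable_fun setT (cauchy_kernel e).
Proof.
move=> e0; apply: continuous_measurable_fun => x.
apply: cvgMl_tmp; apply: cvgV.
  by rewrite gt_eqF// ltr_pwDl ?sqr_ge0// exprn_even_gt0.
by apply: cvgD; [exact: cvg_cst|exact: exprn_continuous].
Qed.

Lemma ge0_integralT_split0 (f : R -> R) : measurable_fun setT f ->
  (forall x, 0 <= f x) ->
  (\int[mu]_x (f x)%:E = \int[mu]_(x in `[0%R, +oo[) (f x)%:E +
                         \int[mu]_(x in `[0%R, +oo[) (f (- x))%:E)%E.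
Proof.
move=> mf f0.
rewrite -(setUv [set x : R | 0 <= x]%R) -set_itvcy ge0_integral_setU//=; last 4 first.
- exact: measurableC.
- by rewrite setUv; apply/measurable_EFinP; exact: mf.
- by move=> z _; rewrite lee_fin f0.
- exact/disj_setPCl.
rewrite setCitvr integral_itv_bndo_bndc; last exact/measurable_EFinP/measurable_funTS.
congr (_ + _)%E; rewrite [RHS](@ge0_integration_by_substitution0 _ (fun x => (f (- x))%:E))//.
- by apply: eq_integral => x _; rewrite opprK.
- by apply: mEFin; apply: (measurableT_comp mf); exact: oppr_measurable.
- by move=> r; rewrite lee_fin.
Qed.

Lemma integral_laplace_1Dcos (e x a : R) : 0 < e ->
  (\int[mu]_z (laplace_kernel e z * (1 + cos (x * z + a)))%:E
   = (2 / e + cos a * cauchy_kernel e x)%:E)%E.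
Proof.
move=> e0; rewrite ge0_integralT_split0; first last.
- by move=> z; rewrite mulr_ge0 ?expR_ge0// oneDcos_ge0.
- apply: measurable_funM; first exact: measurable_laplace_kernel.
  apply: measurable_funD => //; apply: measurableT_comp.
    exact: measurable_cos.
  by apply: measurable_funD => //; exact: measurable_funM.
transitivity (\int[mu]_(z in `[0%R, +oo[) (expR (- (e * z)) * (1 + cos (x * z + a)))%:E
   + \int[mu]_(z in `[0%R, +oo[) (expR (- (e * z)) * (1 + cos ((- x) * z + a)))%:E)%E.
  congr (_ + _)%E; apply: eq_integral => z; rewrite inE/= in_itv/= ?andbT => z0.
    by rewrite /laplace_kernel ger0_norm.
  by rewrite /laplace_kernel normrN ger0_norm// mulrN mulNr.
rewrite !integral0y_expR_cos// -EFinD; congr EFin.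
rewrite /cauchy_kernel; field.
by rewrite !gt_eqF// ltr_pwDl ?sqr_ge0// exprn_gt0.
Qed.

Lemma integral_laplace (e : R) : 0 < e ->
  (\int[mu]_z (laplace_kernel e z)%:E = (2 / e)%:E)%E.
Proof.
move=> e0; have := integral_laplace_1Dcos 0 (pi / 2) e0.
rewrite cos_pihalf mul0r addr0 => <-; apply: eq_integral => z _.
by rewrite mul0r add0r cos_pihalf addr0 mulr1.
Qed.

(** With weights [B <= A] instead of the plain [1 + cos], the class of integrands is stable under
    integrating coordinates out. *)
Lemma ge0_integral_laplace_cos (A B e x a : R) : 0 < e -> 0 <= B <= A ->
  (\int[mu]_z (laplace_kernel e z * (A + B * cos (x * z + a)))%:E
   = (A * (2 / e) + B * (cos a * cauchy_kernel e x))%:E)%E.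
Proof.
move=> e0 /andP[B0 BA].
have m1 : measurable_fun setT (fun z : R => laplace_kernel e z * (1 + cos (x * z + a))).
  apply: measurable_funM; first exact: measurable_laplace_kernel.
  apply: measurable_funD => //; apply: measurableT_comp.
    exact: measurable_cos.
  by apply: measurable_funD => //; exact: measurable_funM.
transitivity (\int[mu]_z ((A - B)%:E * (laplace_kernel e z)%:E +
   B%:E * (laplace_kernel e z * (1 + cos (x * z + a)))%:E))%E.
  by apply: eq_integral => z _; rewrite -!EFinM -EFinD; congr EFin; ring.
rewrite ge0_integralD//; last 4 first.
- by move=> z _; rewrite -EFinM lee_fin mulr_ge0 ?subr_ge0 ?laplace_kernel_ge0.
- by apply: measurable_funeM; exact: (mEFin (measurable_laplace_kernel e)).
- by move=> z _; rewrite -EFinM lee_fin ?mulr_ge0 ?laplace_kernel_ge0 ?oneDcos_ge0.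
- by apply: measurable_funeM; exact: mEFin.
rewrite !ge0_integralZl_EFin ?subr_ge0//; last 4 first.
- by move=> z _; rewrite lee_fin ?mulr_ge0 ?laplace_kernel_ge0 ?oneDcos_ge0.
- exact: mEFin.
- by move=> z _; rewrite lee_fin laplace_kernel_ge0.
- exact: (mEFin (measurable_laplace_kernel e)).
rewrite integral_laplace// integral_laplace_1Dcos// -!EFinM -EFinD; congr EFin.
by ring.
Qed.

Lemma is_derive_continuous (F : R -> R) (x l : R) :
  is_derive x 1 F l -> {for x, continuous F}.
Proof.
move=> dF; apply: differentiable_continuous; apply/derivable1_diffP.
exact: ex_derive.
Qed.

Lemma is_derive_atan_scaled (e c x : R) : 0 < e ->
  is_derive x 1 (fun x => 2 * atan ((x - c) / e)) (cauchy_kernel e (x - c)).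
Proof.
move=> e0; apply: is_derive_eq.
rewrite /cauchy_kernel /GRing.scale/= mulr0 add0r subr0 mulr1.
field; rewrite !gt_eqF//=.
  by rewrite ltr_pwDl ?sqr_ge0 ?exprn_gt0.
Qed.

Lemma continuous_cauchy_kernel (e c : R) : 0 < e ->
  continuous (fun x => cauchy_kernel e (x - c)).
Proof.
move=> e0 x; apply: cvgMl_tmp; apply: cvgV.
  by rewrite gt_eqF// ltr_pwDl ?sqr_ge0 ?exprn_gt0.
apply: cvgD; first exact: cvg_cst.
apply: (@continuous_comp _ _ _ (fun x => x - c) (fun x => x ^+ 2)); last exact: exprn_continuous.
by apply: cvgB; [exact: cvg_id|exact: cvg_cst].
Qed.

Lemma integral0y_cauchy (e c : R) : 0 < e ->
  (\int[mu]_(x in `[0%R, +oo[) (cauchy_kernel e (x - c))%:E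
   = (pi - 2 * atan (- c / e))%:E)%E.
Proof.
move=> e0.
have dF x := is_derive_atan_scaled c x e0.
rewrite (@ge0_continuous_FTC2y _ _ (fun x => 2 * atan ((x - c) / e)) 0 pi)//.
- by rewrite sub0r.
- by move=> x _; rewrite cauchy_kernel_ge0// ltW.
- by apply: continuous_subspaceT; exact: continuous_cauchy_kernel.
- rewrite (_ : pi = 2 * (pi / 2)); last by field.
  apply: cvgMl_tmp; apply: (@cvg_comp _ _ _ (fun x : R => (x - c) / e) _ _ +oo); last exact: cvgy_atan.
  by apply: gt0_cvgMly; [rewrite invr_gt0|exact: cvg_addrr].
- by apply: cvg_at_right_filter; exact: (is_derive_continuous (dF 0)).
- by move=> z _; rewrite derive1E; exact: derive_val.
Qed.

Lemma integral_cauchy (e c : R) : 0 < e ->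
  (\int[mu]_x (cauchy_kernel e (x - c))%:E = (2 * pi)%:E)%E.
Proof.
move=> e0; rewrite ge0_integralT_split0; first last.
- by move=> x; rewrite cauchy_kernel_ge0// ltW.
- by apply: continuous_measurable_fun; exact: continuous_cauchy_kernel.
rewrite [X in (_ + X)%E](_ : _ = \int[mu]_(x in `[0%R, +oo[) (cauchy_kernel e (x - - c))%:E)%E.
  rewrite !integral0y_cauchy// -EFinD opprK mulNr atanN; congr EFin; ring.
apply: eq_integral => x _; congr EFin; rewrite /cauchy_kernel; congr (_ / (_ + _)).
by rewrite -sqrrN; congr (_ ^+ 2); ring.
Qed.

Lemma integral_cauchy_itv (e c a b : R) : 0 < e -> a < b ->
  (\int[mu]_(x in `[a, b]) (cauchy_kernel e (x - c))%:E =
   (2 * atan ((b - c) / e) - 2 * atan ((a - c) / e))%:E)%E.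
Proof.
move=> e0 ab; have dF x := is_derive_atan_scaled c x e0.
have cF x : {for x, continuous (fun x => 2 * atan ((x - c) / e))}.
  exact: (is_derive_continuous (dF x)).
rewrite (@continuous_FTC2 _ _ (fun x => 2 * atan ((x - c) / e)))//.
- by apply: continuous_subspaceT; exact: continuous_cauchy_kernel.
- split.
  + by move=> x _; exact: ex_derive.
  + by apply: cvg_at_right_filter; exact: cF.
  + by apply: cvg_at_left_filter; exact: cF.
- by move=> z _; rewrite derive1E; exact: derive_val.
Qed.

End laplace_cauchy_1d.

(** * The transform pair in dimension d *)

Section laplace_cauchy_cV.
Context {R : realType}.
Local Notation mu := (@lebesgue_measure R).

Definition laplace_cV d (e : R) (z : 'cV[R]_d) : R :=
  \prod_(i < d) laplace_kernel e (z i ord0).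

Definition cauchy_cV d (e : R) (x : 'cV[R]_d) : R :=
  \prod_(i < d) cauchy_kernel e (x i ord0).

Lemma laplace_cV_ge0 d e (z : 'cV[R]_d) : 0 <= laplace_cV e z.
Proof. by apply: prodr_ge0 => i _; exact: laplace_kernel_ge0. Qed.

Lemma laplace_cV_le1 d e (z : 'cV[R]_d) : 0 <= e -> laplace_cV e z <= 1.
Proof.
move=> e0; rewrite -[leRHS](expr1n R d) -[X in _ ^+ X](card_ord d) -prodr_const.
by apply: ler_prod => i _; rewrite laplace_kernel_ge0 laplace_kernel_le1.
Qed.

Lemma cauchy_cV_ge0 d e (x : 'cV[R]_d) : 0 <= e -> 0 <= cauchy_cV e x.
Proof. by move=> e0; apply: prodr_ge0 => i _; exact: cauchy_kernel_ge0. Qed.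

Lemma cauchy_cV_le d e (x : 'cV[R]_d) : 0 < e -> cauchy_cV e x <= (2 / e) ^+ d.
Proof.
move=> e0; rewrite -[X in _ <= _ ^+ X](card_ord d) -prodr_const.
by apply: ler_prod => i _; rewrite cauchy_kernel_ge0 ?cauchy_kernel_le// ltW.
Qed.

Lemma measurable_laplace_cV d e : measurable_fun setT (@laplace_cV d e).
Proof.
by apply: (@measurable_prod_coordT R d (fun=> laplace_kernel e)) => i; exact: measurable_laplace_kernel.
Qed.

Lemma measurable_cauchy_cV d e : e != 0 -> measurable_fun setT (@cauchy_cV d e).
Proof.
by move=> e0; apply: (@measurable_prod_coordT R d (fun=> cauchy_kernel e)) => i; exact: measurable_cauchy_kernel.
Qed.

Lemma laplace_cV_cons n e (a : R) (x : 'cV[R]_n) :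
  laplace_cV e (cV_cons (a, x)) = laplace_kernel e a * laplace_cV e x.
Proof.
rewrite /laplace_cV big_ord_recl cV_cons0; congr (_ * _).
by apply: eq_bigr => i _; rewrite cV_consS.
Qed.

Lemma cauchy_cV_uncons n e (x : 'cV[R]_n.+1) :
  cauchy_cV e x = cauchy_kernel e (x ord0 ord0) * cauchy_cV e (cV_uncons x).2.
Proof.
rewrite /cauchy_cV big_ord_recl; congr (_ * _).
by apply: eq_bigr => i _; rewrite mxE.
Qed.

Lemma measurable_laplace_cV_cos d (A B e : R) (x : 'cV[R]_d) (a : R) :
  measurable_fun setT
    (fun z => laplace_cV e z * (A + B * cos (dotp x z + a))).
Proof.
apply: measurable_funM; first exact: measurable_laplace_cV.
apply: measurable_funD => //; apply: measurable_funM => //.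
apply: (measurableT_comp measurable_cos).
apply: measurable_funD => //; apply: measurable_dotp; first exact: measurable_cst.
exact: measurable_id.
Qed.

Lemma ge0_ABcos (A B u : R) : 0 <= B <= A -> 0 <= A + B * cos u.
Proof.
move=> /andP[B0 BA]; rewrite (_ : _ + _ = A - B + B * (1 + cos u)); last by ring.
by rewrite addr_ge0 ?subr_ge0// mulr_ge0 ?oneDcos_ge0.
Qed.

(** Induction on the dimension: integrating out all coordinates but the first leaves an integrand of
    the same form, with weights [A * (2 / e)^d] and [B * cauchy_cV e x']; [cauchy_cV_le] keeps the
    second below the first. *)
Lemma ge0_integral_laplace_cV_cos d (A B e : R) (x : 'cV[R]_d) (a : R) :
  0 < e -> 0 <= B <= A ->
  (\int[lebesgue_cV d]_z (laplace_cV e z * (A + B * cos (dotp x z + a)))%:E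
   = (A * (2 / e) ^+ d + B * (cos a * cauchy_cV e x))%:E)%E.
Proof.
move=> e0; elim: d A B x a => [|d IHd] A B x a /andP[B0 BA].
  rewrite ge0_integral_cV0; first last.
  - by move=> z; rewrite lee_fin mulr_ge0 ?laplace_cV_ge0 ?ge0_ABcos ?B0.
  - by apply: mEFin; exact: measurable_laplace_cV_cos.
  by rewrite /laplace_cV /cauchy_cV /dotp !big_ord0 mul1r add0r expr0 !mulr1.
rewrite ge0_integral_cVS; first last.
- by move=> z; rewrite lee_fin mulr_ge0 ?laplace_cV_ge0 ?ge0_ABcos ?B0.
- by apply: mEFin; exact: measurable_laplace_cV_cos.
pose x' := (cV_uncons x).2.
transitivity (\int[mu]_z (laplace_kernel e z * (A * (2 / e) ^+ d +
   (B * cauchy_cV e x') * cos (x ord0 ord0 * z + a)))%:E)%E.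
  apply: eq_integral => z _.
  transitivity (\int[lebesgue_cV d]_y ((laplace_kernel e z)%:E *
    (laplace_cV e y * (A + B * cos (dotp x' y + (x ord0 ord0 * z + a))))%:E))%E.
    apply: eq_integral => y _; rewrite -EFinM laplace_cV_cons dotp_cV_cons.
    by rewrite mulrA addrCA addrA.
  rewrite ge0_integralZl_EFin ?laplace_kernel_ge0//; last 2 first.
  - by move=> y _; rewrite lee_fin mulr_ge0 ?laplace_cV_ge0 ?ge0_ABcos ?B0.
  - by apply: mEFin; exact: measurable_laplace_cV_cos.
  by rewrite IHd ?B0// -EFinM; congr (_ * _)%:E; congr (_ + _); ring.
rewrite ge0_integral_laplace_cos//; last first.
  rewrite mulr_ge0 ?cauchy_cV_ge0 ?(ltW e0)//= ler_pM ?cauchy_cV_ge0 ?cauchy_cV_le ?(ltW e0)//.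
by rewrite cauchy_cV_uncons exprSr; congr EFin; rewrite /x'; ring.
Qed.

Lemma integral_laplace_cV d (e : R) : 0 < e ->
  (\int[lebesgue_cV d]_z (laplace_cV e z)%:E = ((2 / e) ^+ d)%:E)%E.
Proof.
move=> e0; have := @ge0_integral_laplace_cV_cos d 1 0 e 0 0 e0.
rewrite lexx ler01 mul0r addr0 mul1r => <-//.
by apply: eq_integral => z _; rewrite mul0r addr0 mulr1.
Qed.

Lemma integrable_laplace_cV d (e : R) : 0 < e ->
  (lebesgue_cV d).-integrable setT (EFin \o @laplace_cV d e).
Proof.
move=> e0; apply/integrableP; split; first by apply: mEFin; exact: measurable_laplace_cV.
under eq_integral do rewrite /= ger0_norm ?laplace_cV_ge0//.
by rewrite integral_laplace_cV// ltry.
Qed.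

Lemma integrable_laplace_cV_cos d (e : R) (x : 'cV[R]_d) a : 0 < e ->
  (lebesgue_cV d).-integrable setT
    (EFin \o (fun z => laplace_cV e z * cos (dotp x z + a))).
Proof.
move=> e0; apply: (@le_integrable _ _ _ _ _ _ _ (EFin \o @laplace_cV d e)) => //.
- have := @measurable_laplace_cV_cos d 0 1 e x a.
  under eq_fun do rewrite add0r mul1r.
  exact: mEFin.
- move=> z _; rewrite /= lee_fin normrM ler_piMr ?cos_max//.
- exact: integrable_laplace_cV.
Qed.

Lemma Rintegral_laplace_cV_cos d (e : R) (x : 'cV[R]_d) a : 0 < e ->
  \int[lebesgue_cV d]_z (laplace_cV e z * cos (dotp x z + a)) =
  cos a * cauchy_cV e x.
Proof.
move=> e0.
have H : \int[lebesgue_cV d]_z (laplace_cV e z * (1 + 1 * cos (dotp x z + a)))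
    = (2 / e) ^+ d + cos a * cauchy_cV e x.
  by rewrite /Rintegral ge0_integral_laplace_cV_cos ?ler01 ?lexx//= !mul1r.
have : \int[lebesgue_cV d]_z (laplace_cV e z + laplace_cV e z * cos (dotp x z + a))
    = (2 / e) ^+ d + cos a * cauchy_cV e x.
  by rewrite -H; apply: eq_Rintegral => z _; rewrite mul1r mulrDr mulr1.
rewrite RintegralD//; last 2 first.
- exact: integrable_laplace_cV.
- exact: integrable_laplace_cV_cos.
by rewrite {1}/Rintegral integral_laplace_cV//= => /addrI.
Qed.

Lemma integral_cauchy_cV d (e : R) (c : 'cV[R]_d) : 0 < e ->
  (\int[lebesgue_cV d]_x (cauchy_cV e (x - c))%:E = ((2 * pi) ^+ d)%:E)%E.
Proof.
move=> e0.
transitivity (\int[lebesgue_cV d]_x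
    (\prod_(i < d) cauchy_kernel e (x i ord0 - c i ord0))%:E)%E.
  by apply: eq_integral => x _; congr EFin; apply: eq_bigr => i _; rewrite !mxE.
rewrite (@ge0_integral_prod_coord R d (fun i x => cauchy_kernel e (x - c i ord0))).
- under eq_bigr do rewrite integral_cauchy//.
  by rewrite prodEFin prodr_const card_ord.
- by move=> i; apply: continuous_measurable_fun; exact: continuous_cauchy_kernel.
- by move=> i x; rewrite cauchy_kernel_ge0// ltW.
Qed.

End laplace_cauchy_cV.

(** * Real-valued integrals: Fubini and dominated convergence *)

Section real_integration.
Context {R : realType}.

Lemma Rintegral_EFin d (T : measurableType d) (m : {measure set T -> \bar R})
    (D : set T) (f : T -> R) : measurable D -> m.-integrable D (EFin \o f) ->
  (\int[m]_(x in D) (f x)%:E)%E = (\int[m]_(x in D) f x)%:E.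
Proof. by move=> mD fi; rewrite /Rintegral fineK//; exact: integrable_fin_num. Qed.

Lemma Rintegral_prob_cst d (T : measurableType d) (P : probability T R) (M : R) :
  \int[P]_x (cst M x) = M.
Proof.
rewrite Rintegral_cst// (_ : fine _ = 1) ?mulr1//.
by have /(congr1 fine) := @probability_setT _ _ _ P.
Qed.

Lemma integral_prob_cst d (T : measurableType d) (P : probability T R) (M : \bar R) :
  (\int[P]_x (cst M x) = M)%E.
Proof.
rewrite integral_cst//; have E := @probability_setT _ _ _ P.
by rewrite [X in (_ * X)%E](E : _ = 1%E) mule1.
Qed.

Lemma prob_bounded_integrable d (T : measurableType d) (P : probability T R)
    (f : T -> R) (M : R) : measurable_fun setT f -> (forall x, `|f x| <= M) ->
  P.-integrable setT (EFin \o f).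
Proof.
move=> mf fM; apply: measurable_bounded_integrable => //.
- exact: fin_num_fun_lty.
- exists M; split; first exact: num_real.
  by move=> x Mx y _ /=; apply: le_trans (fM y) _; exact: ltW.
Qed.

Lemma prob_bounded_Rintegral d (T : measurableType d) (P : probability T R)
    (f : T -> R) (M : R) : measurable_fun setT f -> (forall x, `|f x| <= M) ->
  `| \int[P]_x f x | <= M.
Proof.
move=> mf fM; have fi := prob_bounded_integrable P mf fM.
rewrite (le_trans (le_normr_Rintegral measurableT fi))//.
rewrite (@le_trans _ _ (\int[P]_x (cst M) x))//; last first.
  by rewrite Rintegral_prob_cst.
apply: le_Rintegral => //.
- exact: integrable_norm.
- apply: (@prob_bounded_integrable _ _ _ _ `|M|) => // x; exact: ler_norm.
Qed.

Section weighted_fubini.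
Context d1 d2 (T1 : measurableType d1) (T2 : measurableType d2).
Variables (m : {sigma_finite_measure set T1 -> \bar R}) (P : probability T2 R).
Variables (w : T1 -> R) (k : T1 -> T2 -> R) (M : R).
Hypothesis wi : m.-integrable setT (EFin \o w).
Hypothesis mk : measurable_fun setT (fun xy : T1 * T2 => k xy.1 xy.2).
Hypothesis kM : forall x y, `|k x y| <= M.

Let mw : measurable_fun setT w.
Proof. by move/integrableP : wi => [/measurable_EFinP]. Qed.

Let mf : measurable_fun setT (fun xy : T1 * T2 => (w xy.1 * k xy.1 xy.2)%:E).
Proof.
apply: mEFin; apply: measurable_funM => //.
by apply: (measurableT_comp mw); exact: measurable_fst.
Qed.

Lemma integrable_weight1 x : P.-integrable setT (fun y => (k x y)%:E).
Proof.
apply: (@prob_bounded_integrable _ _ _ _ M) => //.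
exact: (measurableT_comp mk (pair1_measurable x)).
Qed.

Lemma integrable_weight2 y : m.-integrable setT (fun x => (w x * k x y)%:E).
Proof.
have H := @integrableMl _ _ _ m setT measurableT (EFin \o w) (k ^~ y) wi.
rewrite (_ : (fun x => _) = (EFin \o w) \* (EFin \o (k ^~ y)))%E//; apply: H.
  exact: (measurableT_comp mk (pair2_measurable y)).
exists M; split; first exact: num_real.
by move=> x Mx z _ /=; apply: le_trans (kM z y) _; exact: ltW.
Qed.

(** An integrable weight times a bounded kernel is integrable on the product because [P] has mass
    one. This covers oscillating kernels such as [cos], to which Tonelli's theorem does not apply
    directly. *)
Lemma integrable_weight12 :
  (m \x P)%E.-integrable setT (fun xy : T1 * T2 => (w xy.1 * k xy.1 xy.2)%:E).
Proof.
apply/integrable12ltyP => //=.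
apply: (@le_lt_trans _ _ (\int[m]_x (`|M|%:E * `|(w x)%:E|)))%E; last first.
  rewrite ge0_integralZl_EFin//; last exact: measurableT_comp (mEFin mw).
  by move/integrableP : wi => [_ wlty]; rewrite lte_mul_pinfty.
apply: ge0_le_integral => //.
- by move=> x _; exact: integral_ge0.
- apply: (measurable_fun_fubini_tonelli_F (fun xy : T1 * T2 => `|(w xy.1 * k xy.1 xy.2)%:E|%E)) => //.
  exact: measurableT_comp mf.
- by apply: measurable_funeM; exact: measurableT_comp (mEFin mw).
- move=> x _.
  rewrite (@le_trans _ _ (\int[P]_y (cst (`|M|%:E * `|(w x)%:E|) y)))%E//; last first.
    by rewrite integral_prob_cst.
  apply: ge0_le_integral => //.
  + apply: mEFin; apply: measurableT_comp => //; apply: measurable_funM => //.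
    exact: (measurableT_comp mk (pair1_measurable x)).
  + move=> y _; rewrite /= lee_fin normrM mulrC ler_wpM2r//.
    by rewrite (le_trans (kM _ _))// ler_norm.
Qed.

Lemma Rintegral_weight :
  \int[m]_x (w x * \int[P]_y k x y) = \int[P]_y \int[m]_x (w x * k x y).
Proof.
have := Fubini integrable_weight12.
move=> E; apply: (congr1 fine).
transitivity (\int[m]_x \int[P]_y (w x * k x y)%:E)%E.
  apply: eq_integral => x _; rewrite Rintegral_EFin//.
    by rewrite RintegralZl//; exact: integrable_weight1.
  have := integrableZl measurableT (w x) (integrable_weight1 x).
  by apply: eq_integrable.
rewrite E; apply: eq_integral => y _.
by rewrite Rintegral_EFin//; exact: integrable_weight2.
Qed.

End weighted_fubini.

(** Measurability of an integral in its parameter comes from Tonelli's theorem, hence for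
    nonnegative kernels; adding the bound [M] reduces to that case. *)
Lemma measurable_Rintegral_prob d1 d2 (T1 : measurableType d1)
    (T2 : measurableType d2) (P : probability T2 R) (k : T1 -> T2 -> R) (M : R) :
  measurable_fun setT (fun xy : T1 * T2 => k xy.1 xy.2) ->
  (forall x y, `|k x y| <= M) ->
  measurable_fun setT (fun x => \int[P]_y k x y).
Proof.
move=> mk kM.
have kx x : measurable_fun setT (k x) by exact: (measurableT_comp mk (pair1_measurable x)).
have H : measurable_fun setT (fun x => \int[P]_y (M + k x y)%:E)%E.
  apply: (measurable_fun_fubini_tonelli_F (fun xy : T1 * T2 => (M + k xy.1 xy.2)%:E)).
    by apply: mEFin; exact: measurable_funD.
  by move=> [x y]; rewrite lee_fin -lerBlDl sub0r lerNl (le_trans (ler_norm _))// normrN.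
have E x : \int[P]_y k x y = fine (\int[P]_y (M + k x y)%:E)%E - M.
  rewrite [fine _](@RintegralD _ _ _ _ _ (cst M) (k x))//.
  - by rewrite Rintegral_prob_cst addrC addKr.
  - by apply: (@prob_bounded_integrable _ _ _ _ `|M|) => // y; exact: ler_norm.
  - exact: (@prob_bounded_integrable _ _ _ _ M).
under eq_fun do rewrite E.
apply: measurable_funB => //; apply: measurableT_comp => //; exact: H.
Qed.

Lemma Rdominated_cvg d (T : measurableType d) (m : {measure set T -> \bar R})
    (D : set T) (f_ : nat -> T -> R) (f g : T -> R) :
  measurable D -> (forall n, measurable_fun D (f_ n)) -> measurable_fun D f ->
  (forall x, D x -> f_ n x @[n --> \oo] --> f x) ->
  m.-integrable D (EFin \o g) -> (forall n x, D x -> `|f_ n x| <= g x) ->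
  \int[m]_(x in D) f_ n x @[n --> \oo] --> \int[m]_(x in D) f x.
Proof.
move=> mD mf_ mf cf ig fg.
have [fi _ cv] : [/\ m.-integrable D (EFin \o f),
   [sequence \int[m]_(x in D) (`|(f_ n x)%:E - (f x)%:E|)]_n @ \oo --> 0 &
   [sequence \int[m]_(x in D) ((f_ n x)%:E)]_n @ \oo --> \int[m]_(x in D) (f x)%:E ]%E.
  apply: (@dominated_convergence _ _ _ m D mD (fun n x => (f_ n x)%:E) (EFin \o f) (EFin \o g)) => //.
  - by move=> n; exact/measurable_EFinP.
  - exact/measurable_EFinP.
  - by apply: aeW => x Dx; apply: cvg_EFin; [exact: nearW|exact: cf].
  - by apply: aeW => x n Dx; rewrite lee_fin fg.
rewrite (Rintegral_EFin mD fi) in cv.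
by move/fine_cvg : cv.
Qed.

End real_integration.

(** * Euclidean inner product and norm *)

Section dotp_theory.
Context {R : realType} {d : nat}.
Implicit Types x y z : 'cV[R]_d.

Lemma dotpC x y : dotp x y = dotp y x.
Proof. by apply: eq_bigr => i _; rewrite mulrC. Qed.

Lemma dotpDl x y z : dotp (x + y) z = dotp x z + dotp y z.
Proof. by rewrite /dotp -big_split; apply: eq_bigr => i _; rewrite mxE mulrDl. Qed.

Lemma dotpDr x y z : dotp z (x + y) = dotp z x + dotp z y.
Proof. by rewrite dotpC dotpDl !(dotpC z). Qed.

Lemma dotpZl a x y : dotp (a *: x) y = a * dotp x y.
Proof. by rewrite /dotp mulr_sumr; apply: eq_bigr => i _; rewrite mxE mulrA. Qed.

Lemma dotpZr a x y : dotp x (a *: y) = a * dotp x y.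
Proof. by rewrite dotpC dotpZl dotpC. Qed.

Lemma dotpNl x y : dotp (- x) y = - dotp x y.
Proof. by rewrite -scaleN1r dotpZl mulN1r. Qed.

Lemma dotpNr x y : dotp x (- y) = - dotp x y.
Proof. by rewrite dotpC dotpNl dotpC. Qed.

Lemma dotpBl x y z : dotp (x - y) z = dotp x z - dotp y z.
Proof. by rewrite dotpDl dotpNl. Qed.

Lemma dotpBr x y z : dotp z (x - y) = dotp z x - dotp z y.
Proof. by rewrite dotpDr dotpNr. Qed.

Lemma dotp0l x : dotp 0 x = 0.
Proof. by rewrite -(scale0r (0 : 'cV[R]_d)) dotpZl mul0r. Qed.

Lemma dotpp_ge0 x : 0 <= dotp x x.
Proof. by apply: sumr_ge0 => i _; rewrite -expr2 sqr_ge0. Qed.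

Lemma enorm_ge0 x : 0 <= enorm x.
Proof. exact: sqrtr_ge0. Qed.

Lemma sqr_enorm x : enorm x ^+ 2 = dotp x x.
Proof. by rewrite sqr_sqrtr// dotpp_ge0. Qed.

Lemma dotp_CS x y : `|dotp x y| <= enorm x * enorm y.
Proof.
rewrite -ler_sqr ?nnegrE ?mulr_ge0 ?enorm_ge0//.
rewrite exprMn !sqr_enorm real_normK ?num_real//.
have [y0|y0] := eqVneq (dotp y y) 0.
  have yi i : y i ord0 = 0.
    move: y0 => /eqP; rewrite psumr_eq0; last by move=> j _; rewrite -expr2 sqr_ge0.
    by move=> /allP/(_ i); rewrite mem_index_enum -expr2 sqrf_eq0 => /(_ isT)/eqP.
  by rewrite {1}/dotp big1 ?expr0n ?y0 ?mulr0// => i _; rewrite yi mulr0.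
have ygt0 : 0 < dotp y y by rewrite lt_neqAle eq_sym y0 dotpp_ge0.
(* Up to the factor [dotp y y], this vector is [x] minus its projection on [y]; its squared norm is
   [c * (a * c - b^2)]. *)
have := dotpp_ge0 (dotp y y *: x - dotp x y *: y).
rewrite dotpBl !dotpBr !dotpZl !dotpZr (dotpC y x).
set b := dotp x y; set a := dotp x x; set c := dotp y y in ygt0 y0 *.
rewrite (_ : _ - _ = c * (a * c - b ^+ 2)); last by ring.
by rewrite pmulr_rge0// subr_ge0.
Qed.

Lemma enormZ a x : enorm (a *: x) = `|a| * enorm x.
Proof.
by rewrite /enorm dotpZl dotpZr mulrA -expr2 sqrtrM ?sqr_ge0// sqrtr_sqr.
Qed.

Lemma enormN x : enorm (- x) = enorm x.
Proof. by rewrite -scaleN1r enormZ normrN1 mul1r. Qed.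

Lemma coord_le_enorm x i : `|x i ord0| <= enorm x.
Proof.
rewrite -ler_sqr ?nnegrE ?enorm_ge0// real_normK ?num_real// sqr_enorm.
rewrite /dotp (bigD1 i)//= -expr2 lerDl.
by apply: sumr_ge0 => j _; rewrite -expr2 sqr_ge0.
Qed.

(** The sum of [d] squares is at most [d * r^2], hence at most the square of [d * r]; the loss keeps
    square roots out of the later constants. *)
Lemma enorm_le_coord x (r : R) : 0 <= r -> (forall i, `|x i ord0| <= r) ->
  enorm x <= d%:R * r.
Proof.
move=> r0 xr; rewrite -ler_sqr ?nnegrE ?enorm_ge0 ?mulr_ge0//.
rewrite sqr_enorm exprMn.
rewrite (@le_trans _ _ (\sum_(i < d) r ^+ 2))//.
  apply: ler_sum => i _; rewrite -expr2 -[leLHS]real_normK ?num_real//.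
  by rewrite ler_sqr ?nnegrE.
rewrite sumr_const card_ord -[leLHS]mulr_natl ler_wpM2r ?sqr_ge0//.
by rewrite -natrX ler_nat; case: (d) => // n; rewrite expnS leq_pmulr// expn_gt0.
Qed.

Lemma enorm_eq0 x : enorm x = 0 -> x = 0.
Proof.
move=> x0; apply/colP => i; rewrite mxE; apply/eqP; rewrite -normr_le0.
by rewrite (le_trans (coord_le_enorm x i))// x0.
Qed.

Lemma enorm0 : enorm (0 : 'cV[R]_d) = 0.
Proof. by rewrite /enorm dotp0l sqrtr0. Qed.

Lemma measurable_enorm disp (T : measurableType disp) (f : T -> 'cV[R]_d) :
  measurable_fun setT f -> measurable_fun setT (fun w => enorm (f w)).
Proof.
move=> mf; have ms : measurable_fun setT (@Num.sqrt R).
  by apply: continuous_measurable_fun; exact: sqrt_continuous.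
exact: (measurableT_comp ms (measurable_dotp mf mf)).
Qed.

Lemma cauchy_cVB e x y : cauchy_cV e (x - y) = cauchy_cV e (y - x).
Proof.
apply: eq_bigr => i _; rewrite !mxE /cauchy_kernel; congr (_ / (_ + _)).
by rewrite -sqrrN opprB.
Qed.

End dotp_theory.

(** * Fourier inversion in polar form *)

Section polar_charfun.
Context {R : realType} {d : nat}.
Local Notation lam := (lebesgue_cV d).
Context {disp : measure_display} {Omega : measurableType disp}.
Variables (P : probability Omega R) (X : Omega -> 'cV[R]_d).
Hypothesis mX : measurable_fun setT X.

Lemma integral_law_le (f : 'cV[R]_d -> \bar R) (M : R) :
  (forall B, measurable B -> P (X @^-1` B) <= M%:E * lam B)%E -> 0 <= M ->
  measurable_fun setT f -> (forall x, 0 <= f x)%E ->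
  (\int[P]_w f (X w) <= M%:E * \int[lam]_x f x)%E.
Proof.
move=> PM M0 mf f0.
have := @ge0_le_measure_integral _ _ R (pushforward P X) (mscale (NngNum M0) lam).
move=> /(_ mX PM f setT measurableT f0 mf).
by rewrite ge0_integral_mscale// ge0_integral_pushforward// preimage_setT.
Qed.

(* [exp(-psi) e^{- i m}] is the characteristic function of [X]. *)
Variables psi m : 'cV[R]_d -> R.
Hypothesis XE : forall z a,
  \int[P]_w cos (dotp z (X w) + a) = expR (- psi z) * cos (a - m z).

Let measurable_k (u : 'cV[R]_d -> R) : measurable_fun setT u ->
  measurable_fun setT (fun zw : 'cV[R]_d * Omega =>
    cos (dotp zw.1 (X zw.2) + u zw.1)).
Proof.
move=> mu; apply: (measurableT_comp measurable_cos); apply: measurable_funD.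
  apply: measurable_dotp; first exact: measurable_fst.
  by apply: (measurableT_comp mX); exact: measurable_snd.
by apply: (measurableT_comp mu); exact: measurable_fst.
Qed.

(** [XE] determines [m] only modulo [2 * pi], so [m] need not be measurable. The product with the
    exponential is, being an integral that depends on the parameter [z]. *)
Lemma measurable_polar_cos (u : 'cV[R]_d -> R) : measurable_fun setT u ->
  measurable_fun setT (fun z => expR (- psi z) * cos (u z - m z)).
Proof.
move=> mu; under eq_fun do rewrite -XE.
apply: (@measurable_Rintegral_prob R _ _ _ _ P (fun z w => cos (dotp z (X w) + u z)) 1).
  exact: measurable_k.
by move=> z w; exact: cos_max.
Qed.

(** The shifts 0 and [pi / 2] give the two components of the characteristic function up to sign; the
    sum of their squares is [expR (- 2 psi)], and a logarithm recovers [psi]. *)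
Lemma measurable_polar_exponent : measurable_fun setT psi.
Proof.
have E z : psi z = - ln ((expR (- psi z) * cos (0 - m z)) ^+ 2 +
    (expR (- psi z) * cos (pi / 2 - m z)) ^+ 2) / 2.
  rewrite sub0r cosN (_ : pi / 2 - m z = - (m z - pi / 2)); last by ring.
  rewrite cosN cosBpihalf !exprMn -mulrDr cos2Dsin2 mulr1 -expRM_natl expRK.
  by field.
rewrite (funext E).
apply: measurable_funM => //; apply: measurable_funN.
apply: measurableT_comp; first exact: measurable_ln.
apply: measurable_funD; apply: measurable_funX.
- exact: (@measurable_polar_cos (cst 0)).
- exact: (@measurable_polar_cos (cst (pi / 2))).
Qed.

(** Parseval's relation: insert [XE] and exchange the integrals; the integral over [z] of the
    Laplace kernel against a cosine is then the Cauchy kernel at [X w - x]. *)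
Lemma smoothed_inversion e a x : 0 < e ->
  \int[lam]_z (laplace_cV e z * (expR (- psi z) * cos (a - dotp z x - m z))) =
  cos a * \int[P]_w cauchy_cV e (X w - x).
Proof.
move=> e0; under eq_Rintegral do rewrite -XE.
rewrite (@Rintegral_weight R _ _ _ _ lam P _ _ 1); first last.
- by move=> z w; exact: cos_max.
- apply: (@measurable_k (fun z => a - dotp z x)).
  apply: measurable_funB => //; apply: measurable_dotp; first exact: measurable_id.
  exact: measurable_cst.
- exact: integrable_laplace_cV.
rewrite -RintegralZl//; last first.
  apply: (@prob_bounded_integrable _ _ _ _ _ ((2 / e) ^+ d)).
    apply: measurableT_comp; first by apply: measurable_cauchy_cV; rewrite gt_eqF.
    apply: measurable_fun_cVP => i; under eq_fun do rewrite !mxE.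
    by apply: measurable_funB => //; exact: (measurableT_comp (measurable_coord i) mX).
  by move=> w; rewrite ger0_norm ?cauchy_cV_le ?cauchy_cV_ge0 ?ltW.
apply: eq_Rintegral => w _.
rewrite -Rintegral_laplace_cV_cos//; apply: eq_Rintegral => z _.
by rewrite dotpBl !(dotpC z); congr (_ * cos _); ring.
Qed.

End polar_charfun.

(** * A bounded density has a square-integrable characteristic function *)

Section bounded_density.
Context {R : realType} {d : nat}.
Local Notation lam := (lebesgue_cV d).

Lemma laplace_cVE e (z : 'cV[R]_d) :
  laplace_cV e z = expR (- (e * \sum_(i < d) `|z i ord0|)).
Proof.
by rewrite /laplace_cV /laplace_kernel -expR_sum sumrN mulr_sumr.
Qed.

Lemma laplace_cV_cvg1 (z : 'cV[R]_d) :
  laplace_cV (n.+1%:R^-1) z @[n --> \oo] --> (1 : R).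
Proof.
under eq_fun do rewrite laplace_cVE.
have H : - (n.+1%:R^-1 * (\sum_(i < d) `|z i ord0|)) @[n --> \oo] -->
    - (0 * (\sum_(i < d) `|z i ord0|)).
  by apply: cvgN; apply: cvgMr_tmp; exact: cvg_harmonic.
rewrite mul0r oppr0 in H.
have := continuous_cvg _ (@continuous_expR R 0) H. by rewrite expR0; apply.
Qed.

Lemma laplace_cV_nd (z : 'cV[R]_d) (e f : R) : e <= f ->
  laplace_cV f z <= laplace_cV e z.
Proof.
by move=> ef; rewrite !laplace_cVE ler_expR lerN2 ler_wpM2r ?sumr_ge0.
Qed.

Context {disp : measure_display} {Omega : measurableType disp}.
Variables (P : probability Omega R) (X : Omega -> 'cV[R]_d).
Hypothesis mX : measurable_fun setT X.
Variables psi m : 'cV[R]_d -> R.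
Hypothesis XE : forall z a,
  \int[P]_w cos (dotp z (X w) + a) = expR (- psi z) * cos (a - m z).

(** The shift [a = m z] turns the right-hand side of [XE] into the modulus of the characteristic
    function, which is at most 1. *)
Lemma polar_exponent_ge0 z : 0 <= psi z.
Proof.
have := @prob_bounded_Rintegral R _ _ P (fun w => cos (dotp z (X w) + m z)) 1.
rewrite XE subrr cos0 mulr1 ger0_norm ?expR_ge0// expR_le1 oppr_le0; apply.
  apply: (measurableT_comp measurable_cos); apply: measurable_funD => //.
  by apply: measurable_dotp => //; exact: measurable_cst.
by move=> w; exact: cos_max.
Qed.

Lemma measurable_cauchy_law e x : 0 < e ->
  measurable_fun setT (fun w => cauchy_cV e (X w - x)).
Proof.
move=> e0; apply: measurableT_comp; first by apply: measurable_cauchy_cV; rewrite gt_eqF.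
apply: measurable_fun_cVP => i; under eq_fun do rewrite !mxE.
by apply: measurable_funB => //; exact: (measurableT_comp (measurable_coord i) mX).
Qed.

(** [expR (- 2 psi)] is the characteristic function of the difference of two independent copies of
    [X]. Integrated against the Laplace kernel, it becomes the mean of [cauchy_cV e (X v - X w)]
    over [v] and [w]. The domination by Lebesgue measure bounds this by [M] times the mass of the
    Cauchy kernel, uniformly in [e]. *)
Lemma bounded_density_integral (M : R) : 0 <= M ->
  (forall B, measurable B -> P (X @^-1` B) <= M%:E * lam B)%E ->
  (\int[lam]_z (expR (- (2 * psi z)))%:E <= (M * (2 * pi) ^+ d)%:E)%E.
Proof.
move=> M0 PM; have mpsi := measurable_polar_exponent mX XE.
have mexp : measurable_fun setT (fun z => expR (- psi z)).
  by apply: measurableT_comp => //; exact: measurable_funN.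
have smooth e x : 0 < e -> \int[P]_w cauchy_cV e (X w - x) <= M * (2 * pi) ^+ d.
  move=> e0; rewrite -lee_fin -Rintegral_EFin//; last first.
    apply: (@prob_bounded_integrable _ _ _ _ _ ((2 / e) ^+ d)).
      exact: measurable_cauchy_law.
    by move=> w; rewrite ger0_norm ?cauchy_cV_le ?cauchy_cV_ge0 ?ltW.
  have := @integral_law_le R d _ _ P X mX (fun y => (cauchy_cV e (y - x))%:E) M PM M0.
  rewrite integral_cauchy_cV// -EFinM; apply.
    apply: mEFin; apply: measurableT_comp; first by apply: measurable_cauchy_cV; rewrite gt_eqF.
    apply: measurable_fun_cVP => i; under eq_fun do rewrite !mxE.
    by apply: measurable_funB => //; exact: measurable_coord.
  by move=> y; rewrite lee_fin cauchy_cV_ge0 ?ltW.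
have mp c : measurable_fun setT (fun z => expR (- psi z) * cos (c - m z)).
  exact: (measurable_polar_cos mX XE (measurable_cst c)).
pose k z w := expR (- psi z) * cos (0 - dotp z (X w) - m z).
have mk : measurable_fun setT (fun zw : 'cV[R]_d * Omega => k zw.1 zw.2).
  have mphi : measurable_fun setT (fun zw : 'cV[R]_d * Omega => dotp zw.1 (X zw.2)).
    apply: measurable_dotp; first exact: measurable_fst.
    by apply: (measurableT_comp mX); exact: measurable_snd.
  (* Splitting off [dotp z (X w)] leaves factors in [z] alone, of the form that
     [measurable_polar_cos] covers. *)
  have -> : (fun zw : 'cV[R]_d * Omega => k zw.1 zw.2) = (fun zw =>
      cos (dotp zw.1 (X zw.2)) * (expR (- psi zw.1) * cos (0 - m zw.1)) +
      sin (dotp zw.1 (X zw.2)) * (expR (- psi zw.1) * cos (- (pi / 2) - m zw.1))).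
    apply/funext => -[z w] /=; rewrite /k !sub0r.
    have -> : - dotp z (X w) - m z = - (dotp z (X w) + m z) by ring.
    have -> : - (pi / 2) - m z = - (m z + pi / 2) by ring.
    by rewrite !cosN cosD cosDpihalf; ring.
  apply: measurable_funD; apply: measurable_funM.
  - exact: (measurableT_comp measurable_cos).
  - by apply: (measurableT_comp (mp 0)); exact: measurable_fst.
  - exact: (measurableT_comp measurable_sin).
  - by apply: (measurableT_comp (mp (- (pi / 2)))); exact: measurable_fst.
have k1 z w : `|k z w| <= 1.
  rewrite /k normrM ger0_norm ?expR_ge0//.
  by rewrite mulr_ile1 ?expR_ge0 ?cos_max// expR_le1 oppr_le0 polar_exponent_ge0.
have sm e w : 0 < e -> \int[lam]_z (laplace_cV e z * k z w) =
    \int[P]_v cauchy_cV e (X v - X w).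
  by move=> e0; rewrite (smoothed_inversion mX XE)// cos0 mul1r.
have main e : 0 < e ->
    \int[lam]_z (laplace_cV e z * expR (- (2 * psi z))) <= M * (2 * pi) ^+ d.
  move=> e0.
  have -> : \int[lam]_z (laplace_cV e z * expR (- (2 * psi z))) =
            \int[lam]_z (laplace_cV e z * \int[P]_w k z w).
    apply: eq_Rintegral => z _; congr (_ * _).
    rewrite /k RintegralZl//; last first.
      apply: (@prob_bounded_integrable _ _ _ _ _ 1) => [|w]; last exact: cos_max.
      apply: (measurableT_comp measurable_cos).
      apply: measurable_funB => //; apply: measurable_funB => //.
      by apply: measurable_dotp => //; exact: measurable_cst.
    under eq_Rintegral do rewrite sub0r -opprD cosN.
    by rewrite XE subrr cos0 mulr1 -expRD; congr expR; ring.
  rewrite (@Rintegral_weight R _ _ _ _ lam P _ _ 1)//; last exact: integrable_laplace_cV.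
  rewrite -(Rintegral_prob_cst P (M * (2 * pi) ^+ d)); apply: le_Rintegral => //.
  - apply: (@prob_bounded_integrable _ _ _ _ _ ((2 / e) ^+ d)).
      have -> : (fun w => \int[lam]_z (laplace_cV e z * k z w)) =
                (fun w => \int[P]_v cauchy_cV e (X v - X w)).
        by apply/funext => w; rewrite sm.
      apply: (@measurable_Rintegral_prob R _ _ _ _ P (fun w v => cauchy_cV e (X v - X w)) ((2 / e) ^+ d)).
        apply: measurableT_comp; first by apply: measurable_cauchy_cV; rewrite gt_eqF.
        apply: measurable_fun_cVP => i; under eq_fun do rewrite !mxE.
        apply: measurable_funB.
          apply: (measurableT_comp (measurableT_comp (measurable_coord i) mX)); exact: measurable_snd.
        apply: (measurableT_comp (measurableT_comp (measurable_coord i) mX)); exact: measurable_fst.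
      by move=> v w; rewrite ger0_norm ?cauchy_cV_le ?cauchy_cV_ge0 ?ltW.
    move=> w; rewrite sm//.
    apply: prob_bounded_Rintegral; first exact: measurable_cauchy_law.
    by move=> v; rewrite ger0_norm ?cauchy_cV_le ?cauchy_cV_ge0 ?ltW.
  - exact: finite_measure_integrable_cst.
  - by move=> w _; rewrite sm// smooth.
(* As [e] decreases to 0 the Laplace kernel increases to 1, so monotone convergence removes the
   mollifier. *)
pose f n z := (laplace_cV (n.+1%:R^-1) z * expR (- (2 * psi z)))%:E.
have mexp2 : measurable_fun setT (fun z => expR (- (2 * psi z))).
  apply: measurableT_comp => //; apply: measurable_funN.
  exact: measurable_funM.
have mf n : measurable_fun setT (f n).
  by apply: mEFin; apply: measurable_funM => //; exact: measurable_laplace_cV.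
have f0 n z : (0 <= f n z)%E by rewrite lee_fin mulr_ge0 ?laplace_cV_ge0 ?expR_ge0.
have := @cvg_monotone_convergence _ _ _ lam setT measurableT f mf
  (fun n z _ => f0 n z).
have nd : forall z, setT z -> {homo f ^~ z : n m / (n <= m)%N >-> (n <= m)%E}.
  move=> z _ n k' nk; rewrite lee_fin ler_wpM2r ?expR_ge0// laplace_cV_nd//.
  by rewrite lef_pV2 ?posrE// ler_nat.
move=> /(_ nd) cv.
rewrite (_ : (\int[lam]_z _)%E = limn (fun n => \int[lam]_z f n z)%E); last first.
  rewrite (cvg_lim _ cv)//; apply: eq_integral => z _; apply/esym/cvg_lim => //.
  apply: cvg_EFin; first exact: nearW.
  rewrite -[X in _ --> X](mul1r (expR (- (2 * psi z)))).
  by apply: cvgMr_tmp; exact: laplace_cV_cvg1.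
apply: lime_le; first by apply/cvg_ex; eexists; exact: cv.
apply: nearW => n; rewrite Rintegral_EFin ?lee_fin ?main ?invr_gt0//.
apply: (@le_integrable _ _ _ lam _ measurableT _ (EFin \o laplace_cV (n.+1%:R^-1))) => //.
- exact: mf.
- move=> z _; rewrite /= lee_fin !ger0_norm ?mulr_ge0 ?laplace_cV_ge0 ?expR_ge0//.
  rewrite ler_piMr ?laplace_cV_ge0// expR_le1 oppr_le0 mulr_ge0//.
  exact: polar_exponent_ge0.
- by apply: integrable_laplace_cV; rewrite invr_gt0.
Qed.

End bounded_density.

Section boxes.
Context {R : realType}.

Definition cV_box d (A : 'I_d -> set R) : set 'cV[R]_d :=
  [set x | forall i, A i (x i ord0)].

Lemma measurable_cV_box d (A : 'I_d -> set R) :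
  (forall i, measurable (A i)) -> measurable (cV_box A).
Proof.
move=> mA; rewrite (_ : cV_box A = \bigcap_(i in [set: 'I_d])
    ((fun x : 'cV[R]_d => x i ord0) @^-1` A i)); last first.
  by apply/seteqP; split => x /= H i; [move=> _|]; exact: H.
apply: fin_bigcap_measurable => [|i _]; first exact: finite_finset.
by rewrite -[X in measurable X]setTI; exact: measurable_coord.
Qed.

Lemma cV_box_itv_lty d (a b : 'I_d -> R) :
  (lebesgue_cV d (cV_box (fun i => `[a i, b i]%classic)) < +oo)%E.
Proof.
rewrite lebesgue_cV_box// ltey_eq; apply/orP; left.
apply: prode_fin_num => i _; rewrite lebesgue_measure_itv/=.
by case: ifPn.
Qed.

Lemma indic_cV_box d (A : 'I_d -> set R) (x : 'cV[R]_d) :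
  \1_(cV_box A) x = \prod_(i < d) \1_(A i) (x i ord0) :> R.
Proof.
have [xA|/existsNP[i xA]] := pselect (cV_box A x).
  by rewrite indicE mem_set// big1// => i _; rewrite indicE mem_set//; exact: xA.
rewrite indicE memNset/=; last by move=> /(_ i).
by rewrite (bigD1 i)//= indicE memNset// mul0r.
Qed.

End boxes.

Section limits.
Context {R : realType}.

Lemma cvg_prod_seq (I : Type) (s : seq I) (f : I -> nat -> R) (l : I -> R) :
  (forall i, f i n @[n --> \oo] --> l i) ->
  \prod_(i <- s) f i n @[n --> \oo] --> \prod_(i <- s) l i.
Proof.
move=> fl; elim: s => [|i s IH].
  by rewrite big_nil; under eq_fun do rewrite big_nil; exact: cvg_cst.
rewrite big_cons; under eq_fun do rewrite big_cons.
by apply: cvgM.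
Qed.

(** At [c = 0] the limit is 0, midway between the other two values, so the faces of a box get
    intermediate weights; the sandwich [sg_le] takes care of them. *)
Lemma cvg_atan_sg (c : R) :
  atan (c / n.+1%:R^-1) @[n --> \oo] --> pi / 2 * Num.sg c.
Proof.
have pos (r : R) : 0 < r -> atan (r / n.+1%:R^-1) @[n --> \oo] --> pi / 2.
  move=> r0; apply: (@cvg_comp _ _ _ (fun n => r / n.+1%:R^-1) atan _ +oo); last exact: cvgy_atan.
  under eq_fun do rewrite invrK.
  have H : (n.+1%:R : R) @[n --> \oo] --> +oo.
    by rewrite (@cvg_shiftS R^o (fun n => n%:R)); exact: cvgr_idn.
  exact: (cvg_comp _ _ H (gt0_cvgMry r0 cvg_id)).
have [c0|c0|->] := ltgtP c 0.
- rewrite ltr0_sg// mulrN1.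
  rewrite (_ : (fun n => _) = (fun n => - atan ((- c) / n.+1%:R^-1))); last first.
    by apply/funext => n; rewrite mulNr atanN opprK.
  by apply: cvgN; apply: pos; rewrite oppr_gt0.
- by rewrite gtr0_sg// mulr1; exact: pos.
- rewrite sgr0 mulr0; under eq_fun do rewrite mul0r atan0.
  exact: cvg_cst.
Qed.

Lemma norm_atan_lt (x : R) : `|atan x| < pi / 2.
Proof. by rewrite ltr_norml atan_gtNpi2 atan_ltpi2. Qed.

End limits.

(** * Sup-norm cubes and their volume *)

Section cubes.
Context {R : realType} {d : nat}.
Local Notation lam := (lebesgue_cV d).

(** Cubes stand in for Euclidean balls: their volume is explicit and membership is tested
    coordinatewise; [cube_enorm] returns to the norm at the price of a factor [d]. *)
Definition cube (c : 'cV[R]_d) (a : R) : set 'cV[R]_d :=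
  cV_box (fun i => `[(c i ord0 - a)%R, (c i ord0 + a)%R]%classic).

Lemma measurable_cube c a : measurable (cube c a).
Proof. by apply: measurable_cV_box. Qed.

Lemma cubeP c a x : cube c a x <-> forall i, `|x i ord0 - c i ord0| <= a.
Proof. by split=> h i; have := h i; rewrite /= in_itv/= ler_distl. Qed.

Lemma cube_enorm c a x : 0 <= a -> cube c a x -> enorm (x - c) <= d%:R * a.
Proof.
move=> a0 /cubeP xc; apply: enorm_le_coord => // i.
by have := xc i; rewrite !mxE.
Qed.

Lemma lebesgue_cube c a : 0 < a -> lam (cube c a) = ((2 * a) ^+ d)%:E.
Proof.
move=> a0; rewrite (lebesgue_cV_box
  (A := fun i => `[(c i ord0 - a)%R, (c i ord0 + a)%R]%classic))//.
under eq_bigr => i _.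
  rewrite lebesgue_measure_itv/= lte_fin ifT; last by lra.
  rewrite -EFinB (_ : _ - _ = 2 * a); last by ring.
  over.
by rewrite prodEFin prodr_const card_ord.
Qed.

Lemma ge_cst_integral disp (T : measurableType disp)
    (mu : {measure set T -> \bar R}) (D : set T) (f : T -> R) (k : R) :
  measurable D -> measurable_fun setT f -> (forall x, 0 <= f x) -> 0 <= k ->
  (forall x, D x -> k <= f x) ->
  (k%:E * mu D <= \int[mu]_x (f x)%:E)%E.
Proof.
move=> mD mf f0 k0 kf; rewrite -integral_cst//.
apply: (@le_trans _ _ (\int[mu]_(x in D) (f x)%:E)%E).
  apply: ge0_le_integral => //.
  by apply: measurable_funTS; exact: mEFin.
apply: ge0_subset_integral => //; first exact: mEFin.
by move=> x _; rewrite lee_fin.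
Qed.

End cubes.

(** * The inversion integral as a limit of mollified laws *)

Section inversion.
Context {R : realType} {d : nat}.
Local Notation lam := (lebesgue_cV d).
Context {disp : measure_display} {Omega : measurableType disp}.
Variables (P : probability Omega R) (X : Omega -> 'cV[R]_d).
Hypothesis mX : measurable_fun setT X.
Variables psi m : 'cV[R]_d -> R.
Hypothesis XE : forall z a,
  \int[P]_w cos (dotp z (X w) + a) = expR (- psi z) * cos (a - m z).
Hypothesis psi_int : lam.-integrable setT (EFin \o (fun z => expR (- psi z))).

(** Up to the factor [(2 pi)^-d], the value at [a = 0] is the real part of the inverse Fourier
    integral and the value at [a = pi / 2] the opposite of its imaginary part. *)
Definition inversion_integral a x :=
  \int[lam]_z (expR (- psi z) * cos (a - dotp z x - m z)).

Lemma measurable_inversion_integrand a x : measurable_fun setT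
  (fun z => expR (- psi z) * cos (a - dotp z x - m z)).
Proof.
apply: (measurable_polar_cos mX XE (u := fun z => a - dotp z x)).
apply: measurable_funB => //; apply: measurable_dotp; first exact: measurable_id.
exact: measurable_cst.
Qed.

Lemma norm_inversion_integrand a x z :
  `|expR (- psi z) * cos (a - dotp z x - m z)| <= expR (- psi z).
Proof. by rewrite normrM ger0_norm ?expR_ge0// ler_piMr ?expR_ge0 ?cos_max. Qed.

Lemma integrable_inversion_integrand a x : lam.-integrable setT
  (EFin \o (fun z => expR (- psi z) * cos (a - dotp z x - m z))).
Proof.
apply: (le_integrable measurableT _ _ psi_int).
- by apply: mEFin; exact: measurable_inversion_integrand.
- move=> z _; rewrite /= lee_fin (le_trans (norm_inversion_integrand _ _ _))//.
  exact: ler_norm.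
Qed.

Lemma norm_inversion_integral a x :
  `|inversion_integral a x| <= \int[lam]_z expR (- psi z).
Proof.
rewrite (le_trans (le_normr_Rintegral measurableT (integrable_inversion_integrand a x)))//.
apply: le_Rintegral => //.
- by apply: integrable_norm; exact: integrable_inversion_integrand.
- by move=> z _; exact: norm_inversion_integrand.
Qed.

Let e_ n : R := n.+1%:R^-1.
Let e_gt0 n : 0 < e_ n. Proof. by rewrite invr_gt0. Qed.

Let cauchy_law e x := \int[P]_w cauchy_cV e (X w - x).

Let cauchy_lawE n x a : cos a * cauchy_law (e_ n) x =
  \int[lam]_z (laplace_cV (e_ n) z * (expR (- psi z) * cos (a - dotp z x - m z))).
Proof. by rewrite (smoothed_inversion mX XE). Qed.

Let measurable_smooth n a x : measurable_fun setT
  (fun z => laplace_cV (e_ n) z * (expR (- psi z) * cos (a - dotp z x - m z))).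
Proof.
apply: measurable_funM; first exact: measurable_laplace_cV.
exact: measurable_inversion_integrand.
Qed.

Let norm_smooth n a x z :
  `|laplace_cV (e_ n) z * (expR (- psi z) * cos (a - dotp z x - m z))|
  <= expR (- psi z).
Proof.
rewrite normrM ger0_norm ?laplace_cV_ge0//.
rewrite (le_trans _ (norm_inversion_integrand a x z))// ler_piMl//.
by rewrite laplace_cV_le1// ltW.
Qed.

(** Dominated convergence in [smoothed_inversion], with [expR (- psi)] as majorant. *)
Lemma cauchy_law_cvg a x :
  cos a * \int[P]_w cauchy_cV n.+1%:R^-1 (X w - x) @[n --> \oo]
  --> inversion_integral a x.
Proof.
under eq_fun do rewrite -[X in _ * X]/(cauchy_law (e_ _) x) cauchy_lawE.
apply: (@Rdominated_cvg _ _ _ _ _ _ _ (fun z => expR (- psi z))) => //.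
- exact: measurable_inversion_integrand.
- move=> z _; set u := expR _ * _; rewrite -[X in _ --> X](mul1r u).
  by apply: cvgMr_tmp; exact: laplace_cV_cvg1.
Qed.

(** Every approximating term carries the factor [cos (pi / 2) = 0]: this is why the inversion
    integral of a law is real. *)
Lemma inversion_integral_sin x : inversion_integral (pi / 2) x = 0.
Proof.
have := @cauchy_law_cvg (pi / 2) x.
under eq_fun do rewrite cos_pihalf mul0r.
by move=> /cvg_lim <-//; rewrite lim_cst.
Qed.

Let cauchy_law_ge0 e x : 0 < e -> 0 <= cauchy_law e x.
Proof. by move=> e0; apply: Rintegral_ge0 => w _; rewrite cauchy_cV_ge0 ?ltW. Qed.

Let cauchy_law_cvg0 x : cauchy_law (e_ n) x @[n --> \oo] --> inversion_integral 0 x.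
Proof.
have := @cauchy_law_cvg 0 x.
by under eq_fun do rewrite cos0 mul1r.
Qed.

Lemma inversion_integral_ge0 x : 0 <= inversion_integral 0 x.
Proof.
rewrite -(cvg_lim _ (@cauchy_law_cvg0 x))//; apply: limr_ge.
  by apply/cvg_ex; eexists; exact: cauchy_law_cvg0.
by apply: nearW => n; exact: cauchy_law_ge0.
Qed.

Let measurable_cauchy_pair e : 0 < e ->
  measurable_fun setT (fun xw : 'cV[R]_d * Omega => cauchy_cV e (X xw.2 - xw.1)).
Proof.
move=> e0; apply: measurableT_comp; first by apply: measurable_cauchy_cV; rewrite gt_eqF.
apply: measurable_fun_cVP => i; under eq_fun do rewrite !mxE.
apply: measurable_funB.
  by apply: (measurableT_comp (measurableT_comp (measurable_coord i) mX)); exact: measurable_snd.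
by apply: (measurableT_comp (measurable_coord i)); exact: measurable_fst.
Qed.

Let cauchy_cV_norm e x : 0 < e -> `|cauchy_cV e (x : 'cV[R]_d)| <= (2 / e) ^+ d.
Proof. by move=> e0; rewrite ger0_norm ?cauchy_cV_le ?cauchy_cV_ge0 ?ltW. Qed.

Let measurable_cauchy_law e : 0 < e -> measurable_fun setT (cauchy_law e).
Proof.
move=> e0.
have H := @measurable_Rintegral_prob R _ _ _ _ P
  (fun (x : 'cV[R]_d) w => cauchy_cV e (X w - x)) ((2 / e) ^+ d).
by apply: H => [|x w]; [exact: measurable_cauchy_pair|exact: cauchy_cV_norm].
Qed.

Lemma measurable_inversion_integral : measurable_fun setT (inversion_integral 0).
Proof.
apply: (@measurable_fun_cvg _ _ _ setT (fun n => cauchy_law (e_ n))) => [n|x _].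
  exact: measurable_cauchy_law.
exact: cauchy_law_cvg0.
Qed.

Let cauchy_box (a b : 'I_d -> R) e y : 0 < e -> (forall i, a i < b i) ->
  \int[lam]_x (\1_(cV_box (fun i => `[a i, b i]%classic)) x * cauchy_cV e (y - x)) =
  \prod_(i < d) (2 * atan ((b i - y i ord0) / e) - 2 * atan ((a i - y i ord0) / e)).
Proof.
move=> e0 ab; rewrite /Rintegral.
pose g i (u : R) := (\1_(`[a i, b i]%classic) u * cauchy_kernel e (u - y i ord0)).
transitivity (fine (\int[lam]_x (\prod_(i < d) g i (x i ord0))%:E)%E).
  congr fine; apply: eq_integral => x _; congr EFin.
  by rewrite cauchy_cVB indic_cV_box -big_split/=; apply: eq_bigr => i _; rewrite /g !mxE.
rewrite (@ge0_integral_prod_coord R d g); last 2 first.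
- move=> i; apply: measurable_funM => //.
  by apply: continuous_measurable_fun; exact: continuous_cauchy_kernel.
- by move=> i u; rewrite mulr_ge0 ?cauchy_kernel_ge0// ltW.
rewrite (eq_bigr (fun i => (2 * atan ((b i - y i ord0) / e) -
    2 * atan ((a i - y i ord0) / e))%:E)); first by rewrite prodEFin.
move=> i _; rewrite -(integral_cauchy_itv (y i ord0) e0 (ab i)).
rewrite [RHS]integral_mkcond; apply: eq_integral => u _.
by rewrite /g patchE indicE; case: ifPn => _; rewrite ?mul1r ?mul0r.
Qed.

(** Both sides are limits of the integral of the mollified law over the box. On the left the
    mollified law converges pointwise. On the right Fubini's theorem and [cauchy_box] give a mean of
    products of arctangent differences, which converge to signs. *)
Lemma inversion_integral_box (a b : 'I_d -> R) : (forall i, a i < b i) ->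
  \int[lam]_x (\1_(cV_box (fun i => `[a i, b i]%classic)) x * inversion_integral 0 x) =
  \int[P]_w \prod_(i < d) (pi * (Num.sg (b i - X w i ord0) - Num.sg (a i - X w i ord0))).
Proof.
move=> ab; set B := cV_box _.
have mB : measurable B by apply: measurable_cV_box => i.
have iB : lam.-integrable setT (EFin \o (\1_B : _ -> R)).
  apply/integrableP; split; first by apply: mEFin.
  under eq_integral do rewrite /= ger0_norm//.
  by rewrite integral_indic// setIT; exact: cV_box_itv_lty.
pose f n w := \prod_(i < d) (2 * atan ((b i - X w i ord0) / e_ n) -
  2 * atan ((a i - X w i ord0) / e_ n)).
have fE n w : f n w = \int[lam]_x (\1_B x * cauchy_cV (e_ n) (X w - x)).
  by rewrite cauchy_box.
have fub n w : `|f n w| <= (2 * pi) ^+ d.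
  rewrite /f normr_prod -[X in _ <= _ ^+ X](card_ord d) -prodr_const.
  apply: ler_prod => i _; rewrite normr_ge0/=.
  rewrite (le_trans (ler_normB _ _))// !normrM ger0_norm//.
  have := norm_atan_lt ((b i - X w i ord0) / e_ n).
  have := norm_atan_lt ((a i - X w i ord0) / e_ n).
  lra.
have mf n : measurable_fun setT (f n).
  rewrite /f; under eq_fun do rewrite -big_enum/=.
  apply: measurable_prod => i _.
  have matan c : measurable_fun setT (fun w => 2 * atan ((c - X w i ord0) / e_ n)).
    apply: measurable_funM => //; apply: (@measurableT_comp _ _ _ _ _ _ atan).
      by apply: continuous_measurable_fun; exact: continuous_atan.
    apply: measurable_funM => //; apply: measurable_funB => //.
    exact: (measurableT_comp (measurable_coord i) mX).
  exact: measurable_funB.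
have fl w : f n w @[n --> \oo] -->
    \prod_(i < d) (pi * (Num.sg (b i - X w i ord0) - Num.sg (a i - X w i ord0))).
  apply: cvg_prod_seq => i.
  rewrite (_ : pi * _ = 2 * (pi / 2 * Num.sg (b i - X w i ord0)) -
     2 * (pi / 2 * Num.sg (a i - X w i ord0))); last by field.
  by apply: cvgB; apply: cvgMl_tmp; exact: cvg_atan_sg.
have mfl : measurable_fun setT (fun w =>
    \prod_(i < d) (pi * (Num.sg (b i - X w i ord0) - Num.sg (a i - X w i ord0)))).
  by apply: (@measurable_fun_cvg _ _ _ setT f).
have c1 : \int[P]_w f n w @[n --> \oo] --> \int[P]_w \prod_(i < d)
    (pi * (Num.sg (b i - X w i ord0) - Num.sg (a i - X w i ord0))).
  apply: (@Rdominated_cvg _ _ _ _ _ _ _ (cst ((2 * pi) ^+ d))) => //.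
  exact: finite_measure_integrable_cst.
have c2 : \int[lam]_x (\1_B x * cauchy_law (e_ n) x) @[n --> \oo] -->
    \int[lam]_x (\1_B x * inversion_integral 0 x).
  apply: (@Rdominated_cvg _ _ _ _ _ _ _ (fun x => \1_B x * (\int[lam]_z expR (- psi z)))) => //.
  - by move=> n; apply: measurable_funM => //; exact: measurable_cauchy_law.
  - by apply: measurable_funM => //; exact: measurable_inversion_integral.
  - by move=> x _; apply: cvgMl_tmp; exact: cauchy_law_cvg0.
  - by have := integrableZr measurableT (\int[lam]_z expR (- psi z)) iB.
  - move=> n x _; rewrite normrM ger0_norm// ler_wpM2l//.
    rewrite -[cauchy_law _ _]mul1r -cos0 cauchy_lawE.
    have si : lam.-integrable setT (EFin \o (fun z =>
        laplace_cV (e_ n) z * (expR (- psi z) * cos (0 - dotp z x - m z)))).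
      apply: (le_integrable measurableT _ _ psi_int); first exact: mEFin.
      move=> z _; rewrite /= lee_fin (le_trans (norm_smooth _ _ _ _))//.
      exact: ler_norm.
    rewrite (le_trans (le_normr_Rintegral measurableT si))//.
    by apply: le_Rintegral => //; exact: integrable_norm.
have c12 n : \int[lam]_x (\1_B x * cauchy_law (e_ n) x) = \int[P]_w f n w.
  rewrite (@Rintegral_weight R _ _ _ _ lam P _ (fun x w => cauchy_cV (e_ n) (X w - x)) ((2 / e_ n) ^+ d)) //.
  - by apply: eq_Rintegral => w _; rewrite fE.
  - exact: measurable_cauchy_pair.
  - by move=> x w; exact: cauchy_cV_norm.
move: c2; under eq_fun do rewrite c12; move=> c2.
by rewrite -(cvg_lim _ c1)// -(cvg_lim _ c2).
Qed.

End inversion.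

(** * The inversion integral is a density of the law *)

Section density.
Context {R : realType} {d : nat}.
Local Notation lam := (lebesgue_cV d).

Definition open_boxes : set (set 'cV[R]_d) :=
  [set A | exists a b, A = cV_box (fun i => `]a i, b i[%classic)].

Lemma archi_bound_lt (x : R) : exists n : nat, `|x| < n.+1%:R.
Proof.
exists (Num.bound `|x|); rewrite (lt_trans (archi_boundP (normr_ge0 x)))//.
by rewrite ltr_nat.
Qed.

Lemma cV_archi_bound (x : 'cV[R]_d) :
  exists n : nat, forall k i, (n <= k)%N -> `|x i ord0| < k.+1%:R.
Proof.
have [n xn] := archi_bound_lt (enorm x); exists n => k i nk.
rewrite (le_lt_trans (coord_le_enorm x i))//.
rewrite (le_lt_trans (ler_norm _))// (lt_le_trans xn)// ler_nat ltnS//.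
Qed.

(** Open boxes are stable under intersection, so two measures that agree on them can be
    identified. *)
Lemma measurable_cV_open_boxes :
  (@measurable _ 'cV[R]_d) = <<s open_boxes >>.
Proof.
apply/seteqP; split; last first.
  apply: smallest_sub; first exact: sigma_algebra_measurable.
  by move=> A [a [b ->]]; apply: measurable_cV_box.
move=> A mA.
pose T := g_sigma_algebraType open_boxes.
have : measurable_fun [set: T] (fun x : T => (x : 'cV[R]_d)).
  apply: measurable_fun_cVP => i.
  apply: (measurability _ (RGenOInfty.measurableE R)) => //.
  move=> _ [_ [c ->] <-]; rewrite setTI.
  rewrite (_ : _ @^-1` _ = \bigcup_k (cV_box (fun j : 'I_d =>
      `](if j == i then c else - k.+1%:R), k.+1%:R[%classic))).
    apply: bigcup_measurable => k _; apply: sub_sigma_algebra.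
    by exists (fun j : 'I_d => if j == i then c else - k.+1%:R), (fun=> k.+1%:R).
  apply/seteqP; split => x /=.
    rewrite in_itv/= andbT => cx; have [n xn] := cV_archi_bound x.
    exists n => // j /=; rewrite in_itv/=.
    have := xn n j (leqnn n); rewrite ltr_norml => /andP[x1 x2].
    by rewrite x2 andbT; case: eqP => [->|].
  move=> [k _ /(_ i)]; rewrite /= in_itv/= eqxx => /andP[cx _].
  by rewrite in_itv/= cx.
by move=> /(_ measurableT A mA); rewrite setTI.
Qed.

Context {disp : measure_display} {Omega : measurableType disp}.
Variables (P : probability Omega R) (X : Omega -> 'cV[R]_d).
Hypothesis mX : measurable_fun setT X.
Variables psi m : 'cV[R]_d -> R.
Hypothesis XE : forall z a,
  \int[P]_w cos (dotp z (X w) + a) = expR (- psi z) * cos (a - m z).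
Hypothesis psi_int : lam.-integrable setT (EFin \o (fun z => expR (- psi z))).

Definition inversion_density x : R :=
  (2 * pi) ^- d * inversion_integral psi m 0 x.

Let q := inversion_density.

Let pi2_gt0 : 0 < (2 * pi) ^+ d :> R.
Proof. by rewrite exprn_gt0// mulr_gt0// pi_gt0. Qed.

Lemma inversion_density_ge0 x : 0 <= q x.
Proof.
by rewrite mulr_ge0 ?(inversion_integral_ge0 mX XE psi_int)// invr_ge0 ltW.
Qed.

Lemma measurable_inversion_density : measurable_fun setT q.
Proof.
by apply: measurable_funM => //; exact: (measurable_inversion_integral mX XE psi_int).
Qed.

Lemma inversion_density_le x : q x <= (2 * pi) ^- d * \int[lam]_z expR (- psi z).
Proof.
rewrite ler_wpM2l// ?invr_ge0 ?(ltW pi2_gt0)//.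
by rewrite (le_trans (ler_norm _))// (norm_inversion_integral mX XE psi_int).
Qed.

Let nu (B : set 'cV[R]_d) : \bar R := (\int[lam]_(x in B) (q x)%:E)%E.

Let nu0 : nu set0 = 0%E. Proof. by rewrite /nu integral_set0. Qed.

Let nu_ge0 B : (0 <= nu B)%E.
Proof. by apply: integral_ge0 => x _; rewrite lee_fin inversion_density_ge0. Qed.

Let nu_additive : semi_sigma_additive nu.
Proof.
apply: semi_sigma_additive_nng_induced => [|x].
  by apply: mEFin; exact: measurable_inversion_density.
by rewrite lee_fin inversion_density_ge0.
Qed.

HB.instance Definition _ := isMeasure.Build _ _ _ nu nu0 nu_ge0 nu_additive.

Let cbox (a b : 'I_d -> R) := cV_box (fun i => `[a i, b i]%classic).
Let obox (a b : 'I_d -> R) := cV_box (fun i => `]a i, b i[%classic).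

Let mcbox a b : measurable (cbox a b). Proof. exact: measurable_cV_box. Qed.
Let mobox a b : measurable (obox a b). Proof. exact: measurable_cV_box. Qed.

Let sg_prod (a b : 'I_d -> R) (x : 'cV[R]_d) : R :=
  \prod_(i < d) (pi * (Num.sg (b i - x i ord0) - Num.sg (a i - x i ord0))).

(** Bounding the sign product by the open and the closed box replaces an analysis of its values on
    the faces. *)
Let sg_le a b x : (forall i, a i < b i) ->
  (2 * pi) ^+ d * \1_(obox a b) x <= sg_prod a b x <= (2 * pi) ^+ d * \1_(cbox a b) x.
Proof.
move=> ab; rewrite !indic_cV_box -[X in _ ^+ X](card_ord d) -prodr_const -!big_split/=.
have p0 := @pi_gt0 R.
apply/andP; split; apply: ler_prod => i _; apply/andP; split.
- by rewrite mulr_ge0 ?indicE ?mulr_ge0 ?(ltW p0).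
- rewrite indicE/=; have [|_] := boolP (_ \in _).
    rewrite inE/= in_itv/= => /andP[ax xb].
    by rewrite gtr0_sg ?subr_gt0// ltr0_sg ?subr_lt0//; lra.
  rewrite mulr0 mulr_ge0 ?(ltW p0)// subr_ge0.
  have := ab i; case: (sgrP (b i - x i ord0)); case: (sgrP (a i - x i ord0)); lra.
- rewrite mulr_ge0 ?(ltW p0)// subr_ge0.
  have := ab i; case: (sgrP (b i - x i ord0)); case: (sgrP (a i - x i ord0)); lra.
- rewrite indicE/=; have [|] := boolP (_ \in _).
    rewrite mulr1 => _.
    have := ab i; case: (sgrP (b i - x i ord0)); case: (sgrP (a i - x i ord0)); nra.
  rewrite notin_setE/= in_itv/= => /negP; rewrite negb_and -!ltNge => /orP[xa|bx].
    rewrite gtr0_sg ?subr_gt0// ?(lt_trans xa)// gtr0_sg ?subr_gt0//.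
    by rewrite subrr !mulr0.
  rewrite ltr0_sg ?subr_lt0// ltr0_sg ?subr_lt0// ?(lt_trans _ bx)//.
  by rewrite subrr !mulr0.
Qed.

Let nu_cbox a b : nu (cbox a b) = ((2 * pi) ^- d *
  \int[lam]_x (\1_(cbox a b) x * inversion_integral psi m 0 x))%:E.
Proof.
have mI := measurable_inversion_integral mX XE psi_int.
have iI : lam.-integrable setT (EFin \o
    (fun x => \1_(cbox a b) x * inversion_integral psi m 0 x)).
  have iB : lam.-integrable setT (EFin \o (\1_(cbox a b) : _ -> R)).
    apply/integrableP; split; first by apply: mEFin.
    under eq_integral do rewrite /= ger0_norm//.
    by rewrite integral_indic// setIT; exact: cV_box_itv_lty.
  apply: (@integrableMl _ _ _ lam setT measurableT (EFin \o \1_(cbox a b))) => //.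
  exists (\int[lam]_z expR (- psi z)); split; first exact: num_real.
  move=> M ltM x _ /=; rewrite (le_trans _ (ltW ltM))//.
  exact: (norm_inversion_integral mX XE psi_int).
rewrite EFinM -Rintegral_EFin// -integralZl//.
rewrite /nu [LHS]integral_mkcond; apply: eq_integral => x _.
by rewrite patchE indicE; case: ifPn => _; rewrite ?mul1r ?mul0r ?mule0 -?EFinM.
Qed.

Let law_cbox a b : (forall i, a i < b i) ->
  (P (X @^-1` obox a b) <= nu (cbox a b) <= P (X @^-1` cbox a b))%E.
Proof.
move=> ab; rewrite nu_cbox (inversion_integral_box mX XE psi_int)//.
have mXA A : measurable A -> measurable (X @^-1` A).
  by move=> mA; rewrite -[X in measurable X]setTI; exact: mX.
have mI A : measurable A -> measurable_fun setT (fun w => \1_A (X w) : R).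
  move=> mA; have h : measurable_fun setT (\1_A : 'cV[R]_d -> R) by [].
  exact: (measurableT_comp h mX).
have E A : measurable A -> P (X @^-1` A) = (\int[P]_w \1_A (X w))%:E.
  move=> mA; rewrite -Rintegral_EFin//; last first.
    apply: (@prob_bounded_integrable _ _ _ _ _ 1); last by move=> w; rewrite ger0_norm.
    exact: mI.
  transitivity (\int[P]_w (\1_(X @^-1` A) w)%:E)%E; last by [].
  by rewrite integral_indic ?setIT//; exact: mXA.
have iA A : measurable A -> P.-integrable setT (EFin \o (fun w => (2 * pi) ^+ d * \1_A (X w))).
  move=> mA; apply: (@prob_bounded_integrable _ _ _ _ _ ((2 * pi) ^+ d)).
    by apply: measurable_funM => //; exact: mI.
  by move=> w; rewrite ger0_norm ?mulr_ge0 ?(ltW pi2_gt0)// ler_piMr ?(ltW pi2_gt0).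
have isg : P.-integrable setT (EFin \o (fun w => sg_prod a b (X w))).
  apply: (le_integrable measurableT _ _ (iA _ (mcbox a b))).
    apply: mEFin; rewrite /sg_prod; under eq_fun do rewrite -big_enum/=.
    apply: measurable_prod => i _; apply: measurable_funM => //.
    have msg c : measurable_fun setT (fun w => Num.sg (c - X w i ord0)).
      apply: (@measurableT_comp _ _ _ _ _ _ (@Num.sg R)).
        apply: nondecreasing_measurable => //.
        by move=> u v; case: (sgrP u); case: (sgrP v); lra.
      apply: measurable_funB => //; exact: (measurableT_comp (measurable_coord i) mX).
    exact: measurable_funB.
  move=> w _; have /andP[h1 h2] := sg_le (X w) ab.
  have g0 : 0 <= sg_prod a b (X w).
    by rewrite (le_trans _ h1)// mulr_ge0 ?(ltW pi2_gt0).
  by rewrite /= lee_fin (ger0_norm g0) (le_trans h2)// ler_norm.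
rewrite E// E// !lee_fin ler_pdivlMl// ler_pdivrMl//.
have iX A : measurable A -> P.-integrable setT (EFin \o (fun w => \1_A (X w) : R)).
  move=> mA; apply: (@prob_bounded_integrable _ _ _ _ _ 1); last by move=> w; rewrite ger0_norm.
  exact: mI.
rewrite -!RintegralZl//; [|exact: iX|exact: iX].
by apply/andP; split; apply: le_Rintegral => //; try exact: iA; move=> w _;
  have /andP[] := sg_le (X w) ab.
Qed.

(** Lower end of a shrunken interval; [shrink b a n] is its upper end. The divisor [n + 3] exceeds
    2, so the two ends never cross. *)
Let shrink (a b : 'I_d -> R) n i : R := a i + (b i - a i) / n.+3%:R.

Let shrink_bounds a b n i : a i < b i ->
  [/\ a i < shrink a b n i, shrink a b n i < shrink b a n i & shrink b a n i < b i].
Proof.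
move=> ab; rewrite /shrink -[a i - b i]opprB mulNr.
have h0 : 0 < b i - a i by rewrite subr_gt0.
have h1 : 0 < (b i - a i) / n.+3%:R by rewrite divr_gt0.
have h2 : (b i - a i) / n.+3%:R < (b i - a i) / 2.
  by rewrite ltr_pM2l// ltf_pV2 ?posrE// ltr_nat.
by move: h1 h2; set t := (b i - a i) / n.+3%:R => h1 h2; clearbody t; split; lra.
Qed.

Let shrink_nd a b n k i : a i < b i -> (n <= k)%N ->
  shrink a b k i <= shrink a b n i /\ shrink b a n i <= shrink b a k i.
Proof.
move=> ab nk; rewrite /shrink -[a i - b i]opprB !mulNr.
suff : (b i - a i) / k.+3%:R <= (b i - a i) / n.+3%:R.
  move: (_ / k.+3%:R) (_ / n.+3%:R) => t u tu; split; lra.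
by rewrite ler_pM2l ?subr_gt0// lef_pV2 ?posrE// ler_nat.
Qed.

(** [I] stands for the open and for the closed interval: the two exhaustions serve the two
    inequalities of [law_obox]. *)
Let obox_bigcup (I : R -> R -> set R) a b : (forall i, a i < b i) ->
  (forall u v, (`]u, v[ `<=` I u v)%classic) -> (forall u v, (I u v `<=` `[u, v])%classic) ->
  obox a b = \bigcup_n cV_box (fun i => I (shrink a b n i) (shrink b a n i)).
Proof.
move=> ab oI Ic; apply/seteqP; split => x; last first.
  move=> [n _ xn] i; have [h1 h2 h3] := shrink_bounds n (ab i).
  have := Ic _ _ _ (xn i); rewrite /= !in_itv/= => /andP[h4 h5].
  by rewrite (lt_le_trans h1)// (le_lt_trans h5).
move=> xab.
(* The point [x] lies in the [n]-th box as soon as, in every coordinate, [n + 3] exceeds the ratio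
   of the side to the distance from [x] to either end. *)
pose D i := (b i - a i) / (x i ord0 - a i) + (b i - a i) / (b i - x i ord0).
have D0 i : 0 <= D i.
  have := xab i; rewrite /= in_itv/= => /andP[h1 h2].
  by rewrite addr_ge0// divr_ge0// ltW// subr_gt0.
have [n Dn] := archi_bound_lt (\sum_(i < d) D i).
exists n => // i; apply: oI; rewrite /= in_itv/=.
have := xab i; rewrite /= in_itv/= => /andP[h1 h2].
have Di : D i < n.+3%:R.
  rewrite (@le_lt_trans _ _ (\sum_(i < d) D i))//.
    by rewrite (bigD1 i)//= lerDl sumr_ge0.
  rewrite (le_lt_trans (ler_norm _))// (lt_trans Dn)// ltr_nat//.
have p1 : 0 < x i ord0 - a i by rewrite subr_gt0.
have p2 : 0 < b i - x i ord0 by rewrite subr_gt0.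
have p3 : 0 < b i - a i by rewrite subr_gt0.
have n0 : (0 : R) < n.+3%:R by [].
have q1 : 0 < (b i - a i) / (x i ord0 - a i) by rewrite divr_gt0.
have q2 : 0 < (b i - a i) / (b i - x i ord0) by rewrite divr_gt0.
have r1 : (b i - a i) / n.+3%:R < x i ord0 - a i.
  rewrite ltr_pdivrMr// mulrC -ltr_pdivrMr//; move: Di; rewrite /D; lra.
have r2 : (b i - a i) / n.+3%:R < b i - x i ord0.
  rewrite ltr_pdivrMr// mulrC -ltr_pdivrMr//; move: Di; rewrite /D; lra.
rewrite /shrink -[a i - b i]opprB mulNr.
by move: r1 r2; move: (_ / n.+3%:R) => t r1 r2; apply/andP; split; lra.
Qed.

Let shrink_mono (I : R -> R -> set R) a b : (forall i, a i < b i) ->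
  (forall u v u' v', u' <= u -> v <= v' -> (I u v `<=` I u' v')%classic) ->
  nondecreasing_seq (fun n => cV_box (fun i => I (shrink a b n i) (shrink b a n i))).
Proof.
move=> ab mI n k nk; apply/subsetPset => x xn i.
by have [h1 h2] := shrink_nd (ab i) nk; apply: mI (xn i).
Qed.

(** [law_cbox] compares open with closed boxes. Applied to boxes that grow to the open box from
    inside, both of its inequalities pass to the limit, so the mass of the faces never has to be
    computed. *)
Let law_obox a b : P (X @^-1` obox a b) = nu (obox a b).
Proof.
have [ab|/existsNP[i /negP]] := pselect (forall i, a i < b i); last first.
  rewrite -leNgt => ba; rewrite (_ : obox a b = set0) ?preimage_set0 ?measure0//.
  rewrite -subset0 => x /(_ i); rewrite /= in_itv/= => /andP[h1 h2].
  by have := lt_le_trans (lt_trans h1 h2) ba; rewrite ltxx.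
have mXA A : measurable A -> measurable (X @^-1` A).
  by move=> mA; rewrite -[X in measurable X]setTI; exact: mX.
have sub (u v u' v' : R) : u' <= u -> v <= v' -> (`]u, v[ `<=` `]u', v'[)%classic.
  move=> uu vv x; rewrite /= !in_itv/= => /andP[h1 h2].
  by rewrite (le_lt_trans uu)// (lt_le_trans h2).
have csub (u v u' v' : R) : u' <= u -> v <= v' -> (`[u, v] `<=` `[u', v'])%classic.
  move=> uu vv x; rewrite /= !in_itv/= => /andP[h1 h2].
  by rewrite (le_trans uu)// (le_trans h2).
have oc (u v : R) : (`]u, v[ `<=` `[u, v])%classic.
  by move=> x; rewrite /= !in_itv/= => /andP[h1 h2]; rewrite !ltW.
pose On n := obox (shrink a b n) (shrink b a n).
pose Cn n := cbox (shrink a b n) (shrink b a n).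
have OE : obox a b = \bigcup_n On n.
  by apply: (@obox_bigcup (fun u v => `]u, v[%classic) a b ab) => u v //; exact: oc.
have CE : obox a b = \bigcup_n Cn n.
  by apply: (@obox_bigcup (fun u v => `[u, v]%classic) a b ab) => u v //; exact: oc.
have lc n : (P (X @^-1` On n) <= nu (Cn n) <= P (X @^-1` Cn n))%E.
  apply: law_cbox => i; have [_ + _] := @shrink_bounds a b n i (ab i).
  exact.
have mO : measurable (obox a b) by [].
apply/eqP; rewrite eq_le; apply/andP; split.
  have cv : P (X @^-1` On n) @[n --> \oo] --> P (X @^-1` obox a b).
    rewrite OE preimage_bigcup; apply: nondecreasing_cvg_mu.
    - by move=> n; apply: mXA; exact: mobox.
    - by rewrite -preimage_bigcup -OE; exact: mXA.
    - move=> n k nk; apply/subsetPset => w /=.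
      have /subsetPset := @shrink_mono (fun u v => `]u, v[%classic) a b ab sub n k nk.
      exact.
  rewrite -(cvg_lim _ cv)//; apply: lime_le; first by apply/cvg_ex; eexists; exact: cv.
  apply: nearW => n; have /andP[h1 _] := lc n.
  apply: le_trans h1 _; apply: le_measure; [by apply: mem_set; exact: mcbox|by apply: mem_set; exact: mobox|].
  by rewrite CE => x Cx; exists n.
have cv : nu (Cn n) @[n --> \oo] --> nu (obox a b).
  rewrite CE; apply: nondecreasing_cvg_mu.
  - by move=> n; exact: mcbox.
  - by rewrite -CE; exact: mobox.
  - exact: (@shrink_mono (fun u v => `[u, v]%classic) a b ab csub).
rewrite -(cvg_lim _ cv)//; apply: lime_le; first by apply/cvg_ex; eexists; exact: cv.
apply: nearW => n; have /andP[_ h2] := lc n.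
apply: le_trans h2 _; apply: le_measure.
- by apply: mem_set; apply: mXA; exact: mcbox.
- by apply: mem_set; apply: mXA; exact: mobox.
- by rewrite CE => w Cw; exists n.
Qed.

Lemma inversion_density_law B : measurable B ->
  P (X @^-1` B) = (\int[lam]_(x in B) (q x)%:E)%E.
Proof.
move=> mB.
apply: (@measure_unique _ R _ open_boxes (fun k => obox (fun=> - k.+1%:R) (fun=> k.+1%:R))
  measurable_cV_open_boxes _ _ _ (pushforward P X) nu) => //.
- move=> _ _ [a1 [b1 ->]] [a2 [b2 ->]].
  exists (fun i => Num.max (a1 i) (a2 i)), (fun i => Num.min (b1 i) (b2 i)).
  apply/seteqP; split => x /=.
    move=> [h1 h2] i; have := h1 i; have := h2 i; rewrite /= !in_itv/=.
    by move=> /andP[? ?] /andP[? ?]; rewrite gt_max lt_min; apply/andP; split; apply/andP.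
  move=> h; split => i; have := h i; rewrite /= !in_itv/= gt_max lt_min;
    by move=> /andP[/andP[? ?] /andP[? ?]]; apply/andP.
- by move=> k; exists (fun=> - k.+1%:R), (fun=> k.+1%:R).
- apply/seteqP; split => // x _; have [n xn] := cV_archi_bound x.
  exists n => // i; rewrite /= in_itv/=.
  by have := xn n i (leqnn n); rewrite ltr_norml.
- by move=> _ [a [b ->]]; exact: law_obox.
- move=> k; rewrite /pushforward; apply: (@le_lt_trans _ _ 1%E); last by rewrite ltry.
  by apply: probability_le1; rewrite -[X in measurable X]setTI; apply: mX.
Qed.

End density.

(** * The characteristic exponent and the concentration function [h] *)

Section trig_bounds.
Context {R : realType}.
Implicit Types u v : R.

Lemma norm_sin_le u : `|sin u| <= `|u|.
Proof.
wlog u0 : u / 0 < u => [H|].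
  have [u0|u0|->] := ltgtP u 0; last by rewrite sin0 normr0.
    by rewrite -normrN -sinN -[leRHS]normrN H// oppr_gt0.
  exact: H.
have [c _] := @MVT R sin cos 0 u u0 (fun x _ => is_derive_sin x)
  (continuous_subspaceT (@continuous_sin R)).
rewrite sin0 !subr0 => ->; rewrite normrM ler_piMl// cos_max//.
Qed.

Lemma onemcos_sin u : 1 - cos u = 2 * sin (u / 2) ^+ 2.
Proof.
have {1}-> : u = (u / 2) *+ 2 by rewrite mulr2n; field.
by rewrite cos_mulr2n cos2sin2; rewrite -mulr_natl; ring.
Qed.

Lemma onemcos_ge0 u : 0 <= 1 - cos u.
Proof. by rewrite subr_ge0 cos_le1. Qed.

Lemma onemcos_le2 u : 1 - cos u <= 2.
Proof. by have := cos_geN1 u; lra. Qed.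

Lemma onemcos_le_sqr u : 1 - cos u <= u ^+ 2 / 2.
Proof.
rewrite onemcos_sin.
have : sin (u / 2) ^+ 2 <= (u / 2) ^+ 2.
  rewrite -[leLHS]real_normK ?num_real// -[leRHS]real_normK ?num_real//.
  by rewrite ler_sqr ?nnegrE// norm_sin_le.
by rewrite exprMn exprVn; lra.
Qed.

Lemma onemcos_le_min u : 1 - cos u <= 2 * Num.min 1 (u ^+ 2).
Proof.
have := onemcos_le2 u; have := onemcos_le_sqr u; have := sqr_ge0 u.
by case: (leP 1 (u ^+ 2)); lra.
Qed.

Lemma onemcos_le_norm u : 1 - cos u <= `|u|.
Proof.
have [u1|u1] := leP `|u| 2; last by have := onemcos_le2 u; lra.
rewrite (le_trans (onemcos_le_sqr u))// -real_normK ?num_real//.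
by have := normr_ge0 u; nra.
Qed.

(** Mean value theorem: the derivative [cos c - 1] is at most [c <= u] in absolute value. A
    quadratic bound is what the integrability of compensated jumps calls for. *)
Lemma sin_sub_le_sqr u : `|sin u - u| <= u ^+ 2.
Proof.
wlog u0 : u / 0 < u => [H|].
  have [u0|u0|->] := ltgtP u 0; last by rewrite sin0 subrr normr0 sqr_ge0.
    by rewrite -normrN opprD -sinN -[leRHS]sqrrN H// oppr_gt0.
  exact: H.
have dF (x : R) : is_derive x 1 (fun x : R => sin x - x) (cos x - 1).
  by apply: is_derive_eq.
have cF : {within `[0, u], continuous (fun x : R => sin x - x)}.
  apply: continuous_subspaceT => x; apply: cvgB; [exact: continuous_sin|exact: cvg_id].
have [c] := @MVT R (fun x => sin x - x) (fun x => cos x - 1) 0 u u0 (fun x _ => dF x) cF.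
rewrite in_itv/= => /andP[c0 cu].
rewrite sin0 !subr0 => ->; rewrite normrM -normrN opprB (ger0_norm (onemcos_ge0 c)).
rewrite expr2 (ger0_norm (ltW u0)) ler_pM2r//.
by rewrite (le_trans (onemcos_le_norm c))// gtr0_norm// ltW.
Qed.

(** With [v = u / 2], [sin_sub_le_sqr] gives [|sin v| >= |v| / 2], so that [1 - cos u = 2 sin^2 v]
    is at least [v^2 / 2 = u^2 / 8]. *)
Lemma onemcos_ge_sqr u : `|u| <= 1 -> u ^+ 2 <= 8 * (1 - cos u).
Proof.
move=> u1; rewrite onemcos_sin.
set v := u / 2; have -> : u = 2 * v by rewrite /v; field.
have v1 : `|v| <= 1 / 2.
  by rewrite /v normrM (ger0_norm (_ : 0 <= 2^-1)) ?invr_ge0//; lra.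
have sv : `|v| / 2 <= `|sin v|.
  have h1 : `|v| <= `|sin v - v| + `|sin v|.
    by rewrite -[`|sin v - v|]normrN (le_trans _ (ler_normD _ _))// opprB subrK.
  have h2 : v ^+ 2 <= `|v| / 2.
    by rewrite -real_normK ?num_real//; have := normr_ge0 v; nra.
  have := sin_sub_le_sqr v; lra.
rewrite exprMn -[v ^+ 2]real_normK ?num_real// -[sin v ^+ 2]real_normK ?num_real//.
by have := normr_ge0 v; nra.
Qed.

(** The half-angle formula reduces this to [(p + q)^2 <= 2 p^2 + 2 q^2] for the two products in the
    expansion of [sin (u / 2 + v / 2)]. *)
Lemma onemcosD u v : 1 - cos (u + v) <= 2 * (1 - cos u) + 2 * (1 - cos v).
Proof.
rewrite !onemcos_sin (mulrDl u v) sinD.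
have := sqr_ge0 (sin (u / 2) * cos (v / 2) - cos (u / 2) * sin (v / 2)).
have := cos2Dsin2 (v / 2); have := cos2Dsin2 (u / 2).
set a := sin (u / 2); set b := cos (u / 2); set c := sin (v / 2); set e := cos (v / 2).
move=> h1 h2 h3.
have e1 : e ^+ 2 <= 1 by have := sqr_ge0 c; lra.
have b1 : b ^+ 2 <= 1 by have := sqr_ge0 a; lra.
have : (a * e) ^+ 2 <= a ^+ 2 by rewrite exprMn ler_piMr ?sqr_ge0.
have : (b * c) ^+ 2 <= c ^+ 2 by rewrite exprMn ler_piMl ?sqr_ge0.
rewrite (_ : (a * e + b * c) ^+ 2 = 2 * (a * e) ^+ 2 + 2 * (b * c) ^+ 2 - (a * e - b * c) ^+ 2); last by ring.
lra.
Qed.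

Lemma norm_sin_muln n u : `|sin (n%:R * u)| <= n%:R * `|sin u|.
Proof.
elim: n => [|n IH]; first by rewrite !mul0r sin0 normr0.
rewrite -natr1 mulrDl mul1r sinD (le_trans (ler_normD _ _))// !normrM mulrDl mul1r.
rewrite lerD//; first by rewrite (le_trans _ IH)// ler_piMr ?cos_max.
by rewrite ler_piMl ?cos_max.
Qed.

Lemma onemcos_muln n u : 1 - cos (n%:R * u) <= n%:R ^+ 2 * (1 - cos u).
Proof.
rewrite !onemcos_sin [leRHS]mulrCA ler_wpM2l// -mulrA -exprMn.
rewrite -[leLHS]real_normK ?num_real// -[leRHS]real_normK ?num_real//.
by rewrite ler_sqr ?nnegrE// normrM normr_nat norm_sin_muln.
Qed.

(** Write [1 - E c = (1 - E) + E (1 - c)] with [E = expR (- a)] between [1 - a] and 1. *)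
Lemma onem_expRcos (a b : R) : 0 <= a -> 1 - expR (- a) * cos b <= a + `|b|.
Proof.
move=> a0.
have e1 : expR (- a) <= 1 by rewrite expR_le1 oppr_le0.
have := expR_ge1Dx (- a); have := onemcos_le_norm b; have := onemcos_ge0 b.
have := expR_gt0 (- a); set E := expR _ in e1 *; set c := cos b; nra.
Qed.

End trig_bounds.

Section opnorm_theory.
Context {R : realType} {d : nat}.
Implicit Types (A : 'M[R]_d) (x y : 'cV[R]_d).

Lemma opnorm_has_sup A :
  has_sup [set enorm (A *m x) | x in [set x : 'cV[R]_d | enorm x <= 1]].
Proof.
split; first by exists (enorm (A *m 0)), 0 => //=; rewrite enorm0.
exists (d%:R * \sum_i \sum_j `|A i j|) => _ [x /= x1 <-].
apply: enorm_le_coord; first by apply: sumr_ge0 => i _; exact: sumr_ge0.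
move=> i; rewrite mxE (le_trans (ler_norm_sum _ _ _))//.
rewrite (@le_trans _ _ (\sum_j `|A i j|))//.
  apply: ler_sum => j _; rewrite normrM ler_piMr//.
  by rewrite (le_trans (coord_le_enorm x j)).
rewrite [leRHS](bigD1 i)//= lerDl; apply: sumr_ge0 => k _; exact: sumr_ge0.
Qed.

Lemma opnorm_ge0 A : 0 <= opnorm A.
Proof.
apply: (ub_le_sup (opnorm_has_sup A).2); exists 0; first by rewrite /= enorm0.
by rewrite mulmx0 enorm0.
Qed.

Lemma enorm_mulmx_le A x : enorm (A *m x) <= opnorm A * enorm x.
Proof.
have [x0|x0] := eqVneq (enorm x) 0.
  by rewrite (enorm_eq0 x0) mulmx0 enorm0 mulr0.
have xgt0 : 0 < enorm x by rewrite lt_neqAle eq_sym x0 enorm_ge0.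
rewrite -ler_pdivrMr//.
apply: (ub_le_sup (opnorm_has_sup A).2); exists ((enorm x)^-1 *: x) => /=.
  by rewrite enormZ ger0_norm ?invr_ge0 ?enorm_ge0// mulVf.
by rewrite -scalemxAr enormZ ger0_norm ?invr_ge0 ?enorm_ge0// mulrC.
Qed.

Lemma dotp_mulmx_le A x : dotp x (A *m x) <= opnorm A * enorm x ^+ 2.
Proof.
rewrite (le_trans (ler_norm _))// (le_trans (dotp_CS _ _))// expr2 mulrA [leLHS]mulrC.
by rewrite ler_wpM2r ?enorm_ge0// enorm_mulmx_le.
Qed.

Lemma dotp_mulmx_sym A x y : A^T = A -> dotp x (A *m y) = dotp (A *m x) y.
Proof.
move=> AT; rewrite /dotp.
under eq_bigr do rewrite mxE mulr_sumr.
rewrite exchange_big/=; apply: eq_bigr => j _.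
rewrite mxE mulr_suml; apply: eq_bigr => i _.
by rewrite -[in LHS]AT mxE; ring.
Qed.

(* Cauchy-Schwarz for the semi-inner product [<x, A y>] with [y = A x]. *)
Lemma opnorm_le_quad A (Q : R) : A^T = A -> (forall x, 0 <= dotp x (A *m x)) ->
  (forall x, enorm x <= 1 -> dotp x (A *m x) <= Q) -> opnorm A <= Q.
Proof.
move=> AT A0 AQ.
have Q0 : 0 <= Q by rewrite (le_trans (A0 0))// AQ// enorm0.
apply: ge_sup; first exact: (opnorm_has_sup A).1.
move=> _ [x /= x1 <-].
have AQ' y : dotp y (A *m y) <= Q * enorm y ^+ 2.
  have [y0|y0] := eqVneq (enorm y) 0.
    by rewrite (enorm_eq0 y0) mulmx0 dotp0l enorm0 expr0n mulr0.
  have ygt0 : 0 < enorm y by rewrite lt_neqAle eq_sym y0 enorm_ge0.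
  have := AQ ((enorm y)^-1 *: y).
  rewrite enormZ ger0_norm ?invr_ge0 ?enorm_ge0// mulVf// lexx => /(_ isT).
  rewrite -scalemxAr dotpZl dotpZr mulrA -expr2 exprVn mulrC ler_pdivrMr//.
  by rewrite exprn_gt0.
set y := A *m x.
have [y0|y0] := eqVneq (enorm y) 0; first by rewrite y0.
have ygt0 : 0 < enorm y by rewrite lt_neqAle eq_sym y0 enorm_ge0.
set a := dotp x (A *m x); set c := dotp y (A *m y).
have b : dotp x (A *m y) = enorm y ^+ 2.
  by rewrite dotp_mulmx_sym// sqr_enorm.
have b' : dotp y (A *m x) = enorm y ^+ 2 by rewrite sqr_enorm.
have a1 : a <= Q by exact: AQ.
have a0 : 0 <= a by exact: A0.
have c1 : c <= Q * enorm y ^+ 2 by exact: AQ'.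
set s := enorm y in ygt0 y0 b b' c1 *.
have H (t : R) : 0 <= t ^+ 2 * a - 2 * t * s ^+ 2 + c.
  have := A0 (t *: x - y).
  rewrite mulmxBr -scalemxAr dotpBl !dotpBr !dotpZl !dotpZr b b' -/a -/c.
  by congr (0 <= _); ring.
have s2 : 0 < s ^+ 2 by rewrite exprn_gt0.
have [Q00|Qn0] := eqVneq Q 0.
  have := H 1; move: a1 c1; rewrite Q00; lra.
have Qgt0 : 0 < Q by rewrite lt_neqAle eq_sym Qn0.
(* [t = s^2 / Q] minimises the quadratic once [a] and [c] are replaced by their bounds [Q] and
   [Q * s^2]; nonnegativity there reads [s <= Q]. *)
have : 0 <= (s ^+ 2 / Q) ^+ 2 * Q - 2 * (s ^+ 2 / Q) * s ^+ 2 + Q * s ^+ 2.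
  apply: le_trans (H (s ^+ 2 / Q)) _; rewrite lerD// lerD2r.
  by rewrite ler_wpM2l ?sqr_ge0.
rewrite (_ : _ + _ = s ^+ 2 / Q * (Q ^+ 2 - s ^+ 2)); last by field.
rewrite pmulr_rge0 ?divr_gt0// subr_ge0 ler_sqr// nnegrE ltW//.
Qed.

End opnorm_theory.

(** * The exponent in terms of truncated second moments of the jumps *)

Section levy_exponent.
Context {R : realType} {d : nat}.
Variable g : levy_triplet R d.
Implicit Types x y z u : 'cV[R]_d.
Local Notation N := (jump g).
Local Notation A := (gauss g).

Definition psi x : R := complex.Re (Psi g x).
Definition phase x : R := complex.Im (Psi g x).

Definition trunc_sqr (r : R) z : R := Num.min 1 (enorm z ^+ 2 / r ^+ 2).

Lemma trunc_sqr_ge0 r z : 0 <= trunc_sqr r z.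
Proof. by rewrite /trunc_sqr le_min ler01 divr_ge0 ?sqr_ge0. Qed.

Lemma measurable_trunc_sqr r : measurable_fun setT (trunc_sqr r).
Proof.
apply: measurable_minr => //; apply: measurable_funM => //.
by apply: measurable_funX; apply: measurable_enorm; exact: measurable_id.
Qed.

Lemma integrable_trunc_sqr1 : N.-integrable setT (EFin \o trunc_sqr 1).
Proof.
apply/integrableP; split; first by apply: mEFin; exact: measurable_trunc_sqr.
have := jump_fin g; congr (_ < _)%E; apply: eq_integral => z _.
by rewrite /= ger0_norm ?trunc_sqr_ge0// /trunc_sqr expr1n divr1.
Qed.

Lemma trunc_sqr_le (r s : R) z : 0 < r <= s -> trunc_sqr s z <= trunc_sqr r z.
Proof.
move=> /andP[r0 rs]; have s0 : 0 < s by exact: lt_le_trans rs.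
rewrite /trunc_sqr le_min ge_min lexx/= ge_min; apply/orP; right.
by rewrite ler_wpM2l ?sqr_ge0// lef_pV2 ?posrE ?exprn_gt0// ler_sqr ?nnegrE ?(ltW r0) ?(ltW s0).
Qed.

Lemma trunc_sqr_scale (r K : R) z : 0 < r -> 1 <= K ->
  trunc_sqr r z <= K ^+ 2 * trunc_sqr (K * r) z.
Proof.
move=> r0 K1; have K0 : 0 < K by exact: lt_le_trans K1.
have K2 : 1 <= K ^+ 2 by rewrite exprn_ege1.
rewrite /trunc_sqr [leRHS]minr_pMr ?sqr_ge0// mulr1 le_min !ge_min K2/=.
have -> : K ^+ 2 * (enorm z ^+ 2 / (K * r) ^+ 2) = enorm z ^+ 2 / r ^+ 2.
  by field; rewrite !gt_eqF.
by rewrite lexx orbT.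
Qed.

Lemma integrable_trunc_sqr r : 0 < r -> N.-integrable setT (EFin \o trunc_sqr r).
Proof.
(* This factor sends the radius [r] to [r + 1 >= 1], where [trunc_sqr 1] is a majorant. *)
move=> r0; have K1 : 1 <= 1 + r^-1 by rewrite lerDl invr_ge0 ltW.
apply: (le_integrable measurableT _ _ (integrableZl measurableT ((1 + r^-1) ^+ 2) integrable_trunc_sqr1)).
  by apply: mEFin; exact: measurable_trunc_sqr.
move=> z _; have g0 : 0 <= (1 + r^-1) ^+ 2 * trunc_sqr 1 z.
  by apply: mulr_ge0; [exact: sqr_ge0|exact: trunc_sqr_ge0].
rewrite /= lee_fin (ger0_norm g0) ger0_norm ?trunc_sqr_ge0//.
rewrite (le_trans (trunc_sqr_scale z r0 K1))// ler_wpM2l ?sqr_ge0//.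
apply: trunc_sqr_le; rewrite ltr01 mulrDl mul1r mulVf ?gt_eqF//.
by rewrite lerDr ltW.
Qed.

Lemma jump_integrable (f : 'cV[R]_d -> R) (C r : R) : 0 < r ->
  measurable_fun setT f -> (forall z, `|f z| <= C * trunc_sqr r z) ->
  N.-integrable setT (EFin \o f).
Proof.
move=> r0 mf fC.
apply: (le_integrable measurableT _ _ (integrableZl measurableT C (integrable_trunc_sqr r0))).
  exact: mEFin.
by move=> z _; rewrite /= lee_fin (le_trans (fC z))// ler_norm.
Qed.

Lemma norm_jump_integral (f : 'cV[R]_d -> R) (C r : R) : 0 < r ->
  measurable_fun setT f -> (forall z, `|f z| <= C * trunc_sqr r z) ->
  `|\int[N]_z f z| <= C * \int[N]_z trunc_sqr r z.
Proof.
move=> r0 mf fC; have fi := jump_integrable r0 mf fC.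
rewrite (le_trans (le_normr_Rintegral measurableT fi))//.
rewrite -RintegralZl//; last exact: integrable_trunc_sqr.
apply: le_Rintegral => //; first exact: integrable_norm.
by have := integrableZl measurableT C (integrable_trunc_sqr r0).
Qed.

Lemma hE r : h g r = r ^- 2 * opnorm A + \int[N]_z trunc_sqr r z.
Proof. by []. Qed.

Lemma jump_le_h r : 0 < r -> \int[N]_z trunc_sqr r z <= h g r.
Proof.
by move=> r0; rewrite hE lerDr mulr_ge0 ?opnorm_ge0// invr_ge0 sqr_ge0.
Qed.

Lemma h_ge0 r : 0 <= h g r.
Proof.
rewrite hE addr_ge0 ?mulr_ge0 ?opnorm_ge0 ?invr_ge0 ?sqr_ge0//.
by apply: Rintegral_ge0 => z _; exact: trunc_sqr_ge0.
Qed.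

Lemma h_le r s : 0 < r <= s -> h g s <= h g r.
Proof.
move=> /[dup] rs' /andP[r0 rs]; have s0 : 0 < s by exact: lt_le_trans rs.
rewrite !hE lerD//.
  rewrite ler_wpM2r ?opnorm_ge0// lef_pV2 ?posrE ?exprn_gt0//.
  by rewrite ler_sqr ?nnegrE ?(ltW r0) ?(ltW s0).
apply: le_Rintegral => //; try exact: integrable_trunc_sqr.
by move=> z _; exact: trunc_sqr_le.
Qed.

Lemma h_scale r K : 0 < r -> 1 <= K -> h g r <= K ^+ 2 * h g (K * r).
Proof.
move=> r0 K1; have K0 : 0 < K by exact: lt_le_trans K1.
rewrite !hE mulrDr lerD//.
  by rewrite mulrA exprMn (_ : K ^+ 2 / _ = r ^- 2) //; field; rewrite !gt_eqF.
rewrite -RintegralZl//; last by apply: integrable_trunc_sqr; rewrite mulr_gt0.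
apply: le_Rintegral => //.
- exact: integrable_trunc_sqr.
- have := integrable_trunc_sqr (mulr_gt0 K0 r0).
  by move=> /(integrableZl measurableT (K ^+ 2)).
- by move=> z _; exact: trunc_sqr_scale.
Qed.

Lemma measurable_dotpr x : measurable_fun setT (dotp x).
Proof. by apply: measurable_dotp; [exact: measurable_cst|exact: measurable_id]. Qed.

Lemma dotp_sqr_le (r K : R) x z : 0 < r -> 1 <= K -> enorm x ^+ 2 * r ^+ 2 <= K ->
  Num.min 1 (dotp x z ^+ 2) <= K * trunc_sqr r z.
Proof.
move=> r0 K1 xK; have K0 : 0 <= K by rewrite (le_trans ler01).
rewrite /trunc_sqr [leRHS]minr_pMr// mulr1 le_min !ge_min K1/=; apply/orP; right.
rewrite -[leLHS]real_normK ?num_real//.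
rewrite (@le_trans _ _ ((enorm x * enorm z) ^+ 2))//.
  by rewrite ler_sqr ?nnegrE ?mulr_ge0 ?enorm_ge0// dotp_CS.
have -> : (enorm x * enorm z) ^+ 2 =
    (enorm x ^+ 2 * r ^+ 2) * (enorm z ^+ 2 / r ^+ 2) by field; rewrite gt_eqF.
by rewrite ler_wpM2r// divr_ge0 ?sqr_ge0.
Qed.

Lemma measurable_onemcos x : measurable_fun setT (fun z => 1 - cos (dotp x z)).
Proof.
apply: measurable_funB => //; apply: (measurableT_comp measurable_cos).
exact: measurable_dotpr.
Qed.

Lemma norm_onemcos_le (r K : R) x z : 0 < r -> 1 <= K -> enorm x ^+ 2 * r ^+ 2 <= K ->
  `|1 - cos (dotp x z)| <= 2 * K * trunc_sqr r z.
Proof.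
move=> r0 K1 xK; rewrite ger0_norm ?onemcos_ge0// (le_trans (onemcos_le_min _))//.
by rewrite -mulrA ler_wpM2l// dotp_sqr_le.
Qed.

Lemma integrable_onemcos x : N.-integrable setT (EFin \o (fun z => 1 - cos (dotp x z))).
Proof.
apply: (@jump_integrable _ (2 * (1 + enorm x ^+ 2)) 1 ltr01).
  exact: measurable_onemcos.
move=> z; apply: norm_onemcos_le => //; first by rewrite lerDl sqr_ge0.
by rewrite expr1n mulr1 lerDr.
Qed.

(** Moving the truncation radius from 1 to [r] turns the drift into [drift_r g r]; this is the
    imaginary part of the integrand after that change. *)
Definition sin_compensated r x z := sin (dotp x z) - dotp x z * \1_(eball r) z.

Lemma measurable_eball r : measurable (eball r : set 'cV[R]_d).
Proof.
have menorm : measurable_fun setT (@enorm R d) by apply: measurable_enorm; exact: measurable_id.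
have mlt : measurable_fun setT (fun z : 'cV[R]_d => enorm z < r).
  by apply: measurable_fun_ltr.
have := mlt measurableT [set true]; rewrite setTI; apply.
by [].
Qed.

Lemma measurable_sin_compensated r x : measurable_fun setT (sin_compensated r x).
Proof.
apply: measurable_funB.
  by apply: (measurableT_comp measurable_sin); exact: measurable_dotpr.
apply: measurable_funM; first exact: measurable_dotpr.
by apply: measurable_indic; exact: measurable_eball.
Qed.

(** Inside the ball of radius [r] the compensated sine is quadratic in [dotp x z]; outside only the
    bounded sine is left. *)
Lemma sin_compensated_le (r K : R) x z : 0 < r -> 1 <= K ->
  enorm x ^+ 2 * r ^+ 2 <= K -> `|sin_compensated r x z| <= K * trunc_sqr r z.
Proof.
move=> r0 K1 xK; rewrite /sin_compensated indicE.
have [|] := boolP (z \in _).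
  rewrite inE /eball/= mulr1 => zr.
  rewrite (le_trans (sin_sub_le_sqr _))//.
  rewrite -[leLHS]real_normK ?num_real// /trunc_sqr min_r; last first.
    rewrite ler_pdivrMr ?exprn_gt0// mul1r ler_sqr ?nnegrE ?enorm_ge0//; exact: ltW.
  rewrite (@le_trans _ _ ((enorm x * enorm z) ^+ 2))//.
    by rewrite ler_sqr ?nnegrE ?mulr_ge0 ?enorm_ge0// dotp_CS.
  have -> : (enorm x * enorm z) ^+ 2 =
      (enorm x ^+ 2 * r ^+ 2) * (enorm z ^+ 2 / r ^+ 2) by field; rewrite gt_eqF.
  by rewrite ler_wpM2r// divr_ge0 ?sqr_ge0.
rewrite notin_setE /eball/= => /negP; rewrite -leNgt => rz.
rewrite mulr0 subr0 /trunc_sqr min_l ?mulr1; first exact: le_trans (sin_max _) K1.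
by rewrite ler_pdivlMr ?exprn_gt0// mul1r ler_sqr ?nnegrE ?enorm_ge0 ?(ltW r0).
Qed.

Lemma integrable_sin_compensated r x : 0 < r ->
  N.-integrable setT (EFin \o sin_compensated r x).
Proof.
move=> r0; apply: (@jump_integrable _ (1 + enorm x ^+ 2 * r ^+ 2) r r0).
  exact: measurable_sin_compensated.
move=> z; apply: sin_compensated_le => //; last by rewrite lerDr.
by rewrite lerDl mulr_ge0 ?sqr_ge0.
Qed.

Let Psi_integrand x z : cexp ('i%C * (dotp x z)%:C%C) - 1
    - 'i%C * (dotp x z)%:C%C * \1_(eball 1) z =
  Complex (cos (dotp x z) - 1) (sin_compensated 1 x z).
Proof.
have -> : \1_(eball 1) z = (\1_(eball 1) z : R)%:C%C :> R[i].
  by rewrite !indicE; case: (_ \in _).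
rewrite /cexp /sin_compensated; apply/eqP; rewrite eq_complex /=.
by rewrite !(mul0r, mulr0, mul1r, mulr1, subr0, sub0r, add0r, addr0, oppr0, expR0) !eqxx.
Qed.

Lemma psiE x : psi x = dotp x (A *m x) + \int[N]_z (1 - cos (dotp x z)).
Proof.
rewrite /psi /Psi /cintegral /= mul0r mulr0 subrr subr0; congr (_ + _).
under eq_Rintegral do rewrite Psi_integrand /=.
have -> : \int[N]_z (1 - cos (dotp x z)) = \int[N]_z ((-1) * (cos (dotp x z) - 1)).
  by apply: eq_Rintegral => z _; rewrite mulN1r opprB.
rewrite RintegralZl ?mulN1r//.
have := integrableZl measurableT (-1) (integrable_onemcos x).
apply: eq_integrable => // z _ /=; rewrite -EFinM; congr EFin; ring.
Qed.

Lemma phaseE x : phase x = - dotp x (drift g) - \int[N]_z sin_compensated 1 x z.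
Proof.
rewrite /phase /Psi /cintegral /= mul0r mul1r !add0r; congr (_ - _).
by apply: eq_Rintegral => z _; rewrite Psi_integrand.
Qed.

Lemma psi_ge0 x : 0 <= psi x.
Proof.
rewrite psiE addr_ge0 ?gauss_ge0//.
by apply: Rintegral_ge0 => z _; exact: onemcos_ge0.
Qed.

(** The free [K] serves two uses: [K = 1] for frequencies up to [1 / r], and [K = 1 + r^2 |x|^2] for
    all frequencies in the concentration estimate. *)
Lemma psi_le (r K : R) x : 0 < r -> 1 <= K -> enorm x ^+ 2 * r ^+ 2 <= K ->
  psi x <= 2 * K * h g r.
Proof.
move=> r0 K1 xK; rewrite psiE hE mulrDr lerD//.
  rewrite (le_trans (dotp_mulmx_le _ _))// [leRHS]mulrA [leLHS]mulrC ler_wpM2r ?opnorm_ge0//.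
  rewrite ler_pdivlMr ?exprn_gt0// (le_trans xK)//.
  by rewrite ler_peMl ?ler1n// (le_trans ler01).
rewrite (le_trans (ler_norm _))//; apply: norm_jump_integral => //.
  exact: measurable_onemcos.
by move=> z; exact: norm_onemcos_le.
Qed.

Lemma dotp_drift_r r x : 0 < r -> dotp x (drift_r g r) =
  dotp x (drift g) + \int[N]_z (dotp x z * (\1_(eball r) z - \1_(eball 1) z)).
Proof.
move=> r0; rewrite /drift_r dotpDr; congr (_ + _).
(* The sines cancel in the difference of the compensated sines at radii 1 and [r]. *)
have int_tr y : N.-integrable setT
    (EFin \o (fun z => dotp y z * (\1_(eball r) z - \1_(eball 1) z))).
  have := integrableB measurableT (integrable_sin_compensated y ltr01) (integrable_sin_compensated y r0).
  apply: eq_integrable => // z _; rewrite /sin_compensated /= -EFinB; congr EFin; ring.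
have coordE i z : z i ord0 = dotp (delta_mx i ord0) z.
  rewrite /dotp (bigD1 i)//= big1 ?addr0 ?mxE ?eqxx ?mul1r//.
  by move=> j ji; rewrite mxE (negbTE ji) mul0r.
have int_i i : N.-integrable setT (EFin \o
    (fun z : 'cV[R]_d => z i ord0 * (\1_(eball r) z - \1_(eball 1) z))).
  have := int_tr (delta_mx i ord0); apply: eq_integrable => // z _ /=.
  by rewrite -coordE.
apply: EFin_inj; rewrite -Rintegral_EFin//.
transitivity (\int[N]_z (\sum_(i < d) (x i ord0)%:E *
    (z i ord0 * (\1_(eball r) z - \1_(eball 1) z))%:E))%E; last first.
  apply: eq_integral => z _; rewrite /dotp mulr_suml -sumEFin.
  by apply: eq_bigr => i _; rewrite -EFinM mulrA.
rewrite integral_sum//; last by move=> i; have := integrableZl measurableT (x i ord0) (int_i i).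
rewrite /dotp -sumEFin; apply: eq_bigr => i _.
rewrite mxE integralZl//; last exact: int_i.
by rewrite EFinM; congr (_ * _)%E; rewrite -Rintegral_EFin//; exact: int_i.
Qed.

(** Recentring by [drift_r g r] leaves exactly the integral of [sin_compensated r], of order [h g r]
    at frequencies up to [1 / r]: this is what makes [t *: drift_r g r] the right centre for the law
    at time [t = 1 / h g r]. *)
Lemma phase_drift_le (r K : R) x : 0 < r -> 1 <= K -> enorm x ^+ 2 * r ^+ 2 <= K ->
  `|phase x + dotp x (drift_r g r)| <= K * h g r.
Proof.
move=> r0 K1 xK; have K0 : 0 <= K by rewrite (le_trans ler01).
have -> : phase x + dotp x (drift_r g r) = - \int[N]_z sin_compensated r x z.
  rewrite phaseE dotp_drift_r// addrACA addNr add0r.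
  have -> : \int[N]_z (dotp x z * (\1_(eball r) z - \1_(eball 1) z)) =
      \int[N]_z (sin_compensated 1 x z - sin_compensated r x z).
    by apply: eq_Rintegral => z _; rewrite /sin_compensated; ring.
  rewrite RintegralB//; first by ring.
    exact: integrable_sin_compensated.
  exact: integrable_sin_compensated.
rewrite normrN.
apply: (@le_trans _ _ (K * \int[N]_z trunc_sqr r z)).
  apply: norm_jump_integral => //; first exact: measurable_sin_compensated.
  by move=> z; exact: sin_compensated_le.
by rewrite ler_wpM2l// jump_le_h.
Qed.

(** The jump part follows from [onemcosD] and [onemcos_muln], the Gaussian part from nonnegativity
    of the form at [n x - y]. *)
Lemma psiD (n : nat) x y : psi (n%:R *: x + y) <= 2 * n%:R ^+ 2 * psi x + 2 * psi y.
Proof.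
rewrite !psiE !mulrDr addrACA lerD//.
  have := gauss_ge0 g (n%:R *: x - y).
  rewrite mulmxBr mulmxDr -scalemxAr !dotpBl !dotpDl !dotpBr !dotpDr !dotpZl !dotpZr.
  lra.
rewrite -!RintegralZl//; try exact: integrable_onemcos.
rewrite -RintegralD//; last 2 first.
- by have := integrableZl measurableT (2 * n%:R ^+ 2) (integrable_onemcos x).
- by have := integrableZl measurableT 2 (integrable_onemcos y).
apply: le_Rintegral => //; first exact: integrable_onemcos.
  have := integrableD measurableT
    (integrableZl measurableT (2 * n%:R ^+ 2) (integrable_onemcos x))
    (integrableZl measurableT 2 (integrable_onemcos y)).
  by [].
move=> z _; rewrite dotpDl dotpZl (le_trans (onemcosD _ _))// lerD2r.
by rewrite -mulrA ler_wpM2l// onemcos_muln.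
Qed.

Lemma psi_muln (n : nat) x : psi (n%:R *: x) <= n%:R ^+ 2 * psi x.
Proof.
rewrite !psiE mulrDr -scalemxAr dotpZl dotpZr mulrA -expr2 lerD2l.
rewrite -RintegralZl//; last exact: integrable_onemcos.
apply: le_Rintegral => //; first exact: integrable_onemcos.
  by have := integrableZl measurableT (n%:R ^+ 2) (integrable_onemcos x).
by move=> z _; rewrite dotpZl onemcos_muln.
Qed.

End levy_exponent.

(** * Comparison of h with Psistar *)

Section Psistar_theory.
Context {R : realType} {d : nat}.
Variable g : levy_triplet R d.
Implicit Types x y z : 'cV[R]_d.
Local Notation N := (jump g).
Local Notation mu := (@lebesgue_measure R).

Lemma psi_ball_has_sup (rho : R) : 0 <= rho ->
  has_sup [set complex.Re (Psi g z) | z in [set z : 'cV[R]_d | enorm z <= rho]].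
Proof.
move=> rho0; split; first by exists (psi g 0), 0 => //=; rewrite enorm0.
exists (2 * (1 + rho ^+ 2) * h g 1) => _ [z /= zr <-].
apply: psi_le => //; first by rewrite lerDl sqr_ge0.
rewrite expr1n mulr1 (@le_trans _ _ (rho ^+ 2))// ?lerDr//.
by rewrite ler_sqr ?nnegrE ?enorm_ge0.
Qed.

Lemma psi_le_Psistar (rho : R) z : enorm z <= rho -> psi g z <= Psistar g rho.
Proof.
move=> zr; have rho0 : 0 <= rho by exact: le_trans (enorm_ge0 z) zr.
by apply: (ub_le_sup (psi_ball_has_sup rho0).2); exists z.
Qed.

Lemma Psistar_le (rho M : R) : 0 <= rho ->
  (forall z, enorm z <= rho -> psi g z <= M) -> Psistar g rho <= M.
Proof.
move=> rho0 H; apply: ge_sup; first exact: (psi_ball_has_sup rho0).1.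
by move=> _ [z /= zr <-]; exact: H.
Qed.

Lemma Psistar_ge0 (rho : R) : 0 <= rho -> 0 <= Psistar g rho.
Proof.
by move=> rho0; apply: le_trans (psi_ge0 g 0) _; apply: psi_le_Psistar; rewrite enorm0.
Qed.

Lemma Psistar_nd (rho sigma : R) : 0 <= rho <= sigma ->
  Psistar g rho <= Psistar g sigma.
Proof.
move=> /andP[rho0 rs]; apply: Psistar_le => // z zr.
by apply: psi_le_Psistar; exact: le_trans rs.
Qed.

Lemma Psistar_le_h (r : R) : 0 < r -> Psistar g r^-1 <= 2 * h g r.
Proof.
move=> r0; apply: Psistar_le; first by rewrite invr_ge0 ltW.
move=> z zr; rewrite -[2]mulr1; apply: psi_le => //.
rewrite -exprMn -[leRHS](expr1n R 2) ler_sqr ?nnegrE ?mulr_ge0 ?enorm_ge0 ?(ltW r0)//.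
by rewrite -ler_pdivlMr// mul1r.
Qed.

Lemma psi_le_scaled (rho t : R) z : 0 <= rho -> 0 <= t -> enorm z <= t * rho ->
  psi g z <= (1 + t) ^+ 2 * Psistar g rho.
Proof.
move=> rho0 t0 zt; have /andP[k1 k2] := Num.Theory.truncn_itv t0.
(* [k] lies in []t, 1 + t]], so [z / k] is in the ball of radius [rho] and [psi_muln] costs a factor
   [k^2]. *)
set k := (Num.truncn t).+1 in k2.
have k0 : 0 < k%:R :> R by rewrite ltr0n.
have -> : z = k%:R *: (k%:R^-1 *: z) by rewrite scalerA divff ?scale1r// gt_eqF.
rewrite (le_trans (psi_muln g k _))//.
apply: ler_pM; rewrite ?sqr_ge0 ?psi_ge0//.
  rewrite ler_sqr ?nnegrE ?addr_ge0// /k -natr1; lra.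
apply: psi_le_Psistar; rewrite enormZ ger0_norm ?invr_ge0 ?(ltW k0)//.
rewrite mulrC ler_pdivrMr// (le_trans zt)// mulrC ler_wpM2l// ltW//.
Qed.

Lemma jump_far_lty (r : R) : 0 < r -> (N (~` eball r) < +oo)%E.
Proof.
move=> r0; have mE : measurable (~` eball r : set 'cV[R]_d).
  by apply: measurableC; exact: measurable_eball.
have /integrableP[_] := integrable_trunc_sqr g r0; apply: le_lt_trans.
rewrite -[X in N X]setIT -(integral_indic N measurableT mE).
apply: ge0_le_integral => //.
- by apply: mEFin; exact: measurable_indic.
- by apply: measurableT_comp => //; apply: mEFin; exact: measurable_trunc_sqr.
- move=> z _; rewrite /= lee_fin ger0_norm ?trunc_sqr_ge0// indicE.
  have [|_] := boolP (z \in _); last exact: trunc_sqr_ge0.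
  rewrite inE /eball/= => /negP; rewrite -leNgt => rz.
  rewrite /trunc_sqr min_l// ler_pdivlMr ?exprn_gt0// mul1r.
  by rewrite ler_sqr ?nnegrE ?enorm_ge0 ?(ltW r0).
Qed.

(** The mass can be infinite only near 0, and 0 itself has mass zero: complements of small balls,
    with the origin added, exhaust the space. *)
Lemma jump_sigma_finite : sigma_finite setT N.
Proof.
exists (fun k => [set 0] `|` ~` eball k.+1%:R^-1).
  apply/esym/seteqP; split => // z _.
  have [z0|z0] := eqVneq (enorm z) 0; first by exists 0%N => //; left; exact: enorm_eq0.
  have zgt0 : 0 < enorm z by rewrite lt_neqAle eq_sym z0 enorm_ge0.
  have [n zn] := archi_bound_lt (enorm z)^-1.
  exists n => //; right; rewrite /eball/=; apply/negP; rewrite -leNgt.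
  rewrite invf_ple ?posrE// ltW// (le_lt_trans _ zn)// ler_norm//.
have m0 : measurable ([set 0] : set 'cV[R]_d).
  have me : measurable_fun setT (@enorm R d) by apply: measurable_enorm; exact: measurable_id.
  rewrite (_ : [set 0] = setT `&` (@enorm R d) @^-1` [set 0]).
    exact: (me measurableT).
  by rewrite setTI; apply/seteqP; split => z /= => [->|/enorm_eq0//]; rewrite enorm0.
move=> k; have mE : measurable (~` eball k.+1%:R^-1 : set 'cV[R]_d).
  by apply: measurableC; exact: measurable_eball.
split; first exact: measurableU.
apply: (@le_lt_trans _ _ (N [set 0%R] + N (~` eball k.+1%:R^-1))%E); first exact: measureU2.
have -> : N [set 0] = 0%E by exact: jump0.
by rewrite add0e; apply: jump_far_lty; rewrite invr_gt0.
Qed.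

(** The jump measure under a new name, to which the sigma-finite structure required by Tonelli's
    theorem can be attached. *)
Definition sf_jump : set 'cV[R]_d -> \bar R := N.

Let sf_jump0 : sf_jump set0 = 0%E. Proof. exact: measure0. Qed.

Let sf_jump_ge0 B : (0 <= sf_jump B)%E. Proof. exact: measure_ge0. Qed.

Let sf_jump_additive : semi_sigma_additive sf_jump.
Proof. exact: measure_semi_sigma_additive. Qed.

HB.instance Definition _ := isMeasure.Build _ _ _ sf_jump
  sf_jump0 sf_jump_ge0 sf_jump_additive.

HB.instance Definition _ := Measure_isSigmaFinite.Build _ _ _ sf_jump jump_sigma_finite.

Lemma integral_sf_jump (D : set 'cV[R]_d) (f : 'cV[R]_d -> \bar R) :
  (\int[sf_jump]_(z in D) f z = \int[N]_(z in D) f z)%E.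
Proof. exact: eq_measure_integral. Qed.

(** The right-hand side is comparable to [min 1 (u^2)]. Averaging [psi] along a line thus recovers
    the truncated second moment of the jumps in that direction, which is how [Psistar] controls
    [h]. *)
Lemma integral_laplace_onemcos (u : R) :
  (\int[mu]_v (laplace_kernel 1 v * (1 - cos (v * u)))%:E =
   (2 * u ^+ 2 / (1 + u ^+ 2))%:E)%E.
Proof.
transitivity (\int[mu]_v (laplace_kernel 1 v * (1 + cos (u * v + pi)))%:E)%E.
  by apply: eq_integral => v _; rewrite cosDpi (mulrC u).
rewrite integral_laplace_1Dcos// cospi /cauchy_kernel; congr EFin.
by field; rewrite ?expr1n gt_eqF// ltr_pwDl ?sqr_ge0.
Qed.

(** Half of the exponential decay is kept and the other half absorbs the square: [expR (|v| / 2)] is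
    at least [(1 + |v| / 4)^2], hence the 16. *)
Lemma laplace_sqr_le (v : R) :
  laplace_kernel 1 v * (1 + `|v|) ^+ 2 <= 16 * laplace_kernel 2^-1 v.
Proof.
have -> : laplace_kernel 1 v = laplace_kernel 2^-1 v * expR (- (2^-1 * `|v|)).
  by rewrite /laplace_kernel -expRD; congr expR; field.
rewrite -mulrA mulrC ler_wpM2r ?laplace_kernel_ge0//.
rewrite expRN mulrC ler_pdivrMr ?expR_gt0//.
have v0 := normr_ge0 v.
have h1 := @expR_ge1Dx R (`|v| / 4).
have -> : expR (2^-1 * `|v|) = expR (`|v| / 4) ^+ 2.
  by rewrite -expRM_natr; congr expR; field.
have : (1 + `|v| / 4) ^+ 2 <= expR (`|v| / 4) ^+ 2.
  by rewrite ler_sqr ?nnegrE ?expR_ge0//; lra.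
move: (expR _) => E; nra.
Qed.

Lemma measurable_psi_line (u : 'cV[R]_d) :
  measurable_fun setT (fun v : R => \int[sf_jump]_z (1 - cos (v * dotp u z))%:E)%E.
Proof.
apply: (measurable_fun_fubini_tonelli_F (fun vz : R * 'cV[R]_d => (1 - cos (vz.1 * dotp u vz.2))%:E)).
  apply: mEFin; apply: measurable_funB => //; apply: (measurableT_comp measurable_cos).
  apply: measurable_funM; first exact: measurable_fst.
  by apply: (measurableT_comp (measurable_dotpr u)); exact: measurable_snd.
by move=> vz; rewrite lee_fin onemcos_ge0.
Qed.

(** 64 is the 16 of [laplace_sqr_le] times the mass 4 of [laplace_kernel 2^-1]; the absorbed factor
    [(1 + |v|)^2] is the growth of [psi] along the line given by [psi_le_scaled]. *)
Lemma jump_quotient_le (u : 'cV[R]_d) (rho : R) : 0 < rho -> enorm u <= rho ->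
  (\int[N]_z (2 * dotp u z ^+ 2 / (1 + dotp u z ^+ 2))%:E
   <= (64 * Psistar g rho)%:E)%E.
Proof.
move=> rho0 urho.
have mk : measurable_fun setT (fun vz : R * 'cV[R]_d =>
    (laplace_kernel 1 vz.1 * (1 - cos (vz.1 * dotp u vz.2)))%:E).
  apply: mEFin; apply: measurable_funM.
    by apply: (measurableT_comp (measurable_laplace_kernel 1)); exact: measurable_fst.
  apply: measurable_funB => //; apply: (measurableT_comp measurable_cos).
  apply: measurable_funM; first exact: measurable_fst.
  by apply: (measurableT_comp (measurable_dotpr u)); exact: measurable_snd.
rewrite -integral_sf_jump.
under eq_integral do rewrite -integral_laplace_onemcos.
rewrite -(@fubini_tonelli _ _ _ _ R mu sf_jump (fun vz : R * 'cV[R]_d =>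
    (laplace_kernel 1 vz.1 * (1 - cos (vz.1 * dotp u vz.2)))%:E))//; last first.
  by move=> vz; rewrite lee_fin mulr_ge0 ?laplace_kernel_ge0 ?onemcos_ge0.
rewrite (_ : (64 * Psistar g rho)%:E =
    \int[mu]_v ((16 * Psistar g rho)%:E * (laplace_kernel 2^-1 v)%:E))%E; last first.
  rewrite ge0_integralZl_EFin//; first by rewrite integral_laplace// -EFinM; congr EFin; field.
  - by move=> v _; rewrite lee_fin laplace_kernel_ge0.
  - exact: (mEFin (measurable_laplace_kernel 2^-1)).
  - by rewrite mulr_ge0 ?Psistar_ge0 ?ltW.
have inner v : (\int[sf_jump]_z (laplace_kernel 1 v * (1 - cos (v * dotp u z)))%:E =
    (laplace_kernel 1 v)%:E * \int[sf_jump]_z (1 - cos (v * dotp u z))%:E)%E.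
  under eq_integral do rewrite EFinM.
  rewrite ge0_integralZl_EFin ?laplace_kernel_ge0//.
  by apply: mEFin; under eq_fun do rewrite -dotpZl; exact: measurable_onemcos.
apply: ge0_le_integral => //.
- by move=> v _; apply: integral_ge0 => z _; rewrite lee_fin mulr_ge0 ?laplace_kernel_ge0 ?onemcos_ge0.
- under eq_fun do rewrite inner.
  apply: emeasurable_funM; last exact: measurable_psi_line.
  exact: (mEFin (measurable_laplace_kernel 1)).
- apply: measurable_funeM; exact: (mEFin (measurable_laplace_kernel 2^-1)).
- move=> v _; rewrite /= inner integral_sf_jump.
  have -> : (\int[N]_z (1 - cos (v * dotp u z))%:E = (\int[N]_z (1 - cos (dotp (v *: u) z)))%:E)%E.
    under eq_integral do rewrite -dotpZl.
    by rewrite Rintegral_EFin//; exact: integrable_onemcos.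
  have psi_v : \int[N]_z (1 - cos (dotp (v *: u) z)) <= (1 + `|v|) ^+ 2 * Psistar g rho.
    rewrite (le_trans _ (psi_le_scaled (ltW rho0) (normr_ge0 v) (z := v *: u) _))//.
      by rewrite psiE lerDr gauss_ge0.
    by rewrite enormZ ler_wpM2l.
  rewrite -!EFinM lee_fin.
  rewrite (le_trans (ler_wpM2l (laplace_kernel_ge0 1 v) psi_v))//.
  rewrite mulrA [leRHS]mulrAC ler_wpM2r ?Psistar_ge0 ?(ltW rho0)//.
  exact: laplace_sqr_le.
Qed.

Lemma trunc_sqr_jump_le (rho : R) : 0 < rho ->
  \int[N]_z trunc_sqr rho^-1 z <= 64 * d%:R * Psistar g rho.
Proof.
move=> rho0; rewrite -lee_fin -Rintegral_EFin//; last first.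
  by apply: integrable_trunc_sqr; rewrite invr_gt0.
pose e i : 'cV[R]_d := rho *: delta_mx i ord0.
have eE i z : dotp (e i) z = rho * z i ord0.
  rewrite /e dotpZl; congr (_ * _); rewrite /dotp (bigD1 i)//= big1 ?addr0 ?mxE ?eqxx ?mul1r//.
  by move=> j ji; rewrite mxE (negbTE ji) mul0r.
have en i : enorm (e i) <= rho.
  rewrite /e enormZ gtr0_norm// -[leRHS]mulr1 ler_wpM2l ?(ltW rho0)//.
  rewrite -ler_sqr ?nnegrE ?enorm_ge0// sqr_enorm expr1n.
  rewrite /dotp (bigD1 i)//= big1 ?addr0 ?mxE ?eqxx ?mul1r//.
  by move=> j ji; rewrite mxE (negbTE ji) mul0r.
pose q i z : R := 2 * dotp (e i) z ^+ 2 / (1 + dotp (e i) z ^+ 2).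
have q0 i z : 0 <= q i z.
  by apply: divr_ge0; [apply: mulr_ge0 => //|apply: addr_ge0 => //]; exact: sqr_ge0.
have mq i : measurable_fun setT (q i).
  apply: measurable_funM; first by apply: measurable_funM => //; apply: measurable_funX; exact: measurable_dotpr.
  apply: (@measurableT_comp _ _ _ _ _ _ (fun x : R => (1 + x ^+ 2)^-1)); last exact: measurable_dotpr.
  apply: continuous_measurable_fun => x; exact: (@continuous_oneDsqrV R x).
apply: (@le_trans _ _ (\int[N]_z (\sum_(i < d) (q i z)%:E))%E).
  apply: ge0_le_integral => //.
  - by move=> z _; rewrite lee_fin trunc_sqr_ge0.
  - by apply: mEFin; exact: measurable_trunc_sqr.
  - by apply: emeasurable_sum => i; exact: mEFin.
  move=> z _; rewrite sumEFin lee_fin.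
  pose S := \sum_(i < d) dotp (e i) z ^+ 2.
  have S0 : 0 <= S by apply: sumr_ge0 => i _; rewrite sqr_ge0.
  have -> : trunc_sqr rho^-1 z = Num.min 1 S.
    rewrite /trunc_sqr exprVn invrK sqr_enorm /dotp mulr_suml; congr Num.min.
    by apply: eq_bigr => i _; rewrite eE exprMn mulrC expr2 (expr2 (z i ord0)).
  (* [min 1 S <= 2 S / (1 + S)]; each denominator is then lowered to that of a single direction. *)
  apply: (@le_trans _ _ (\sum_(i < d) 2 * dotp (e i) z ^+ 2 / (1 + S))).
    rewrite -mulr_suml -mulr_sumr -/S.
    rewrite ler_pdivlMr ?ltr_pwDl//.
    by case: (leP 1 S) => S1; nra.
  apply: ler_sum => i _; rewrite /q; apply: ler_wpM2l.
    by apply: mulr_ge0 => //; exact: sqr_ge0.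
  rewrite lef_pV2 ?posrE ?ltr_pwDl ?sqr_ge0// lerD2l /S (bigD1 i)//= lerDl.
  by apply: sumr_ge0 => j _; rewrite sqr_ge0.
rewrite ge0_integral_sum//; last 2 first.
- by move=> i; exact: mEFin.
- by move=> i z _; rewrite lee_fin.
apply: (@le_trans _ _ (\sum_(i < d) (64 * Psistar g rho)%:E)%E).
  by apply: lee_sum => i _; exact: jump_quotient_le.
rewrite sumEFin lee_fin sumr_const card_ord -[leLHS]mulr_natl; lra.
Qed.

(** Converse of [Psistar_le_h] up to a constant depending on [d] only. For the Gaussian part,
    [psi g (rho *: x)] dominates [rho^2] times the quadratic form at [x], whose supremum over the
    unit ball is the operator norm. *)
Lemma h_le_Psistar (rho : R) : 0 < rho ->
  h g rho^-1 <= (1 + 64 * d%:R) * Psistar g rho.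
Proof.
move=> rho0; rewrite hE mulrDl mul1r lerD ?trunc_sqr_jump_le//.
rewrite exprVn invrK -ler_pdivlMl ?exprn_gt0//.
apply: opnorm_le_quad; [exact: gauss_sym|exact: gauss_ge0|].
move=> x x1; rewrite ler_pdivlMl ?exprn_gt0//.
apply: (@le_trans _ _ (psi g (rho *: x))).
  rewrite psiE -scalemxAr dotpZl dotpZr mulrA -expr2 lerDl.
  by apply: Rintegral_ge0 => z _; exact: onemcos_ge0.
apply: psi_le_Psistar; rewrite enormZ gtr0_norm// -[leRHS]mulr1.
by rewrite ler_wpM2l// ltW.
Qed.

End Psistar_theory.

(** * The bijection h and its inverse *)

Section h_inverse.
Context {R : realType} {d : nat}.
Variable g : levy_triplet R d.
Hypothesis hoo : h g r @[r --> 0^'+] --> +oo.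

Lemma h_unbounded (M : R) : exists2 r, 0 < r & M < h g r.
Proof.
have /cvgryPgt/(_ M) H := hoo.
have : \forall r \near 0^'+, (0 : R) < r /\ M < h g r.
  by near=> r; split; near: r; [exact: nbhs_right_gt|exact: H].
by move=> /filter_ex[r [r0 Mr]]; exists r.
Unshelve. all: by end_near. Qed.

(* If [h r = h s] with [r < s], then [h] is bounded near [0] by the pointwise
   comparison of the truncated squares below. *)
Lemma h_lt r s : 0 < r < s -> h g s < h g r.
Proof.
move=> /andP[r0 rs]; have s0 : 0 < s by exact: lt_trans rs.
rewrite lt_neqAle h_le ?r0 ?(ltW rs)// andbT; apply/eqP => hE'.
have r2 : 0 < r ^+ 2 by rewrite exprn_gt0.
have s2 : 0 < s ^+ 2 by rewrite exprn_gt0.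
have rs2 : r ^+ 2 < s ^+ 2 by rewrite ltr_sqr ?nnegrE ?ltW.
have diff_gt0 : 0 < r ^- 2 - s ^- 2 by rewrite subr_gt0 ltf_pV2.
have [rho rho0 /lt_geF] := h_unbounded (h g s).
suff -> : h g rho <= h g s by [].
have [rrho|rhor] := leP r rho.
  by rewrite hE' h_le ?r0.
have rho2 : 0 < rho ^+ 2 by rewrite exprn_gt0.
(* The quotient makes [C * (r^-2 - s^-2)] at least [rho^-2], for the Gaussian part and the jumps
   with [|z| < r]; [C >= 1] serves the jumps with [r <= |z| < s]. *)
pose C := 1 + rho ^- 2 / (r ^- 2 - s ^- 2).
have C1 : 1 <= C by rewrite lerDl divr_ge0 ?invr_ge0 ?ltW.
have opn0 := opnorm_ge0 (gauss g).
rewrite (@le_trans _ _ (h g s + C * (h g r - h g s)))//; last by rewrite hE' subrr mulr0 addr0.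
rewrite !hE.
set J := fun t => \int[jump g]_z trunc_sqr t z.
suff J_le : J rho - J s <= C * (J r - J s).
  have : rho ^- 2 * opnorm (gauss g) <=
      s ^- 2 * opnorm (gauss g) + C * ((r ^- 2 - s ^- 2) * opnorm (gauss g)).
    rewrite mulrA -mulrDl ler_wpM2r// /C mulrDl mul1r divfK ?gt_eqF//.
    have : 0 < r ^- 2 by rewrite invr_gt0.
    lra.
  move: J_le; rewrite -/(J rho) -/(J s) -/(J r).
  clear; move: (J rho) (J s) (J r) C => a b c K.
  by move: (opnorm _) (rho ^- 2) (s ^- 2) (r ^- 2) => o x y z; lra.
have iT t : 0 < t -> (jump g).-integrable setT (EFin \o trunc_sqr t).
  exact: integrable_trunc_sqr.
rewrite /J -!RintegralB//; try exact: iT.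
have iB := integrableB measurableT (iT _ r0) (iT _ s0).
rewrite -RintegralZl//; apply: le_Rintegral => //.
- exact: (integrableB measurableT (iT _ rho0) (iT _ s0)).
- exact: (integrableZl measurableT C iB).
move=> z _; rewrite /trunc_sqr.
have e0 := sqr_ge0 (enorm z); set e := enorm z ^+ 2 in e0 *.
have C0 : 0 <= C by exact: le_trans C1.
have [se|es] := leP (s ^+ 2) e.
  by rewrite !min_l ?ler_pdivlMr ?mul1r ?subrr ?mulr0// ?(le_trans _ se) ?ltW// ltr_sqr ?nnegrE ?ltW// (lt_trans rhor).
rewrite (@min_r _ _ 1 (e / s ^+ 2)); last by rewrite ler_pdivrMr ?mul1r ?ltW.
have [re|er] := leP (r ^+ 2) e.
  rewrite (@min_l _ _ 1 (e / r ^+ 2)); last by rewrite ler_pdivlMr ?mul1r.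
  rewrite (@le_trans _ _ (1 - e / s ^+ 2))//; first by rewrite lerD2r ge_min lexx.
  by rewrite ler_peMl// subr_ge0 ler_pdivrMr ?mul1r ?ltW.
rewrite (@min_r _ _ 1 (e / r ^+ 2)); last by rewrite ler_pdivrMr ?mul1r ?ltW.
rewrite (@le_trans _ _ (e / rho ^+ 2))//.
  rewrite lerBlDr (@le_trans _ _ (e / rho ^+ 2))//; first by rewrite ge_min lexx orbT.
  by rewrite lerDl divr_ge0 ?(ltW s2).
rewrite -mulrBr mulrCA ler_wpM2l// /C mulrDl mul1r divfK ?gt_eqF//.
by rewrite lerDr ltW.
Qed.

Lemma h_gt0 r : 0 < r -> 0 < h g r.
Proof.
by move=> r0; apply: (le_lt_trans (h_ge0 g (r + 1))); apply: h_lt; rewrite r0 ltrDl ltr01.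
Qed.

(** [h] is nonincreasing while [r^2 * h r] is nondecreasing ([h_scale]), so [h g s] lies between
    [h g r] and [(r / s)^2 * h g r]. *)
Lemma h_dist r s : 0 < r -> 0 < s -> `|h g s - h g r| <= `|(r / s) ^+ 2 - 1| * h g r.
Proof.
move=> r0 s0; have hr := h_ge0 g r.
have [rs|sr] := leP r s.
  have K1 : 1 <= s / r by rewrite ler_pdivlMr ?mul1r.
  have := h_scale g r0 K1; rewrite divfK ?gt_eqF// => h1.
  have h2 : h g s <= h g r by rewrite h_le ?r0.
  rewrite ler0_norm ?subr_le0// ler0_norm; last first.
    by rewrite subr_le0 exprn_ile1 ?divr_ge0 ?(ltW r0) ?(ltW s0)// ler_pdivrMr ?mul1r.
  have : (r / s) ^+ 2 * h g r <= h g s.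
    rewrite -ler_pdivlMl ?exprn_gt0 ?divr_gt0//.
    by rewrite -exprVn invf_div.
  lra.
have K1 : 1 <= r / s by rewrite ler_pdivlMr ?mul1r ?ltW.
have := h_scale g s0 K1; rewrite divfK ?gt_eqF// => h1.
have h2 : h g r <= h g s by rewrite h_le ?s0 ?ltW.
rewrite ger0_norm ?subr_ge0// ger0_norm; first lra.
by rewrite subr_ge0 exprn_ege1.
Qed.

Lemma continuous_h r : 0 < r -> {for r, continuous (h g)}.
Proof.
move=> r0.
have c1 : `|(r / s) ^+ 2 - 1| * h g r @[s --> r] --> (0 : R).
  rewrite -[X in _ --> X](mul0r (h g r)); apply: cvgMr_tmp.
  rewrite -[X in _ --> X](@normr0 _ R) -[X in `|X|](subrr 1).
  apply: cvg_norm; apply: cvgB; last exact: cvg_cst.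
  rewrite -[X in _ --> X](expr1n R 2) -[X in X ^+ 2](divff (lt0r_neq0 r0)).
  apply: (@cvg_comp _ _ _ (fun s => r / s) (fun x => x ^+ 2)); last exact: exprn_continuous.
  by apply: cvgMl_tmp; apply: cvgV; [rewrite gt_eqF|exact: cvg_id].
apply/cvgrPdist_lt => eps eps0.
move/cvgrPdist_lt : c1 => /(_ _ eps0) c1.
near=> s; have s0 : 0 < s by near: s; exact: lt_nbhsr.
rewrite distrC (le_lt_trans (h_dist r0 s0))//.
have : `|0 - `|(r / s) ^+ 2 - 1| * h g r| < eps by near: s.
by rewrite sub0r normrN ger0_norm// mulr_ge0 ?h_ge0.
Unshelve. all: by end_near. Qed.

Lemma h_vanishes (y : R) : 0 < y -> exists2 r, 0 < r & h g r < y.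
Proof.
move=> y0.
have i1 := integrable_trunc_sqr g ltr01.
have c1 : \int[jump g]_z trunc_sqr n.+1%:R z @[n --> \oo] --> \int[jump g]_z (cst (0 : R) z).
  apply: (@Rdominated_cvg R _ _ _ _ _ _ (trunc_sqr 1)) => //.
  - by move=> n; exact: measurable_trunc_sqr.
  - move=> z _; apply: (@squeeze_cvgr _ _ _ _ (cst 0) (fun n => enorm z ^+ 2 / n.+1%:R)).
    + apply: nearW => n; rewrite trunc_sqr_ge0/= /trunc_sqr ge_min; apply/orP; right.
      rewrite ler_wpM2l ?sqr_ge0// lef_pV2 ?posrE ?exprn_gt0// expr2 ler_peMl// ler1n//.
    + exact: cvg_cst.
    + rewrite -[X in _ --> X](mulr0 (enorm z ^+ 2)); apply: cvgMl_tmp.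
      exact: cvg_harmonic.
  - move=> n z _; rewrite ger0_norm ?trunc_sqr_ge0//; apply: trunc_sqr_le.
    by rewrite ltr01 ler1n.
have c2 : h g n.+1%:R @[n --> \oo] --> (0 : R).
  under eq_fun do rewrite hE.
  have -> : (0 : R) = 0 * opnorm (gauss g) + \int[jump g]_z (cst (0 : R) z).
    by rewrite mul0r add0r /Rintegral integral0_eq.
  apply: cvgD => //; apply: cvgMr_tmp.
  have c3 : (n.+1%:R^-1 : R) ^+ 2 @[n --> \oo] --> (0 : R) ^+ 2.
    apply: (@cvg_comp _ _ _ (fun n => n.+1%:R^-1) (fun x : R => x ^+ 2)); last exact: exprn_continuous.
    exact: cvg_harmonic.
  rewrite expr0n in c3; move: c3.
  by under eq_fun do rewrite exprVn.
move/cvgr0Pnorm_lt : c2 => /(_ _ y0) [m _ /(_ m (leqnn m))] /= hm.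
exists m.+1%:R; first exact: ltr0Sn.
by rewrite (le_lt_trans (ler_norm _)).
Qed.

Lemma h_surj (y : R) : 0 < y -> exists2 r, 0 < r & h g r = y.
Proof.
move=> y0; have [a a0 ya] := h_unbounded y; have [b b0 by'] := h_vanishes y0.
have ab : a < b.
  rewrite ltNge; apply/negP => ba; have := h_le g (_ : 0 < b <= a).
  by rewrite b0 ba => /(_ isT); rewrite leNgt (lt_trans by' ya).
have [||c cab hc] := @IVT R (h g) a b y (ltW ab).
- apply: continuous_in_subspaceT => x; rewrite inE/= in_itv/= => /andP[ax _].
  by apply: continuous_h; exact: lt_le_trans ax.
- by rewrite ge_min le_max (ltW by') (ltW ya) orbT.
- by exists c => //; move: cab; rewrite in_itv/= => /andP[ac _]; exact: lt_le_trans ac.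
Qed.

Let surj : set_surj `]0, +oo[ `]0, +oo[ (h g).
Proof.
move=> y /=; rewrite in_itv/= andbT => y0; have [r r0 <-] := h_surj y0.
by exists r => //=; rewrite in_itv/= r0.
Qed.

Lemma hinvK y : 0 < y -> h g (hinv g y) = y.
Proof. by move=> y0; rewrite /hinv (surjpK _ surj)// inE/= in_itv/= y0. Qed.

Lemma hinv_gt0 y : 0 < y -> 0 < hinv g y.
Proof.
move=> y0; suff : `]0, +oo[%classic (hinv g y) by rewrite /= in_itv/= andbT.
apply: (surjpinv_image_sub surj); exists y => //.
by rewrite /= in_itv/= y0.
Qed.

Lemma h_lt_iff r s : 0 < r -> 0 < s -> (h g s < h g r) = (r < s).
Proof.
move=> r0 s0; apply/idP/idP => [hh|rs]; last by apply: h_lt; rewrite r0.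
by rewrite ltNge; apply/negP => sr; move: hh; rewrite ltNge h_le// s0.
Qed.

Lemma hK r : 0 < r -> hinv g (h g r) = r.
Proof.
move=> r0; have h0 := h_gt0 r0; have i0 := hinv_gt0 h0; have E := hinvK h0.
have [rs|sr|//] := ltgtP (hinv g (h g r)) r.
  by have := h_lt (_ : 0 < hinv g (h g r) < r); rewrite i0 rs E ltxx => /(_ isT).
by have := h_lt (_ : 0 < r < hinv g (h g r)); rewrite r0 sr E ltxx => /(_ isT).
Qed.

End h_inverse.

(** * Marginal laws of the process *)

Section levy_law.
Context {R : realType} {d : nat} {disp : measure_display}
  {Omega : measurableType disp}.
Variables (P : probability Omega R) (Y : R -> Omega -> 'cV[R]_d).
Variable g : levy_triplet R d.
Hypothesis YP : levy_process_with P Y g.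
Local Notation lam := (lebesgue_cV d).

Lemma measurable_levy t : 0 <= t -> measurable_fun setT (Y t).
Proof. by move=> t0; have [[+ _ _ _ _ _] _] := YP; apply. Qed.

Let Re_exponent t z : complex.Re (- t%:C%C * Psi g z)%C = - (t * psi g z).
Proof. by rewrite /psi; case: (Psi g z) => a b /=; rewrite oppr0 mul0r subr0 mulNr. Qed.

Let Im_exponent t z : complex.Im (- t%:C%C * Psi g z)%C = - (t * phase g z).
Proof. by rewrite /phase; case: (Psi g z) => a b /=; rewrite oppr0 mul0r addr0 mulNr. Qed.

(** A single real identity with a free shift contains both components of the complex one; it
    provides the hypothesis [XE] of the Fourier sections, with exponent [t * psi g] and phase
    [t * phase g]. *)
Lemma levy_polar t z a : 0 <= t ->
  \int[P]_w cos (dotp z (Y t w) + a) =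
  expR (- (t * psi g z)) * cos (a - t * phase g z).
Proof.
move=> t0; have [_ /(_ t z t0)] := YP; have mY := measurable_levy t0.
rewrite /cintegral /cexp Re_exponent Im_exponent => -[/= Ecos Esin].
have {}Ecos : \int[P]_w cos (dotp z (Y t w)) =
    expR (- (t * psi g z)) * cos (t * phase g z).
  rewrite -[in RHS]cosN -Ecos; apply: eq_Rintegral => w _.
  by rewrite !mul0r mulr0 !mul1r subrr expR0 mul1r ?add0r ?addr0.
have {}Esin : \int[P]_w sin (dotp z (Y t w)) =
    - (expR (- (t * psi g z)) * sin (t * phase g z)).
  rewrite -mulrN -sinN -Esin; apply: eq_Rintegral => w _.
  by rewrite !mul0r mulr0 !mul1r subrr expR0 mul1r ?add0r ?addr0.
have mdot : measurable_fun setT (fun w => dotp z (Y t w)).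
  by apply: measurable_dotp.
have ic : P.-integrable setT (EFin \o (fun w => cos (dotp z (Y t w)))).
  apply: (@prob_bounded_integrable _ _ _ _ _ 1) => [|w]; last exact: cos_max.
  exact: (measurableT_comp measurable_cos).
have iS : P.-integrable setT (EFin \o (fun w => sin (dotp z (Y t w)))).
  apply: (@prob_bounded_integrable _ _ _ _ _ 1) => [|w]; last exact: sin_max.
  exact: (measurableT_comp measurable_sin).
under eq_Rintegral do rewrite cosD.
rewrite RintegralB//; last 2 first.
- by have := integrableZr measurableT (cos a) ic.
- by have := integrableZr measurableT (sin a) iS.
by rewrite !RintegralZr// Ecos Esin cosB; ring.
Qed.

Lemma measurable_psi : measurable_fun setT (psi g).
Proof.
have := measurable_polar_exponent (measurable_levy ler01)
  (fun z a => levy_polar z a ler01).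
by under eq_fun do rewrite mul1r.
Qed.

(** The imaginary part of the complex integral is minus the inversion integral with shift [pi / 2],
    which vanishes. *)
Lemma fourier_inversionE t x : 0 < t ->
  lam.-integrable setT (EFin \o (fun z => expR (- (t * psi g z)))) ->
  fourier_inversion g t x =
  (inversion_density (fun z => t * psi g z) (fun z => t * phase g z) x)%:C%C.
Proof.
move=> t0 it; have mY := measurable_levy (ltW t0).
have XE z a := levy_polar z a (ltW t0).
have S0 := inversion_integral_sin mY XE it x.
rewrite /fourier_inversion /cintegral /inversion_density.
have integrandE z : cexp (- 'i%C * (dotp x z)%:C%C) * cexp (- t%:C%C * Psi g z) =
   Complex (expR (- (t * psi g z)) * cos (0 - dotp z x - t * phase g z))
           (- (expR (- (t * psi g z)) * cos (pi / 2 - dotp z x - t * phase g z))).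
  rewrite {2}/cexp Re_exponent Im_exponent /cexp.
  apply/eqP; rewrite eq_complex /=.
  rewrite !(mul0r, mulr0, mul1r, mulr1, oppr0, subr0, sub0r, add0r, addr0, expR0, mulN1r).
  rewrite (dotpC z x); set u := dotp x z; set v := t * phase g z.
  have -> : pi / 2 - u - v = - ((u + v) - pi / 2) by ring.
  have -> : - u - v = - (u + v) by ring.
  rewrite !cosN cosBpihalf cosD sinD !sinN.
  by apply/andP; split; apply/eqP; ring.
under eq_Rintegral do rewrite integrandE /=.
under [X in Complex _ X]eq_Rintegral do rewrite integrandE /=.
rewrite -/(inversion_integral (fun z => t * psi g z) (fun z => t * phase g z) 0 x).
have -> : \int[lam]_z (- (expR (- (t * psi g z)) * cos (pi / 2 - dotp z x - t * phase g z))) = 0.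
  transitivity (\int[lam]_z ((-1) * (expR (- (t * psi g z)) * cos (pi / 2 - dotp z x - t * phase g z)))).
    by apply: eq_Rintegral => z _; rewrite mulN1r.
  rewrite RintegralZl//; last exact: (integrable_inversion_integrand mY XE it).
  by rewrite -/(inversion_integral _ _ _ x) S0 mulr0.
by apply/eqP; rewrite eq_complex /= !(mul0r, mulr0, subr0, addr0) !eqxx.
Qed.

Lemma transition_density_inversion :
  (forall t, 0 < t -> lam.-integrable setT (EFin \o (fun z => expR (- (t * psi g z))))) ->
  transition_density P Y g (fun t =>
    inversion_density (fun z => t * psi g z) (fun z => t * phase g z)).
Proof.
move=> it t t0; have mY := measurable_levy (ltW t0).
have XE z a := levy_polar z a (ltW t0).
split.
- exact: (measurable_inversion_density mY XE (it _ t0)).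
- exact: (inversion_density_ge0 mY XE (it _ t0)).
- by move=> B mB; exact: (inversion_density_law mY XE (it _ t0)).
- by move=> _ x; rewrite fourier_inversionE//; exact: it.
Qed.

Lemma measurable_increment s t : 0 <= s -> 0 <= t ->
  measurable_fun setT (fun w => Y t w - Y s w).
Proof.
move=> s0 t0; apply: measurable_fun_cVP => i; under eq_fun do rewrite !mxE.
apply: measurable_funB; apply: (measurableT_comp (measurable_coord i));
  exact: measurable_levy.
Qed.

Lemma measurable_increment_in s t (B : set 'cV[R]_d) : 0 <= s -> 0 <= t ->
  measurable B -> measurable (increment_in Y s t B).
Proof.
move=> s0 t0 mB; rewrite -[X in measurable X]setTI.
exact: (measurable_increment s0 t0).
Qed.

(** [Y 0] vanishes only almost surely, so the increment from 0 and [Y t] are compared through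
    indicators that agree almost everywhere. *)
Lemma increment_prob s t (B : set 'cV[R]_d) : 0 <= s -> 0 <= t -> measurable B ->
  P (increment_in Y s (s + t) B) = P (Y t @^-1` B).
Proof.
move=> s0 t0 mB; have [[_ start _ stat _ _] _] := YP.
rewrite stat//; have mi := measurable_increment_in (lexx 0) t0 mB.
have mY : measurable (Y t @^-1` B).
  by rewrite -[X in measurable X]setTI; exact: measurable_levy.
transitivity (\int[P]_w (\1_(increment_in Y 0 t B) w)%:E)%E.
  by rewrite integral_indic// setIT.
transitivity (\int[P]_w (\1_(Y t @^-1` B) w)%:E)%E; last by rewrite integral_indic// setIT.
apply: ae_eq_integral => //.
- by apply: mEFin; exact: measurable_indic.
- by apply: mEFin; exact: measurable_indic.
- apply: filterS start => w Y0 _; congr EFin; rewrite !indicE.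
  have E : increment_in Y 0 t B w = (Y t @^-1` B) w.
    by rewrite /increment_in /preimage /= Y0 subr0.
  by congr (nat_of_bool _)%:R; apply/idP/idP; rewrite !inE E.
Qed.

Lemma increments_prob (n : nat) s (B : set 'cV[R]_d) : 0 <= s -> measurable B ->
  ((fine (P (Y s @^-1` B)) ^+ n)%:E <=
   P (\bigcap_(i < n) increment_in Y (i%:R * s) (i.+1%:R * s) B))%E.
Proof.
move=> s0 mB; have [[_ _ indep _ _ _] _] := YP.
rewrite (indep n (fun i => i%:R * s) (fun=> B))//; first last.
- by move=> i; rewrite ler_wpM2r// ler_nat.
- by rewrite mul0r.
have mYB : measurable (Y s @^-1` B).
  by rewrite -[X in measurable X]setTI; exact: measurable_levy.
rewrite (eq_bigr (fun=> (fine (P (Y s @^-1` B)))%:E)).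
  by rewrite prodEFin prodr_const card_ord.
move=> i _; rewrite fineK ?fin_num_measure//.
by rewrite -natr1 mulrDl mul1r increment_prob// mulr_ge0.
Qed.

(** If each of [n] successive increments lies in the cube about [c], their sum lies in the [n]-fold
    cube about [n c]; independence and stationarity give the [n]-th power. *)
Lemma levy_cube_prob (n : nat) s (c : 'cV[R]_d) (r : R) : 0 <= s ->
  ((fine (P (Y s @^-1` cube c r)) ^+ n)%:E <=
   P (Y (n%:R * s) @^-1` cube (n%:R *: c) (n%:R * r)))%E.
Proof.
move=> s0; set B := cube _ _; set C := cube _ _.
have mB : measurable B := measurable_cube c r.
have mC : measurable C := measurable_cube (n%:R *: c) (n%:R * r).
apply: (le_trans (increments_prob n s0 mB)).
have ns0 : 0 <= n%:R * s by rewrite mulr_ge0.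
have <- : P (increment_in Y 0 (0 + n%:R * s) C) = P (Y (n%:R * s) @^-1` C).
  exact: increment_prob.
apply: le_measure.
- apply: mem_set; apply: fin_bigcap_measurable; first exact: finite_II.
  by move=> i _; apply: measurable_increment_in => //; rewrite mulr_ge0.
- by apply: mem_set; apply: measurable_increment_in => //; rewrite add0r.
move=> w Hw; rewrite add0r /increment_in /=; apply/cubeP => i; rewrite !mxE.
suff H k : (k <= n)%N ->
    `|Y (k%:R * s) w i ord0 - Y 0 w i ord0 - k%:R * c i ord0| <= k%:R * r by exact: H.
elim: k => [_|k IH kn]; first by rewrite !mul0r subrr subr0 normr0.
have := Hw k kn => /cubeP/(_ i); rewrite !mxE => h3.
have E (u : R) : k.+1%:R * u = k%:R * u + u by rewrite -natr1 mulrDl mul1r.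
rewrite (E (c i ord0)) (E r); apply: le_trans (lerD (IH (ltnW kn)) h3).
by apply: le_trans (ler_normD _ _); rewrite le_eqVlt; apply/orP; left; apply/eqP;
  congr `|_|; ring.
Qed.

End levy_law.

(** * Concentration of the law around its drift *)

Section concentration.
Context {R : realType} {d : nat}.
Local Notation lam := (lebesgue_cV d).

Lemma laplace_kernel_scale (r v : R) : 0 < r ->
  laplace_kernel r v = laplace_kernel 1 (r * v).
Proof. by move=> r0; rewrite /laplace_kernel mul1r normrM gtr0_norm. Qed.

Lemma prodr_1D_ge (I : Type) (s : seq I) (a : I -> R) : (forall i, 0 <= a i) ->
  1 + \sum_(i <- s) a i <= \prod_(i <- s) (1 + a i).
Proof.
move=> a0; elim: s => [|i s IH]; first by rewrite !big_nil addr0.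
rewrite !big_cons.
have := ler_wpM2l (addr_ge0 ler01 (a0 i)) IH.
have s0 : 0 <= \sum_(j <- s) a j by apply: sumr_ge0.
by have := a0 i; nra.
Qed.

(** The product of the [1 + (r z_i)^2] dominates [1 + r^2 |z|^2] and factors over the coordinates,
    where [laplace_sqr_le] applies. *)
Lemma laplace_cV_sqr_le (r : R) (z : 'cV[R]_d) : 0 < r ->
  laplace_cV r z * (1 + r ^+ 2 * enorm z ^+ 2) <= 16 ^+ d * laplace_cV (r / 2) z.
Proof.
move=> r0.
have h1 : 1 + r ^+ 2 * enorm z ^+ 2 <= \prod_(i < d) (1 + (r * z i ord0) ^+ 2).
  rewrite sqr_enorm /dotp mulr_sumr.
  rewrite (le_trans _ (prodr_1D_ge _ _))//; last by move=> i; exact: sqr_ge0.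
  by rewrite lerD2l; apply: ler_sum => i _; rewrite exprMn expr2 (expr2 (z i ord0)).
rewrite (le_trans (ler_wpM2l (laplace_cV_ge0 r z) h1))// /laplace_cV -big_split/=.
rewrite -[X in _ ^+ X](card_ord d) -prodr_const -big_split/=.
apply: ler_prod => i _; rewrite mulr_ge0 ?laplace_kernel_ge0 ?addr_ge0 ?sqr_ge0//=.
have -> : laplace_kernel (r / 2) (z i ord0) = laplace_kernel 2^-1 (r * z i ord0).
  by rewrite /laplace_kernel normrM gtr0_norm//; congr expR; ring.
rewrite laplace_kernel_scale// (le_trans _ (laplace_sqr_le _))//.
rewrite ler_wpM2l ?laplace_kernel_ge0// -[X in 1 + X]real_normK ?num_real//.
by have := normr_ge0 (r * z i ord0); nra.
Qed.

Context {disp : measure_display} {Omega : measurableType disp}.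
Variables (P : probability Omega R).

Section polar.
Variables (X : Omega -> 'cV[R]_d) (mX : measurable_fun setT X).
Variables psi m : 'cV[R]_d -> R.
Hypothesis XE : forall z a,
  \int[P]_w cos (dotp z (X w) + a) = expR (- psi z) * cos (a - m z).

(** The mean of the Cauchy kernel of scale [r] about [b] is close to its maximum [(2 / r)^d] when
    the recentred characteristic function is close to 1, whereas off the cube the kernel is at most
    half of that maximum. *)
Lemma polar_concentration (b : 'cV[R]_d) (r D : R) : 0 < r -> 0 <= D ->
  (forall z, 1 - expR (- psi z) * cos (0 - dotp z b - m z) <=
     D * (1 + r ^+ 2 * enorm z ^+ 2)) ->
  1 - 2 * D * 32 ^+ d <= fine (P (X @^-1` cube b r)).
Proof.
move=> r0 D0 H; set B := cube b r.
have mB : measurable B := measurable_cube b r.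
have mXB : measurable (X @^-1` B).
  by rewrite -[X in measurable X]setTI; exact: mX.
have c0 : 0 < (2 / r) ^+ d by rewrite exprn_gt0 ?divr_gt0.
have E := smoothed_inversion mX XE 0 b r0.
rewrite cos0 mul1r in E.
have ismooth : lam.-integrable setT (EFin \o (fun z =>
    laplace_cV r z * (expR (- psi z) * cos (0 - dotp z b - m z)))).
  apply: (le_integrable measurableT _ _ (integrable_laplace_cV d r0)).
    apply: mEFin; apply: measurable_funM; first exact: measurable_laplace_cV.
    exact: (measurable_inversion_integrand mX XE).
  move=> z _; rewrite /= lee_fin normrM [leRHS]ger0_norm ?laplace_cV_ge0//.
  rewrite ger0_norm ?laplace_cV_ge0// ler_piMr ?laplace_cV_ge0//.
  rewrite (le_trans (norm_inversion_integrand _ _ _ _ _))// expR_le1 oppr_le0.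
  exact: (polar_exponent_ge0 mX XE).
(* [64 = 16 * 4]: the 16 of [laplace_cV_sqr_le], and the integral [(4 / r)^d] of
   [laplace_cV (r / 2)]. *)
have up : (2 / r) ^+ d - \int[P]_w cauchy_cV r (X w - b) <= D * (64 / r) ^+ d.
  have -> : (2 / r) ^+ d = \int[lam]_z laplace_cV r z.
    by rewrite /Rintegral integral_laplace_cV.
  rewrite -E -RintegralB//; last exact: integrable_laplace_cV.
  have -> : D * (64 / r) ^+ d = \int[lam]_z (D * 16 ^+ d * laplace_cV (r / 2) z).
    rewrite RintegralZl//; last by apply: integrable_laplace_cV; rewrite divr_gt0.
    rewrite {1}/Rintegral integral_laplace_cV ?divr_gt0//= -mulrA -exprMn.
    by congr (_ * _ ^+ _); field; rewrite gt_eqF.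
  apply: le_Rintegral => //.
  - exact: (integrableB measurableT (integrable_laplace_cV d r0) ismooth).
  - have := integrableZl measurableT (D * 16 ^+ d) (@integrable_laplace_cV R d (r / 2) _).
    by apply; rewrite divr_gt0.
  - move=> z _; set E0 := expR _ * _.
    have -> : laplace_cV r z - laplace_cV r z * E0 = laplace_cV r z * (1 - E0) by ring.
    rewrite (le_trans (ler_wpM2l (laplace_cV_ge0 r z) (H z)))//.
    by rewrite mulrCA -[leRHS]mulrA ler_wpM2l// laplace_cV_sqr_le.
have mI : measurable_fun setT (fun w => \1_(X @^-1` B) w : R) by exact: measurable_indic.
have iI : P.-integrable setT (EFin \o (fun w => \1_(X @^-1` B) w : R)).
  by apply: (@prob_bounded_integrable _ _ _ _ _ 1) => // w; rewrite ger0_norm.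
have low : \int[P]_w cauchy_cV r (X w - b) <=
    (2 / r) ^+ d / 2 * (1 + fine (P (X @^-1` B))).
  have -> : fine (P (X @^-1` B)) = \int[P]_w \1_(X @^-1` B) w.
    by rewrite /Rintegral integral_indic// setIT.
  have -> : 1 + \int[P]_w \1_(X @^-1` B) w = \int[P]_w (1 + \1_(X @^-1` B) w) :> R.
    rewrite RintegralD//; last exact: finite_measure_integrable_cst.
    by rewrite Rintegral_prob_cst.
  have i2 := integrableD measurableT (finite_measure_integrable_cst P 1 measurableT) iI.
  rewrite -RintegralZl//.
  apply: le_Rintegral => //.
  - apply: (@prob_bounded_integrable _ _ _ _ _ ((2 / r) ^+ d)).
      exact: measurable_cauchy_law.
    by move=> w; rewrite ger0_norm ?cauchy_cV_le ?cauchy_cV_ge0 ?ltW.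
  - by have := integrableZl measurableT ((2 / r) ^+ d / 2) i2.
  move=> w _; rewrite indicE/=.
  have [|] := boolP (w \in _); first by move=> _; rewrite -mulrA mulVf// mulr1 cauchy_cV_le.
  rewrite notin_setE => nXB.
  have [i out] : exists i, r < `|X w i ord0 - b i ord0|.
    apply: contrapT => h; apply: nXB; apply/cubeP => i.
    by rewrite leNgt; apply/negP => ri; apply: h; exists i.
  rewrite addr0 mulr1 /cauchy_cV (bigD1 i)//=.
  (* A coordinate off by more than [r] has its factor bounded by [1 / r] instead of [2 / r]. *)
  have -> : (2 / r) ^+ d / 2 = r^-1 * \prod_(j < d | j != i) (2 / r).
    rewrite -[X in _ ^+ X](card_ord d) -prodr_const (bigD1 i)//=.
    by field; rewrite gt_eqF.
  apply: ler_pM.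
  - by rewrite cauchy_kernel_ge0// ltW.
  - by apply: prodr_ge0 => j _; rewrite cauchy_kernel_ge0// ltW.
  - have : r ^+ 2 <= (X w - b) i ord0 ^+ 2.
      by rewrite !mxE -[leRHS]real_normK ?num_real// ler_sqr ?nnegrE ?(ltW r0)// ltW.
    rewrite /cauchy_kernel; move: ((X w - b) i ord0 ^+ 2) => u2 hu.
    have r2 : 0 < r ^+ 2 by rewrite exprn_gt0.
    rewrite ler_pdivrMr; last by lra.
    by rewrite [leRHS]mulrC ler_pdivlMr// -mulrA -expr2 mulrDl !mul1r lerD2l.
  - by apply: ler_prod => j _; rewrite cauchy_kernel_ge0 ?cauchy_kernel_le// ltW.
have : (2 / r) ^+ d * ((1 - fine (P (X @^-1` B))) / 2) <= D * (64 / r) ^+ d.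
  by apply: le_trans up; move: low; lra.
have -> : (64 / r) ^+ d = (2 / r) ^+ d * 32 ^+ d.
  by rewrite -exprMn; congr (_ ^+ _); field; rewrite gt_eqF.
rewrite [leRHS]mulrCA ler_pM2l//; lra.
Qed.

End polar.

(** Chosen so that [D = 3 / n] in [polar_concentration] gives [2 * D * 32^d = 1 / 2]. *)
Definition concentration_steps : nat := (12 * 32 ^ d)%N.

Lemma concentration_steps_gt0 : (0 < concentration_steps)%N.
Proof. by rewrite muln_gt0 expn_gt0. Qed.

(** At time [t / n] the exponent and the recentred phase contribute at most [3 K / n], with
    [K = 1 + r^2 |z|^2], because [h g r = t^-1]; each increment then stays in its cube with
    probability at least 1/2. *)
Lemma levy_concentration (Y : R -> Omega -> 'cV[R]_d) (g : levy_triplet R d) t r :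
  levy_process_with P Y g -> 0 < t -> 0 < r -> h g r = t^-1 ->
  ((2 ^- concentration_steps)%:E <= P (Y t @^-1`
    cube (t *: drift_r g r) (concentration_steps%:R * r)))%E.
Proof.
move=> YP t0 r0 hr; set n := concentration_steps.
have n0 : 0 < n%:R :> R by rewrite ltr0n concentration_steps_gt0.
pose s := t / n%:R; have s0 : 0 < s by rewrite divr_gt0.
have mY := measurable_levy YP (ltW s0).
have XE z a := levy_polar YP z a (ltW s0).
have := @polar_concentration (Y s) mY _ _ XE (s *: drift_r g r) r (3 / n%:R) r0.
rewrite divr_ge0 ?(ltW n0)// => /(_ isT) H.
have {}H : 2^-1 <= fine (P (Y s @^-1` cube (s *: drift_r g r) r)).
  apply: le_trans (H _).
    rewrite /n /concentration_steps natrM natrX.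
    have : 0 < 32 ^+ d :> R by rewrite exprn_gt0.
    by move: (32 ^+ d) => u u0; rewrite le_eqVlt; apply/orP; left; apply/eqP; field; rewrite gt_eqF.
  move=> z; rewrite sub0r -opprD cosN.
  apply: (le_trans (onem_expRcos _ _)); first by rewrite mulr_ge0 ?psi_ge0 ?ltW.
  pose K := 1 + r ^+ 2 * enorm z ^+ 2.
  have K1 : 1 <= K by rewrite lerDl mulr_ge0 ?sqr_ge0.
  have zK : enorm z ^+ 2 * r ^+ 2 <= K by rewrite mulrC lerDr.
  have h1 := psi_le g r0 K1 zK; have h2 := phase_drift_le g r0 K1 zK.
  have -> : dotp z (s *: drift_r g r) + s * phase g z =
      s * (phase g z + dotp z (drift_r g r)) by rewrite dotpZr; ring.
  rewrite normrM (gtr0_norm s0) -mulrDr -/K.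
  rewrite (@le_trans _ _ (s * (3 * K * h g r)))//.
    by rewrite ler_wpM2l ?(ltW s0)//; lra.
  by rewrite hr /s; rewrite le_eqVlt; apply/orP; left; apply/eqP; field; rewrite !gt_eqF.
have := levy_cube_prob YP n (s *: drift_r g r) r (ltW s0).
have nst : n%:R * s = t by rewrite /s; field; rewrite gt_eqF.
rewrite scalerA nst.
apply: le_trans; rewrite lee_fin -exprVn; apply: lerXn2r => //; rewrite nnegrE//.
exact: le_trans H.
Qed.

End concentration.

Arguments concentration_steps d : clear implicits.

Section moment_integrand.
Context {R : realType} {d : nat} (f : 'cV[R]_d -> R).
Hypothesis mf : measurable_fun setT f.

Lemma measurable_expRN_scaled t :
  measurable_fun setT (fun z => expR (- (t * f z))).
Proof. by do 2! apply: measurableT_comp => //; exact: measurable_funM. Qed.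

Lemma measurable_moment t r :
  measurable_fun setT (fun z => expR (- (t * f z)) * (1 + r * enorm z)).
Proof.
apply: measurable_funM; first exact: measurable_expRN_scaled.
apply: measurable_funD => //; apply: measurable_funM => //.
exact: (measurable_enorm (@measurable_id _ _ setT)).
Qed.

Lemma moment_ge0 t r z : 0 <= r -> 0 <= expR (- (t * f z)) * (1 + r * enorm z).
Proof.
by move=> r0; apply: mulr_ge0; rewrite ?expR_ge0// addr_ge0// mulr_ge0// enorm_ge0.
Qed.

End moment_integrand.

(** * Peak of the density and its persistence on a ball *)

Section density_spread.
Context {R : realType} {d : nat}.
Local Notation lam := (lebesgue_cV d).

Lemma cos_lip (a b : R) : `|cos a - cos b| <= `|a - b|.
Proof.
have -> : cos a - cos b =
    cos ((a + b) / 2 + (a - b) / 2) - cos ((a + b) / 2 - (a - b) / 2).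
  by congr (cos _ - cos _); field.
rewrite cosD cosB.
set s := sin _; set s' := sin ((a - b) / 2).
have -> : cos ((a + b) / 2) * cos ((a - b) / 2) - s * s' -
    (cos ((a + b) / 2) * cos ((a - b) / 2) + s * s') = - (2 * s * s') by ring.
rewrite normrN !normrM ger0_norm//.
have h1 : `|s| <= 1 by rewrite ler_norml sin_geN1 sin_le1.
have h2 : `|s'| <= `|a - b| / 2.
  by rewrite (le_trans (norm_sin_le _))// normrM (ger0_norm (_ : 0 <= 2^-1)).
by have := normr_ge0 s; have := normr_ge0 s'; nra.
Qed.

(** Half of the mean density that [levy_concentration] forces on the cube of side [2 n r], up to the
    factor [r^-d]; the half makes the contradiction in [density_peak] strict. *)
Definition peak_const : R :=
  2 ^- (concentration_steps d) / (2 * (2 * (concentration_steps d)%:R) ^+ d).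

(** The summands ensure in turn that [c >= 1], that the peak is within [c r] of the drift, and that
    the Lipschitz bound loses at most half of the peak on the ball of radius [r / c]. *)
Definition spread_const (C : R) : R :=
  1 + d%:R * (concentration_steps d)%:R + 2 * ((2 * pi) ^- d * C) / peak_const.

Lemma peak_const_gt0 : 0 < peak_const.
Proof.
rewrite divr_gt0 ?invr_gt0 ?exprn_gt0// mulr_gt0// exprn_gt0// mulr_gt0//.
by rewrite ltr0n concentration_steps_gt0.
Qed.

Lemma spread_const_ge1 C : 0 <= C -> 1 <= spread_const C.
Proof.
move=> C0; rewrite /spread_const -addrA lerDl addr_ge0 ?mulr_ge0//.
- by rewrite invr_ge0 exprn_ge0// mulr_ge0// pi_ge0.
- by rewrite invr_ge0 ltW// peak_const_gt0.
Qed.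

Context {disp : measure_display} {Omega : measurableType disp}.
Variables (P : probability Omega R) (Y : R -> Omega -> 'cV[R]_d).
Variables (g : levy_triplet R d) (t r C : R).
Hypotheses (YP : levy_process_with P Y g) (t0 : 0 < t) (r0 : 0 < r).
Hypotheses (hr : h g r = t^-1) (C0 : 0 <= C).
Hypothesis moment : (\int[lam]_z
  (expR (- (t * psi g z)) * (1 + r * enorm z))%:E <= (C * r ^- d)%:E)%E.

Let E z := expR (- (t * psi g z)).
Let p := inversion_density (fun z => t * psi g z) (fun z => t * phase g z).
Let mY := measurable_levy YP (ltW t0).
Let XE z a := levy_polar YP z a (ltW t0).

Let mpsi : measurable_fun setT (psi g).
Proof. exact: (measurable_psi YP). Qed.

Let moment_int :
  lam.-integrable setT (EFin \o (fun z => E z * (1 + r * enorm z))).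
Proof.
apply/integrableP; split; first by apply: mEFin; exact: measurable_moment.
apply: le_lt_trans (ltry (C * r ^- d)); apply: le_trans moment.
rewrite le_eqVlt; apply/orP; left; apply/eqP; apply: eq_integral => z _.
by rewrite /= ger0_norm// moment_ge0// ltW.
Qed.

Let momentR : \int[lam]_z (E z * (1 + r * enorm z)) <= C * r ^- d.
Proof. by rewrite -lee_fin -Rintegral_EFin. Qed.

Let E_int : lam.-integrable setT (EFin \o E).
Proof.
apply: (le_integrable measurableT _ _ moment_int).
  by apply: mEFin; exact: measurable_expRN_scaled.
move=> z _; rewrite /= lee_fin normrM ler_peMr//.
rewrite ger0_norm ?addr_ge0 ?mulr_ge0 ?enorm_ge0 ?(ltW r0)//.
by rewrite lerDl mulr_ge0 ?enorm_ge0 ?(ltW r0).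
Qed.

Let pi2 : 0 <= (2 * pi : R) ^- d.
Proof. by rewrite invr_ge0 exprn_ge0// mulr_ge0// pi_ge0. Qed.

Let p_le x : p x <= (2 * pi) ^- d * C * r ^- d.
Proof.
rewrite (le_trans (inversion_density_le mY XE E_int x))// -mulrA ler_wpM2l//.
apply: le_trans momentR; apply: le_Rintegral => // z _.
rewrite ler_peMr ?expR_ge0// lerDl mulr_ge0 ?enorm_ge0//; exact: ltW.
Qed.

(** The cosines differ by at most [|z| |x - y|], which the weight [r |z|] of the moment pays for. *)
Let p_lip x y : p x - p y <= (2 * pi) ^- d * C * r ^- d * (enorm (x - y) / r).
Proof.
rewrite /p /inversion_density -mulrBr -!mulrA ler_wpM2l//.
rewrite /inversion_integral -RintegralB//; first last.
- exact: (integrable_inversion_integrand mY XE E_int 0 y).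
- exact: (integrable_inversion_integrand mY XE E_int 0 x).
rewrite mulrA [leRHS]mulrC.
have e0 : 0 <= enorm (x - y) / r by rewrite divr_ge0 ?enorm_ge0 ?ltW.
apply: le_trans (ler_wpM2l e0 momentR).
rewrite -RintegralZl//; apply: le_Rintegral => //.
- exact: (integrableB measurableT (integrable_inversion_integrand mY XE E_int 0 x)
    (integrable_inversion_integrand mY XE E_int 0 y)).
- exact: (integrableZl measurableT _ moment_int).
move=> z _; rewrite -mulrBr mulrCA ler_wpM2l ?expR_ge0//.
rewrite (le_trans (ler_norm _))// (le_trans (cos_lip _ _))//.
have -> : 0 - dotp z x - t * phase g z - (0 - dotp z y - t * phase g z) =
    - dotp z (x - y) by rewrite dotpBr; ring.
rewrite normrN (le_trans (dotp_CS _ _))//.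
have -> : enorm (x - y) / r * (1 + r * enorm z) =
    enorm (x - y) / r + enorm z * enorm (x - y) by field; rewrite gt_eqF.
by rewrite lerDr.
Qed.

Let n := concentration_steps d.

Lemma density_peak : exists x, cube (t *: drift_r g r) (n%:R * r) x /\
  peak_const * r ^- d <= p x.
Proof.
apply: contrapT => H.
have n0 : 0 < n%:R :> R by rewrite ltr0n concentration_steps_gt0.
have nr0 : 0 < n%:R * r by rewrite mulr_gt0.
pose B := cube (t *: drift_r g r) (n%:R * r).
have small x : B x -> p x <= peak_const * r ^- d.
  by move=> Bx; rewrite leNgt; apply/negP => /ltW lt_p; apply: H; exists x.
have mB : measurable B := measurable_cube _ _.
have := levy_concentration YP t0 r0 hr; rewrite -/n -/B.
rewrite (inversion_density_law mY XE E_int)// -/p; apply/negP; rewrite -ltNge.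
apply: (@le_lt_trans _ _ (\int[lam]_(x in B) (peak_const * r ^- d)%:E)%E).
  apply: ge0_le_integral => //.
  - by move=> x _; rewrite lee_fin (inversion_density_ge0 mY XE E_int).
  - apply: measurable_funTS; apply: mEFin.
    exact: (measurable_inversion_density mY XE E_int).
have -> : (\int[lam]_(x in B) (peak_const * r ^- d)%:E = (peak_const * r ^- d)%:E * lam B)%E.
  exact: integral_cst.
rewrite [X in (_ * X)%E](lebesgue_cube _ nr0) -EFinM lte_fin.
have -> : peak_const * r ^- d * (2 * (n%:R * r)) ^+ d = 2 ^- n / 2.
  have -> : (2 * (n%:R * r)) ^+ d = (2 * n%:R) ^+ d * r ^+ d by rewrite mulrA exprMn.
  rewrite /peak_const -/n.
  have : (2 * n%:R : R) ^+ d != 0 by rewrite expf_neq0// mulf_neq0// gt_eqF.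
  have : r ^+ d != 0 by rewrite expf_neq0// gt_eqF.
  have : (2 : R) ^+ n != 0 by rewrite expf_neq0.
  move: ((2 * n%:R) ^+ d) (r ^+ d) (2 ^+ n) => u v w u0 v0 w0.
  by field; rewrite u0 v0 w0.
by rewrite gtr_pMr ?invr_gt0 ?exprn_gt0// invf_lt1// ltr1n.
Qed.

Lemma density_spread (c : R) : spread_const C <= c ->
  exists xt, enorm xt <= c * r /\
  forall y, enorm y <= c^-1 * r ->
    (c^-1%:E * esup p <= (p (y + xt + t *: drift_r g r))%:E)%E.
Proof.
move=> sc; have c1 : 1 <= c := le_trans (spread_const_ge1 C0) sc.
have c0 : 0 < c := lt_le_trans ltr01 c1.
have k0 := peak_const_gt0.
have n0 : 0 <= n%:R :> R by [].
pose A := (2 * pi) ^- d * C.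
have A0 : 0 <= A by rewrite mulr_ge0.
have [dnc Ac] : d%:R * n%:R <= c /\ 2 * A / peak_const <= c.
  have u1 : 0 <= d%:R * n%:R :> R by rewrite mulr_ge0.
  have u2 : 0 <= 2 * A / peak_const by rewrite divr_ge0 ?mulr_ge0// ltW.
  by move: sc; rewrite /spread_const -/n -/A; split; lra.
have [x [xb px]] := density_peak.
have rd : 0 < r ^- d by rewrite invr_gt0 exprn_gt0.
have Ak : A * c^-1 <= peak_const / 2.
  by move: Ac; rewrite ler_pdivrMr// => Ac; rewrite ler_pdivrMr//; lra.
exists (x - t *: drift_r g r); split.
  apply: (le_trans (cube_enorm _ xb)); first by rewrite mulr_ge0// ltW.
  by rewrite mulrA ler_wpM2r ?(ltW r0).
move=> y yc; have -> : y + (x - t *: drift_r g r) + t *: drift_r g r = y + x.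
  by rewrite -addrA subrK.
have low : peak_const / 2 * r ^- d <= p (y + x).
  have := p_lip x (y + x); rewrite -/A opprD addrCA subrr addr0 enormN.
  have : enorm y / r <= c^-1 by rewrite ler_pdivrMr.
  move=> /(ler_wpM2l A0) => h1.
  have h2 : A * r ^- d * (enorm y / r) <= peak_const / 2 * r ^- d.
    by rewrite mulrAC ler_wpM2r ?(ltW rd)// (le_trans h1).
  have -> : peak_const / 2 * r ^- d = peak_const * r ^- d / 2 by rewrite mulrAC.
  move: px h2; have -> : peak_const / 2 * r ^- d = peak_const * r ^- d / 2.
    by rewrite mulrAC.
  by move: (p x) (p (y + x)) (peak_const / r ^+ d) (_ * (enorm y / r)) => u v k w; lra.
apply: (@le_trans _ _ (c^-1%:E * (A * r ^- d)%:E)%E).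
  apply: lee_wpmul2l; first by rewrite lee_fin invr_ge0 ltW.
  by apply: ge_ereal_sup => _ [z _ <-]; rewrite lee_fin p_le.
rewrite -EFinM lee_fin (le_trans _ low)// mulrA ler_wpM2r ?(ltW rd)//.
by rewrite mulrC.
Qed.

End density_spread.

Arguments spread_const {R} d C.

(** * The conditions in terms of the exponent *)

Section stretched_exponential.
Context {R : realType}.

(** An integer [k] with [k * alpha >= 2 d + 1], so that the [k]-th power of [u^alpha] beats the
    polynomial weight when [u >= 1]. *)
Definition moment_power (d : nat) (alpha : R) : nat :=
  Num.bound ((d.*2.+1)%:R / alpha).

(** The two terms of the sum treat [r |z| <= 1] and [r |z| > 1]; [pi^d * r^-d] is the integral of
    the inverse of the product of the [1 + (r z_i)^2]. *)
Definition moment_const (d : nat) (c alpha : R) : R :=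
  2 ^+ d.*2.+1 * (1 + (moment_power d alpha)`!%:R / c ^+ moment_power d alpha) *
  pi ^+ d.

Lemma moment_const_ge0 d c alpha : 0 < c -> 0 <= moment_const d c alpha.
Proof.
move=> c0; rewrite !mulr_ge0 ?exprn_ge0 ?pi_ge0// addr_ge0// divr_ge0//.
by rewrite exprn_ge0// ltW.
Qed.

Lemma expRN_le (k : nat) (x : R) : 0 < x -> expR (- x) <= k`!%:R / x ^+ k.
Proof.
move=> x0; rewrite expRN -[leRHS]invrK lef_pV2 ?posrE ?expR_gt0//; last first.
  by rewrite invr_gt0 divr_gt0 ?exprn_gt0// ltr0n fact_gt0.
rewrite invfM invrK mulrC; case: k => [|k].
  by rewrite expr0 fact0 invr1 mulr1 -[leLHS]expR0 ler_expR ltW.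
by apply: le_trans (expR_ge1Dxn k (ltW x0)); rewrite lerDr.
Qed.

Lemma stretched_exp_le d (c alpha u : R) : 0 < c -> 0 < alpha -> 1 <= u ->
  expR (- (c * u `^ alpha)) * u ^+ d.*2.+1 <=
  (moment_power d alpha)`!%:R / c ^+ moment_power d alpha.
Proof.
move=> c0 a0 u1; set k := moment_power d alpha.
have u0 : 0 < u := lt_le_trans ltr01 u1.
have ua : 0 < u `^ alpha by rewrite powR_gt0.
have uk : u ^+ d.*2.+1 <= (u `^ alpha) ^+ k.
  rewrite -powR_mulrn ?(ltW u0)// -powR_mulrn ?(ltW ua)// -powRrM ler_powR//.
  rewrite mulrC -ler_pdivrMr// ltW// archi_boundP//.
  by rewrite divr_ge0// ltW.
have h := expRN_le k (mulr_gt0 c0 ua).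
rewrite (le_trans (ler_pM (expR_ge0 _) (exprn_ge0 _ (ltW u0)) h uk))//.
rewrite exprMn invfM -!mulrA mulVf ?mulr1//.
by rewrite expf_neq0// gt_eqF.
Qed.

Lemma prod_1Dsqr_le d (u : R) (a : 'I_d -> R) : 0 <= u ->
  (forall i, `|a i| <= u) -> \prod_(i < d) (1 + a i ^+ 2) <= (1 + u) ^+ d.*2.
Proof.
move=> u0 au; rewrite -mul2n exprM -[X in _ ^+ X](card_ord d) -prodr_const.
apply: ler_prod => i _; rewrite addr_ge0 ?sqr_ge0//=.
rewrite -real_normK ?num_real//; have := au i; have := normr_ge0 (a i).
by move: `|a i| => v v0 vu; nra.
Qed.

Lemma cauchy_cV_scaledE d (r : R) (z : 'cV[R]_d) : 0 < r ->
  cauchy_cV r^-1 z = (2 * r) ^+ d / \prod_(i < d) (1 + (r * z i ord0) ^+ 2).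
Proof.
move=> r0; rewrite /cauchy_cV -[X in _ ^+ X](card_ord d) -prodr_const -prodf_div.
apply: eq_bigr => i _; rewrite /cauchy_kernel.
have h : 1 + (r * z i ord0) ^+ 2 != 0 by rewrite gt_eqF// ltr_pwDl ?sqr_ge0.
have h2 : r^-1 ^+ 2 + z i ord0 ^+ 2 != 0.
  by rewrite gt_eqF// ltr_pwDl ?sqr_ge0// exprn_gt0// invr_gt0.
have h3 : r != 0 by rewrite gt_eqF.
apply/eqP; rewrite eqr_div//; apply/eqP; field.
exact: h3.
Qed.

End stretched_exponential.

(** * Moment bound and integrability under (C3) *)

Section C3_consequences.
Context {R : realType} {d : nat}.
Local Notation lam := (lebesgue_cV d).

Lemma inve_lt (T : \bar R) (r : R) : (0 < T)%E -> 0 < r -> (r%:E < T)%E ->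
  (T^-1 < r^-1%:E)%E.
Proof.
case: T => [s||]//=; rewrite ?lte_fin => s0 r0 rs.
  by rewrite inver gt_eqF// lte_fin ltf_pV2.
by rewrite invr_gt0.
Qed.

Variables (g : levy_triplet R d) (T3 : \bar R) (c3 alpha : R).
Hypotheses (T30 : (0 < T3)%E) (c30 : 0 < c3 <= 1) (a0 : 0 < alpha).
Hypothesis C3g : C3_with g T3 c3 alpha.

(** One factor [c] for each half of (C3), and [1 + 64 d] from [h_le_Psistar]. *)
Definition growth_const (c : R) : R := c ^+ 2 / (1 + 64 * d%:R).

Lemma growth_const_gt0 : 0 < growth_const c3.
Proof.
case/andP: c30 => c0 _; rewrite divr_gt0 ?exprn_gt0// ltr_pwDl// mulr_ge0//.
Qed.

Lemma C3_psi_ge (r : R) z : 0 < r -> (r%:E < T3)%E -> 1 <= r * enorm z ->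
  growth_const c3 * (r * enorm z) `^ alpha * h g r <= psi g z.
Proof.
move=> r0 rT z1; case/andP: c30 => c0 _; have [H1 H2] := C3g.
have Tr := inve_lt T30 r0 rT.
have zr : r^-1 <= enorm z by rewrite -[leLHS]mul1r ler_pdivrMr// mulrC.
have Tz : (T3^-1 < (enorm z)%:E)%E by rewrite (lt_le_trans Tr)// lee_fin.
apply: le_trans (H1 _ Tz).
have e : r * enorm z * r^-1 = enorm z by field; rewrite gt_eqF.
have := H2 _ _ z1 Tr; rewrite e => h2.
apply: le_trans (ler_wpM2l (ltW c0) h2).
have ir : 0 < r^-1 by rewrite invr_gt0.
have h1 := h_le_Psistar g ir; rewrite invrK in h1.
have D0 : 0 < 1 + 64 * d%:R :> R by rewrite ltr_pwDl// mulr_ge0.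
have pa : 0 <= (r * enorm z) `^ alpha by exact: powR_ge0.
have := ler_wpM2l (mulr_ge0 (ltW growth_const_gt0) pa) h1.
move=> /le_trans; apply; rewrite /growth_const le_eqVlt; apply/orP; left; apply/eqP.
by field; rewrite gt_eqF.
Qed.

(** The integrand is dominated by a multiple of the Cauchy product of scale [1 / r]. The power
    [2 d + 1] collects [2 d] from the denominators of that product and 1 from the weight
    [1 + r |z|]. *)
Lemma C3_moment (t r : R) : 0 < t -> 0 < r -> h g r = t^-1 -> (r%:E < T3)%E ->
  measurable_fun setT (psi g) ->
  (\int[lam]_z (expR (- (t * psi g z)) * (1 + r * enorm z))%:E <=
   (moment_const d (growth_const c3) alpha * r ^- d)%:E)%E.
Proof.
move=> t0 r0 hr rT mpsi; set c := growth_const c3; have c0 := growth_const_gt0.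
pose k := moment_power d alpha.
pose K : R := 2 ^+ d.*2.+1 * (1 + k`!%:R / c ^+ k).
have q0 : 0 <= k`!%:R / c ^+ k by rewrite divr_ge0// exprn_ge0// ltW.
have K0 : 0 <= K by rewrite mulr_ge0 ?exprn_ge0// addr_ge0.
have rd : 0 < (2 * r) ^+ d by rewrite exprn_gt0// mulr_gt0.
have bound z : expR (- (t * psi g z)) * (1 + r * enorm z) <=
    K / (2 * r) ^+ d * cauchy_cV r^-1 z.
  rewrite cauchy_cV_scaledE// mulrA divfK ?gt_eqF//.
  set u := r * enorm z; have u0 : 0 <= u by rewrite mulr_ge0 ?enorm_ge0 ?ltW.
  set pr := \prod_(_ < _) _.
  have pr0 : 0 < pr by apply: prodr_gt0 => i _; rewrite ltr_pwDl ?sqr_ge0.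
  have pru : pr <= (1 + u) ^+ d.*2.
    apply: prod_1Dsqr_le => // i; rewrite normrM gtr0_norm// ler_wpM2l ?(ltW r0)//.
    exact: coord_le_enorm.
  rewrite ler_pdivlMr//.
  apply: (@le_trans _ _ (expR (- (t * psi g z)) * (1 + u) ^+ d.*2.+1)).
    by rewrite -mulrA ler_wpM2l ?expR_ge0// exprS ler_wpM2l// addr_ge0.
  have [u1|u1] := leP u 1.
    rewrite -[leRHS]mul1r; apply: ler_pM; rewrite ?expR_ge0 ?exprn_ge0 ?addr_ge0//.
      by rewrite expR_le1 oppr_le0 mulr_ge0 ?psi_ge0 ?ltW.
    rewrite (@le_trans _ _ (2 ^+ d.*2.+1))//; last by rewrite ler_peMr// lerDl.
    by rewrite lerXn2r ?nnegrE ?addr_ge0// -[leRHS]/(1 + 1) lerD2l.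
  apply: (@le_trans _ _ (expR (- (c * u `^ alpha)) * (2 * u) ^+ d.*2.+1)).
    apply: ler_pM; rewrite ?expR_ge0 ?exprn_ge0 ?addr_ge0//.
      rewrite ler_expR lerN2.
      have := ler_wpM2l (ltW t0) (C3_psi_ge r0 rT (ltW u1)).
      by rewrite hr mulrCA divff ?gt_eqF// mulr1.
    by apply: lerXn2r; rewrite ?nnegrE; lra.
  rewrite exprMn mulrCA ler_wpM2l ?exprn_ge0//.
  by rewrite (le_trans (stretched_exp_le d c0 a0 (ltW u1)))// lerDr.
apply: (@le_trans _ _ (\int[lam]_z (K / (2 * r) ^+ d * cauchy_cV r^-1 z)%:E)%E).
  apply: ge0_le_integral => //.
  - by move=> z _; rewrite lee_fin moment_ge0// ltW.
  - by apply: mEFin; exact: measurable_moment.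
  - apply: mEFin; apply: measurable_funM => //.
    by apply: measurable_cauchy_cV; rewrite gt_eqF// invr_gt0.
  - by move=> z _; rewrite lee_fin.
have := @integral_cauchy_cV R d r^-1 0; rewrite invr_gt0 => /(_ r0) ic.
under eq_integral do rewrite EFinM.
rewrite ge0_integralZl_EFin//; first last.
- by rewrite divr_ge0// ltW.
- apply: mEFin; apply: measurable_cauchy_cV; rewrite gt_eqF// invr_gt0//.
- by move=> z _; rewrite lee_fin cauchy_cV_ge0// invr_ge0 ltW.
rewrite (eq_integral (fun z : 'cV[R]_d => (cauchy_cV r^-1 (z - 0))%:E)); last by move=> z _; rewrite subr0.
rewrite ic -EFinM lee_fin /moment_const -/k -/K le_eqVlt; apply/orP; left; apply/eqP.
rewrite !exprMn; field.
by rewrite !expf_neq0// ?gt_eqF.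
Qed.

(** For finite [T3], [C3_moment] reaches small times only; as [psi >= 0], integrability at a time
    [s = 1 / h g r <= t] with [r < T3] carries over to [t]. *)
Lemma C3_exp_integrable (t : R) : h g r @[r --> 0^'+] --> +oo ->
  measurable_fun setT (psi g) -> 0 < t ->
  lam.-integrable setT (EFin \o (fun z => expR (- (t * psi g z)))).
Proof.
move=> hoo mpsi t0; have it : 0 < t^-1 by rewrite invr_gt0.
have [r [r0 rT rt]] : exists r, [/\ 0 < r, (r%:E < T3)%E & r <= hinv g t^-1].
  move: T30; case: T3 => [s||]// s0; last first.
    by exists (hinv g t^-1); rewrite hinv_gt0// ltry.
  exists (Num.min (s / 2) (hinv g t^-1)); rewrite lte_fin in s0.
  split; rewrite ?lt_min ?hinv_gt0 ?divr_gt0 ?ge_min ?lexx ?orbT//.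
  by rewrite lte_fin gt_min; apply/orP; left; rewrite ltr_pdivrMr//; lra.
pose s := (h g r)^-1; have h0 := h_gt0 hoo r0.
have s0 : 0 < s by rewrite invr_gt0.
have st : s <= t.
  rewrite /s -[t]invrK lef_pV2 ?posrE//.
  by rewrite -(hinvK hoo it) h_le// r0.
have := @C3_moment s r s0 r0; rewrite invrK => /(_ erefl rT mpsi) H.
apply/integrableP; split.
  by apply: mEFin; exact: measurable_expRN_scaled.
apply: le_lt_trans (ltry (moment_const d (growth_const c3) alpha * r ^- d)).
apply: le_trans H; apply: ge0_le_integral => //.
- by apply: measurableT_comp => //; apply: mEFin; exact: measurable_expRN_scaled.
- by apply: mEFin; exact: measurable_moment.
move=> z _; rewrite /= lee_fin ger0_norm ?expR_ge0//.
rewrite (@le_trans _ _ (expR (- (s * psi g z))))//.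
  by rewrite ler_expR lerN2 ler_wpM2r ?psi_ge0.
by rewrite ler_peMr ?expR_ge0// lerDl mulr_ge0 ?enorm_ge0 ?ltW.
Qed.

End C3_consequences.

Arguments growth_const {R} d c.

(** * From the integral bound to (C3) *)

Section doubling.
Context {R : realType} {d : nat}.
Local Notation lam := (lebesgue_cV d).
Variable g : levy_triplet R d.

(** Doubling is iterated [m] times, with [m] the integer part of [ln lambda / ln l]. Then [2^m] is
    [lambda^alpha] up to rounding, whence the factor 1/2; [l >= 2] gives [alpha <= 1]. *)
Lemma doubling_power_growth (T3 : \bar R) (l : R) : 2 <= l ->
  (forall r : R, 0 < r -> (T3^-1 < r%:E)%E -> 2 * Psistar g r <= Psistar g (l * r)) ->
  (0 < T3)%E ->
  exists2 alpha : R, 0 < alpha <= 2 & forall lambda r : R, 1 <= lambda ->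
    (T3^-1 < r%:E)%E ->
    2^-1 * lambda `^ alpha * Psistar g r <= Psistar g (lambda * r).
Proof.
move=> l2 dbl T30; have l0 : 0 < l by lra.
have l1 : 1 < l by lra.
have lnl : 0 < ln l by rewrite ln_gt0.
have ln2 : 0 < ln (2 : R) by rewrite ln_gt0// ltr1n.
exists (ln 2 / ln l).
  rewrite divr_gt0//= ler_pdivrMr// (@le_trans _ _ (ln l))//.
    by rewrite ler_ln ?posrE.
  by rewrite mulr_natl mulr2n lerDl ltW.
move=> L r L1 Tr; have L0 : 0 < L := lt_le_trans ltr01 L1.
have T3i : (0 <= T3^-1)%E by rewrite inve_ge0 ltW.
have r0 : 0 < r by rewrite -lte_fin (le_lt_trans T3i).
have iter (m : nat) : 2 ^+ m * Psistar g r <= Psistar g (l ^+ m * r).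
  elim: m => [|m IH]; first by rewrite !expr0 !mul1r.
  rewrite !exprS -!mulrA; have lm1 : 1 <= l ^+ m by rewrite exprn_ege1// ltW.
  have lr : r <= l ^+ m * r by rewrite ler_peMl// ltW.
  apply: le_trans (dbl (l ^+ m * r) _ _).
  - by rewrite ler_wpM2l.
  - exact: lt_le_trans lr.
  - by rewrite (lt_le_trans Tr)// lee_fin.
pose s := ln L / ln l.
have s0 : 0 <= s by rewrite divr_ge0 ?ln_ge0// ltW.
have LE : L = expR (s * ln l) by rewrite /s divfK ?gt_eqF// lnK.
have /andP[ms sm] := truncn_itv s0; set m := Num.truncn s in ms sm.
have lm : l ^+ m <= L.
  by rewrite -powR_mulrn ?(ltW l0)// /powR gt_eqF// LE ler_expR ler_pM2r.
have La : L `^ (ln 2 / ln l) <= 2 * 2 ^+ m.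
  rewrite -exprS -powR_mulrn// /powR !gt_eqF// LE expRK ler_expR.
  have -> : ln 2 / ln l * (s * ln l) = s * ln 2 by field; rewrite gt_eqF.
  by rewrite ler_pM2r// ltW.
have Pr := Psistar_ge0 g (ltW r0).
apply: (@le_trans _ _ (2 ^+ m * Psistar g r)).
  by rewrite ler_wpM2r// [leLHS]mulrC ler_pdivrMr// [leRHS]mulrC.
apply: (le_trans (iter m)); apply: Psistar_nd.
by rewrite mulr_ge0 ?exprn_ge0 ?(ltW l0) ?(ltW r0)//= ler_pM2r.
Qed.

Hypothesis hoo : h g r @[r --> 0^'+] --> +oo.
Hypothesis mpsi : measurable_fun setT (psi g).

Variables T c : R.
Hypothesis T0 : 0 < T.
Hypothesis exp_le : forall t : R, 0 < t -> t < T ->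
  (\int[lam]_z (expR (- (2 * (t * psi g z))))%:E <= (c * hinv g t^-1 ^- d)%:E)%E.

(* [t = 1 / h (1 / rho)], so that [hinv (1 / t) = 1 / rho]. *)
Lemma exp_bound_vol (rho M : R) (U : set 'cV[R]_d) (v : R) :
  (hinv g T^-1)^-1 < rho -> measurable U -> lam U = v%:E ->
  (forall z, U z -> psi g z <= M * h g rho^-1) ->
  expR (- (2 * M)) * v <= c * rho ^+ d.
Proof.
move=> Trho mU lU UM.
have iT : 0 < T^-1 by rewrite invr_gt0.
have hT := hinv_gt0 hoo iT.
have rho0 : 0 < rho by rewrite (lt_trans _ Trho)// invr_gt0.
have ir : 0 < rho^-1 by rewrite invr_gt0.
have hr := h_gt0 hoo ir.
pose t := (h g rho^-1)^-1; have t0 : 0 < t by rewrite invr_gt0.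
have tT : t < T.
  rewrite /t -[T]invrK ltf_pV2 ?posrE// -(hinvK hoo iT) h_lt_iff//.
  by rewrite -[X in _ < X]invrK ltf_pV2 ?posrE ?invr_gt0.
have := exp_le t0 tT; rewrite invrK hK// exprVn invrK => /(le_trans _) H.
rewrite -lee_fin EFinM -lU; apply: H; apply: ge_cst_integral => //.
- apply: measurableT_comp => //; apply: measurableT_comp => //.
  by apply: measurable_funM => //; exact: measurable_funM.
- move=> x Ux; rewrite ler_expR lerN2 ler_pM2l// /t mulrC ler_pdivrMr//.
  exact: UM.
Qed.

Hypothesis d0 : (0 < d)%N.

Let dR : 0 < d%:R :> R. Proof. by rewrite ltr0n. Qed.

(** Without doubling, [psi] would stay below [4 * h g rho^-1] on a cube whose side is a large
    multiple of [rho], too voluminous for [exp_bound_vol]. *)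
Lemma exp_bound_doubling : exists2 l : R, 2 <= l &
  forall rho : R, (hinv g T^-1)^-1 < rho ->
    2 * Psistar g rho <= Psistar g (l * rho).
Proof.
(* [8 = 2 * 4] is the exponent lost on that cube. Its volume [(4 b rho)^d] is too large once
   [b > |c| * expR 8], and the cube lies in the ball of radius [2 d b rho]. *)
pose b := `|c| * expR 8 + 1; have b1 : 1 <= b.
  by rewrite lerDr mulr_ge0// expR_ge0.
exists (2 * d%:R * b).
  by rewrite -mulrA ler_peMr// (le_trans b1)// ler_peMl ?ler1n// (le_trans _ b1).
move=> rho Trho; rewrite leNgt; apply/negP => H.
have hT : 0 < hinv g T^-1 by rewrite hinv_gt0// invr_gt0.
have rho0 : 0 < rho by rewrite (lt_trans _ Trho)// invr_gt0.
have b0 : 0 < b := lt_le_trans ltr01 b1.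
have a0 : 0 < 2 * b * rho by rewrite !mulr_gt0.
have := @exp_bound_vol rho 4 (cube 0 (2 * b * rho)) _ Trho
  (measurable_cube _ _) (lebesgue_cube _ a0).
have ir : 0 < rho^-1 by rewrite invr_gt0.
have := Psistar_le_h g ir; rewrite invrK => Ph.
have hz z : cube 0 (2 * b * rho) z -> psi g z <= 4 * h g rho^-1.
  move=> /(cube_enorm (ltW a0)); rewrite subr0 => zn.
  have : psi g z <= Psistar g (2 * d%:R * b * rho).
    by apply: psi_le_Psistar; rewrite (le_trans zn)// !mulrA (mulrC d%:R).
  by move: H Ph; move: (Psistar _ _) (Psistar _ _) => u v; lra.
move=> /(_ hz); apply/negP; rewrite -ltNge.
have -> : (2 * (2 * b * rho)) ^+ d = (2 * (2 * b)) ^+ d * rho ^+ d.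
  by rewrite -exprMn mulrA.
rewrite (mulrA (expR _)) ltr_pM2r ?exprn_gt0//.
rewrite [ltRHS]mulrC -ltr_pdivrMr ?expR_gt0// expRN invrK.
have -> : (2 * 4 : R) = 8 by ring.
apply: (@le_lt_trans _ _ (`|c| * expR 8)).
  by rewrite ler_wpM2r ?expR_ge0// ler_norm.
apply: (@lt_le_trans _ _ (2 * (2 * b))).
  have : 0 <= `|c| * expR 8 by rewrite mulr_ge0 ?expR_ge0.
  by rewrite /b; move: (_ * expR 8) => u; lra.
by rewrite -[leLHS]expr1; apply: ler_weXn2l => //; lra.
Qed.

Lemma exists_large_coord (x : 'cV[R]_d) (a : R) : 0 <= a ->
  d%:R * a < enorm x -> exists i, a < `|x i ord0|.
Proof.
move=> a0 xa; apply: contrapT => H; move: xa; apply/negP; rewrite -leNgt.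
apply: enorm_le_coord => // i; rewrite leNgt; apply/negP => ai.
by apply: H; exists i.
Qed.

(* The [n] cubes centred at the multiples [k x], [k < n], are disjoint, and
   [psi] is at most [2 n^2 psi x + O(h (1 / |x|))] on them. *)
Lemma exp_bound_psi_ge : exists2 n : nat, (0 < n)%N &
  forall x : 'cV[R]_d, (hinv g T^-1)^-1 < enorm x ->
    Psistar g (enorm x) <= 8 * n%:R ^+ 2 * psi g x.
Proof.
(* [9 = 2 * (9 / 2)]: if the claim fails with [N] cubes, [2 N^2 psi x] is at most [h / 2] and the
   remainder [2 Psistar] at most [4 h], both at scale [1 / rho]. *)
pose b := `|c| * expR 9 * (2 * d%:R) ^+ d.
have b0 : 0 <= b by rewrite !mulr_ge0 ?expR_ge0 ?exprn_ge0 ?mulr_ge0.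
have [n bn] : exists n : nat, b < n.+1%:R.
  by have [n] := archi_bound_lt b; rewrite ger0_norm//; exists n.
exists n.+1 => // x Tx; set rho := enorm x.
have hT : 0 < hinv g T^-1 by rewrite hinv_gt0// invr_gt0.
have rho0 : 0 < rho by rewrite (lt_trans _ Tx)// invr_gt0.
have ir : 0 < rho^-1 by rewrite invr_gt0.
have hr := h_gt0 hoo ir.
have := Psistar_le_h g ir; rewrite invrK => Ph.
have n0 : 0 < n.+1%:R ^+ 2 :> R by rewrite exprn_gt0.
rewrite leNgt; apply/negP => H.
(* Some coordinate of [x] exceeds [2 a] in absolute value, so cubes of half-side [a] about distinct
   multiples of [x] are separated in it; their points stay within [rho] of the centres. *)
pose a := rho / (4 * d%:R); have a0 : 0 < a by rewrite divr_gt0// mulr_gt0.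
have [i xi] : exists i, 2 * a < `|x i ord0|.
  apply: exists_large_coord; first by rewrite mulr_ge0// ltW.
  have -> : d%:R * (2 * a) = rho / 2 by rewrite /a; field; rewrite gt_eqF.
  by rewrite -/rho ltr_pdivrMr//; lra.
pose F (k : 'I_n.+1) := cube (k%:R *: x) a.
pose U := \big[setU/set0]_(k < n.+1) F k.
have mF k : measurable (F k) by exact: measurable_cube.
have tF : trivIset setT F.
  apply/trivIsetP => k l _ _ kl; rewrite -subset0 => y [] /cubeP/(_ i) yk.
  move=> /cubeP/(_ i) yl; move: kl => /eqP; apply; apply: val_inj => /=.
  have : `|(k%:R - l%:R) * x i ord0| <= 2 * a.
    have -> : (k%:R - l%:R) * x i ord0 =
      (y i ord0 - (l%:R *: x) i ord0) - (y i ord0 - (k%:R *: x) i ord0).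
      by rewrite !mxE; ring.
    by rewrite (le_trans (ler_normB _ _))// mulr_natl mulr2n lerD.
  rewrite normrM => kl2; apply/eqP/negPn/negP => kl.
  have : 1 <= `|k%:R - l%:R : R|.
    have -> : k%:R - l%:R = (k%:Z - l%:Z)%:~R :> R by rewrite intrB.
    by rewrite -intr_norm ler1z -gtz0_ge1 normr_gt0 subr_eq0 eqz_nat.
  by have := normr_ge0 (x i ord0); nra.
have lU : lam U = (n.+1%:R * (2 * a) ^+ d)%:E.
  rewrite measure_bigsetU_ord//.
  rewrite (eq_bigr (fun=> ((2 * a) ^+ d)%:E)); last by move=> k _; exact: lebesgue_cube.
  by rewrite sumEFin sumr_const card_ord -(mulr_natl ((2 * a) ^+ d)).
have mU : measurable U by apply: bigsetU_measurable => k _.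
have := @exp_bound_vol rho (9 / 2) U _ Tx mU lU.
have Uz z : U z -> psi g z <= 9 / 2 * h g rho^-1.
  rewrite /U -bigcup_seq => -[k _ /(cube_enorm (ltW a0)) zk].
  have yr : enorm (z - k%:R *: x) <= rho.
    rewrite (le_trans zk)// /a mulrCA ler_piMr ?(ltW rho0)//.
    have -> : d%:R / (4 * d%:R) = 4^-1 :> R by field; rewrite gt_eqF.
    by rewrite invf_le1// ler1n.
  have := psiD g k x (z - k%:R *: x); rewrite addrC subrK.
  have := psi_le_Psistar g yr => py.
  have kn : k%:R ^+ 2 * psi g x <= n.+1%:R ^+ 2 * psi g x.
    by rewrite ler_wpM2r ?psi_ge0// lerXn2r ?nnegrE// ler_nat ltnW.
  move: H Ph py kn; rewrite -!mulrA.
  move: (psi g z) (psi g (_ - _)) (k%:R * _) (n.+1%:R * _) (Psistar g rho).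
  by move=> u v w p q; lra.
move=> /(_ Uz); apply/negP; rewrite -ltNge.
have -> : n.+1%:R * (2 * a) ^+ d = rho ^+ d * (n.+1%:R / (2 * d%:R) ^+ d).
  have -> : 2 * a = rho / (2 * d%:R) by rewrite /a; field; rewrite gt_eqF.
  by rewrite exprMn exprVn mulrCA.
rewrite [ltRHS]mulrCA [ltLHS]mulrC ltr_pM2l ?exprn_gt0//.
have -> : (2 * (9 / 2) : R) = 9 by field.
rewrite expRN mulrC ltr_pdivlMr ?expR_gt0// ltr_pdivlMr ?exprn_gt0 ?mulr_gt0//.
apply: le_lt_trans bn; rewrite /b ler_wpM2r ?exprn_ge0 ?mulr_ge0//.
by rewrite ler_wpM2r ?expR_ge0// ler_norm.
Qed.

Lemma exp_bound_C3 : C3 g.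
Proof.
have hT : 0 < hinv g T^-1 by rewrite hinv_gt0// invr_gt0.
have [l l2 dbl] := exp_bound_doubling.
have [n n0 low] := exp_bound_psi_ge.
have T30 : (0 < (hinv g T^-1)%:E)%E by rewrite lte_fin.
have TE : ((hinv g T^-1)%:E^-1 = (hinv g T^-1)^-1%:E)%E by rewrite inver gt_eqF.
have [|alpha a02 ha] := @doubling_power_growth (hinv g T^-1)%:E l l2 _ T30.
  by move=> r r0; rewrite TE lte_fin; exact: dbl.
have N1 : 1 <= n%:R ^+ 2 :> R by rewrite exprn_ege1// ler1n.
pose c3 : R := (8 * n%:R ^+ 2)^-1.
have n80 : 0 < 8 * n%:R ^+ 2 :> R by rewrite mulr_gt0// (lt_le_trans ltr01).
have c30 : 0 < c3 by rewrite invr_gt0.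
have c32 : c3 <= 2^-1.
  by rewrite lef_pV2 ?posrE//; move: N1; move: (n%:R ^+ 2) => u; lra.
exists (hinv g T^-1)%:E, c3, alpha; split => //.
  by rewrite c30/= (le_trans c32)// invf_le1// ler1n.
split=> [x|L r L1].
  rewrite TE lte_fin => /low h1; by rewrite /c3 mulrC ler_pdivrMr// mulrC.
move=> Tr; apply: le_trans (ha L r L1 Tr).
have r0 : 0 < r.
  by move: Tr; rewrite TE lte_fin; apply: lt_trans; rewrite invr_gt0.
by rewrite ler_wpM2r ?Psistar_ge0 ?(ltW r0)// ler_wpM2r ?powR_ge0.
Qed.

End doubling.

(** * Capped squares and their growth under doubling *)

Section capped_square.
Context {R : realType}.
Implicit Type u : R.

Definition capped_sqr u : R := Num.min 1 (u ^+ 2).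
(** The integrand of (C4). It is cut off where [capped_sqr] saturates, so it measures the growth of
    [capped_sqr] under doubling. *)
Definition near_sqr u : R := if `|u| < 1 then u ^+ 2 else 0.

Lemma capped_sqr_near u : `|u| < 1 -> capped_sqr u = u ^+ 2.
Proof.
move=> u1; rewrite /capped_sqr min_r// -real_normK ?num_real//.
by rewrite expr_le1// ltW.
Qed.

Lemma capped_sqr_far u : 1 <= `|u| -> capped_sqr u = 1.
Proof.
by move=> u1; rewrite /capped_sqr min_l// -real_normK ?num_real// exprn_ege1.
Qed.

Lemma capped_sqr_ge0 u : 0 <= capped_sqr u.
Proof. by rewrite le_min ler01 sqr_ge0. Qed.

Lemma near_sqr_ge0 u : 0 <= near_sqr u.
Proof. by rewrite /near_sqr; case: ifP => // _; rewrite sqr_ge0. Qed.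

Lemma near_le_capped_sqr u : near_sqr u <= capped_sqr u.
Proof.
rewrite /near_sqr; case: ifP => [u1|_]; last exact: capped_sqr_ge0.
by rewrite capped_sqr_near.
Qed.

Lemma near_sqr_le_onemcos u : near_sqr u <= 8 * (1 - cos u).
Proof.
rewrite /near_sqr; case: ifP => [u1|_]; first by apply: onemcos_ge_sqr; exact: ltW.
by rewrite mulr_ge0// onemcos_ge0.
Qed.

(** For [|u| >= 1] the capped square no longer grows; below, it gains at most [3 u^2]. *)
Lemma capped_sqr_double_le u : capped_sqr (2 * u) <= capped_sqr u + 3 * near_sqr u.
Proof.
rewrite /near_sqr; have [u1|u1] := ltP `|u| 1.
  rewrite (capped_sqr_near u1) (@le_trans _ _ ((2 * u) ^+ 2))//.
    by rewrite /capped_sqr ge_min lexx orbT.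
  by rewrite exprMn; nra.
by rewrite (capped_sqr_far u1) mulr0 addr0 /capped_sqr ge_min lexx.
Qed.

Lemma near_sqr_double_le u : near_sqr (2 * u) <= 4 * near_sqr u.
Proof.
rewrite {1}/near_sqr; case: ifP => [|_]; last by rewrite mulr_ge0 ?near_sqr_ge0.
rewrite normrM ger0_norm// => u2; rewrite /near_sqr ifT; first by rewrite exprMn; nra.
by have := normr_ge0 u; lra.
Qed.

(** For [|2 u| < 1] doubling adds exactly [3 u^2], three quarters of [(2 u)^2]; otherwise the
    right-hand side has reached its maximum 1. *)
Lemma capped_sqr_double_ge u :
  capped_sqr u + 3 / 4 * near_sqr (2 * u) <= capped_sqr (2 * u).
Proof.
rewrite /near_sqr; case: ifP => u2.
  rewrite (capped_sqr_near u2) -lerBrDr (@le_trans _ _ (u ^+ 2))//.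
    by rewrite /capped_sqr ge_min lexx orbT.
  by rewrite exprMn; nra.
move/negbT: u2; rewrite -leNgt => u2.
by rewrite (capped_sqr_far u2) mulr0 addr0 /capped_sqr ge_min lexx.
Qed.

Lemma measurable_capped_sqr : measurable_fun setT capped_sqr.
Proof.
apply: measurable_minr => //.
Qed.

Lemma measurable_near_sqr : measurable_fun setT near_sqr.
Proof.
apply: measurable_fun_ifT => //.
apply: measurable_fun_ltr => //.
Qed.

End capped_square.

Section truncated_forms.
Context {R : realType} {d : nat}.
Variable g : levy_triplet R d.
Local Notation A := (gauss g).
Local Notation N := (jump g).
Implicit Types x : 'cV[R]_d.

Definition capped_form x : R :=
  dotp x (A *m x) + \int[N]_z capped_sqr (dotp x z).

Definition near_form x : R :=
  dotp x (A *m x) + \int[N]_z near_sqr (dotp x z).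

Lemma near_formE x : near_form x = dotp x (A *m x) +
  \int[N]_(z in [set z | `|dotp x z| < 1]) `|dotp x z| ^+ 2.
Proof.
congr (_ + _); rewrite [RHS]Rintegral_mkcond; apply: eq_Rintegral => z _.
rewrite /near_sqr patchE; case: ifPn => [zx|zx].
  by rewrite mem_set// real_normK ?num_real.
by rewrite memNset//; exact/negP.
Qed.

Let capped_le x z :
  `|capped_sqr (dotp x z)| <= (1 + enorm x ^+ 2) * trunc_sqr 1 z.
Proof.
rewrite ger0_norm ?capped_sqr_ge0//.
by apply: dotp_sqr_le => //; rewrite ?expr1n ?mulr1 ?lerDr ?lerDl ?sqr_ge0.
Qed.

Let mcapped x : measurable_fun setT (fun z => capped_sqr (dotp x z)).
Proof. by apply: (measurableT_comp measurable_capped_sqr); exact: measurable_dotpr. Qed.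

Let mnear x : measurable_fun setT (fun z => near_sqr (dotp x z)).
Proof. by apply: (measurableT_comp measurable_near_sqr); exact: measurable_dotpr. Qed.

Let icapped x : N.-integrable setT (EFin \o (fun z => capped_sqr (dotp x z))).
Proof. exact: (@jump_integrable _ _ g _ _ _ ltr01 (mcapped x) (capped_le x)). Qed.

Let inear x : N.-integrable setT (EFin \o (fun z => near_sqr (dotp x z))).
Proof.
apply: (@jump_integrable _ _ g _ (1 + enorm x ^+ 2) _ ltr01 (mnear x)) => z.
apply: le_trans (capped_le x z).
by rewrite !ger0_norm ?near_sqr_ge0 ?capped_sqr_ge0 ?near_le_capped_sqr.
Qed.

Let Q_ge0 x : 0 <= dotp x (A *m x). Proof. exact: gauss_ge0. Qed.

Let Q_double x : dotp (2 *: x) (A *m (2 *: x)) = 4 * dotp x (A *m x).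
Proof. by rewrite -scalemxAr dotpZl dotpZr mulrA -natrM. Qed.

Lemma capped_form_ge0 x : 0 <= capped_form x.
Proof. by rewrite addr_ge0// Rintegral_ge0// => z _; rewrite capped_sqr_ge0. Qed.

Lemma near_form_ge0 x : 0 <= near_form x.
Proof. by rewrite addr_ge0// Rintegral_ge0// => z _; rewrite near_sqr_ge0. Qed.

Lemma psi_le_capped_form x : psi g x <= 2 * capped_form x.
Proof.
rewrite psiE /capped_form mulrDr lerD//; first by have := Q_ge0 x; lra.
rewrite -RintegralZl//; apply: le_Rintegral => //.
- exact: integrable_onemcos.
- exact: (integrableZl measurableT _ (icapped x)).
- by move=> z _; exact: onemcos_le_min.
Qed.

Lemma near_form_le_psi x : near_form x <= 8 * psi g x.
Proof.
rewrite psiE /near_form mulrDr lerD//; first by have := Q_ge0 x; lra.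
rewrite -RintegralZl//; last exact: integrable_onemcos.
apply: le_Rintegral => //.
- exact: (integrableZl measurableT _ (integrable_onemcos g x)).
- by move=> z _; exact: near_sqr_le_onemcos.
Qed.

Lemma capped_form_double_le x :
  capped_form (2 *: x) <= capped_form x + 3 * near_form x.
Proof.
rewrite /capped_form /near_form Q_double mulrDr.
suff : \int[N]_z capped_sqr (dotp (2 *: x) z) <=
    \int[N]_z capped_sqr (dotp x z) + 3 * \int[N]_z near_sqr (dotp x z) by lra.
rewrite -RintegralZl// -RintegralD//; last exact: (integrableZl measurableT _ (inear x)).
apply: le_Rintegral => //.
- exact: (integrableD measurableT (icapped x) (integrableZl measurableT _ (inear x))).
- by move=> z _; rewrite dotpZl capped_sqr_double_le.
Qed.

Lemma near_form_double_le x : near_form (2 *: x) <= 4 * near_form x.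
Proof.
rewrite /near_form Q_double mulrDr lerD2l -RintegralZl//.
apply: le_Rintegral => //.
- exact: (integrableZl measurableT _ (inear x)).
- by move=> z _; rewrite dotpZl near_sqr_double_le.
Qed.

Lemma capped_form_double_ge x :
  capped_form x + 3 / 4 * near_form (2 *: x) <= capped_form (2 *: x).
Proof.
rewrite /capped_form /near_form Q_double mulrDr.
suff : \int[N]_z capped_sqr (dotp x z) + 3 / 4 * \int[N]_z near_sqr (dotp (2 *: x) z)
    <= \int[N]_z capped_sqr (dotp (2 *: x) z) by lra.
rewrite -RintegralZl// -RintegralD//; last exact: (integrableZl measurableT _ (inear _)).
apply: le_Rintegral => //.
- exact: (integrableD measurableT (icapped x) (integrableZl measurableT _ (inear _))).
- by move=> z _; rewrite dotpZl capped_sqr_double_ge.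
Qed.

Lemma capped_form_le_h x : 0 < enorm x -> capped_form x <= h g (enorm x)^-1.
Proof.
move=> x0; have ix : 0 < (enorm x)^-1 by rewrite invr_gt0.
rewrite hE /capped_form lerD//.
  by rewrite exprVn invrK mulrC dotp_mulmx_le.
apply: le_Rintegral => //.
- exact: integrable_trunc_sqr.
- move=> z _; rewrite -[leRHS]mul1r; apply: dotp_sqr_le => //.
  by rewrite exprVn mulfV// expf_neq0// gt_eqF.
Qed.

Lemma capped_form_le_Psistar x : 0 < enorm x ->
  capped_form x <= (1 + 64 * d%:R) * Psistar g (enorm x).
Proof.
move=> x0; exact: le_trans (capped_form_le_h x0) (h_le_Psistar g x0).
Qed.

Lemma capped_form_iter_le m x :
  capped_form (2 ^+ m *: x) <= capped_form x + 4 ^+ m * near_form x.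
Proof.
have K0 := near_form_ge0 x.
have iterK k : near_form (2 ^+ k *: x) <= 4 ^+ k * near_form x.
  elim: k => [|k IH]; first by rewrite !expr0 scale1r mul1r.
  rewrite !exprS -scalerA (le_trans (near_form_double_le _))//.
  by rewrite -mulrA ler_wpM2l.
(* The increments sum to [3 (1 + 4 + ... + 4^(m - 1)) = 4^m - 1]. *)
suff : capped_form (2 ^+ m *: x) <= capped_form x + (4 ^+ m - 1) * near_form x.
  by move: (4 ^+ m) => u; nra.
elim: m => [|m IH]; first by rewrite !expr0 scale1r subrr mul0r addr0.
rewrite !exprS -scalerA (le_trans (capped_form_double_le _))//.
have := iterK m; move: IH; move: (4 ^+ m) (capped_form (_ *: _)) (near_form (_ *: _)).
by move=> u v w; nra.
Qed.

End truncated_forms.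

(** * Equivalence of (C3) and (C4) *)

Section C3_C4.
Context {R : realType} {d : nat}.
Variable g : levy_triplet R d.
Let D : R := 1 + 64 * d%:R.

Let D1 : 1 <= D. Proof. by rewrite lerDl mulr_ge0. Qed.

Lemma inve_enorm_gt0 (T : \bar R) (r : R) : (0 < T)%E -> (T^-1 < r%:E)%E -> 0 < r.
Proof.
by move=> T0 Tr; rewrite -lte_fin (le_lt_trans _ Tr)// inve_ge0 ltW.
Qed.

Lemma pow_unbounded (a y : R) : 1 < a -> exists m : nat, y <= a ^+ m.
Proof.
move=> a1; exists (Num.bound (`|y| / (a - 1))).
set m := Num.bound _; have a0 : 0 < a - 1 by rewrite subr_gt0.
have ym : `|y| / (a - 1) < m%:R.
  by apply: archi_boundP; rewrite divr_ge0// ltW.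
have bern (k : nat) : 1 + k%:R * (a - 1) <= a ^+ k.
  elim: k => [|k IH]; first by rewrite mul0r addr0 expr0.
  rewrite exprS -(natr1 k); have k0 : 0 <= k%:R :> R by [].
  have := ler_wpM2l (ltW (lt_trans ltr01 a1)) IH.
  by have := mulr_ge0 k0 (sqr_ge0 (a - 1)); rewrite expr2; move: (k%:R) (a ^+ k) => u v; lra.
apply: le_trans (bern m); rewrite ltr_pdivrMr// in ym.
by rewrite (le_trans (ler_norm y))// (le_trans (ltW ym))// lerDr.
Qed.

(** By (C3), [capped_form] at [2^m x] is at least [(c^2 / 2) (2^alpha)^m Psistar |x|], whereas at
    [x] it is at most [D * Psistar |x|]. For [m] large the increase is at least half of
    [Psistar |x|], and it is at most [4^m * near_form x]. *)
Lemma C3_C4 : C3 g -> C4 g.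
Proof.
move=> [T [c [al [T0 /andP[c0 c1] /andP[a0 a2] [H1 H2]]]]].
have [m hm] : exists m : nat, (2 * D + 1) / c ^+ 2 <= (2 `^ al) ^+ m.
  by apply: pow_unbounded; rewrite /powR gt_eqF// expR_gt1 mulr_gt0// ln_gt0// ltr1n.
exists T, (2 * 4 ^+ m); split => //.
  by rewrite (@le_trans _ _ (4 ^+ m))// ?exprn_ege1// ?ler1n// ler_peMl// ?ler1n// exprn_ge0.
move=> x Tx; rewrite -near_formE.
have x0 := inve_enorm_gt0 T0 Tx.
have P0 := Psistar_ge0 g (ltW x0).
have m1 : 1 <= 2 ^+ m :> R by rewrite exprn_ege1// ler1n.
have nx : enorm (2 ^+ m *: x) = 2 ^+ m * enorm x.
  by rewrite enormZ ger0_norm ?exprn_ge0.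
have Tm : (T^-1 < (enorm (2 ^+ m *: x))%:E)%E.
  by rewrite (lt_le_trans Tx)// lee_fin nx ler_peMl// ltW.
have h1 := H1 _ Tm; have h2 := H2 _ _ m1 Tx; rewrite nx in h1.
have h3 := psi_le_capped_form g (2 ^+ m *: x).
have h4 := capped_form_iter_le g m x.
have h5 := capped_form_le_Psistar g x0.
have e : (2 ^+ m) `^ al = (2 `^ al) ^+ m :> R.
  by rewrite -!powR_mulrn ?powR_ge0// -!powRrM mulrC.
rewrite e in h2.
have h6 := ler_wpM2l (ltW c0) h2.
have c2 : 0 < c ^+ 2 by rewrite exprn_gt0.
have h7 : 2 * D + 1 <= c ^+ 2 * (2 `^ al) ^+ m by rewrite [leRHS]mulrC -ler_pdivrMr.
have h8 := ler_wpM2r P0 h7.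
have h9 : c * (c * (2 `^ al) ^+ m * Psistar g (enorm x)) =
  c ^+ 2 * (2 `^ al) ^+ m * Psistar g (enorm x) by ring.
rewrite h9 in h6.
have := le_trans h8 (le_trans h6 (le_trans h1 h3)); rewrite mulrDl mul1r.
move: h4 h5; rewrite -/D -mulrA -(mulrA 2).
move: (capped_form g (_ *: _)) (capped_form g x) (4 ^+ m * _) (Psistar g _) D.
by move=> p1 p2 p3 p4 p5; lra.
Qed.

Hypothesis d0 : (0 < d)%N.

Lemma exists_enorm (r : R) : 0 <= r -> exists x : 'cV[R]_d, enorm x = r.
Proof.
move=> r0; pose i0 := Ordinal d0.
exists (\col_i (if i == i0 then r else 0)).
rewrite /enorm /dotp (bigD1 i0)//= big1 => [|i /negPf ii0]; rewrite !mxE ?eqxx.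
  by rewrite addr0 -expr2 sqrtr_sqr ger0_norm.
by rewrite ii0 mul0r.
Qed.

(** (C4) at [2 x] makes the increase of [capped_form] from [x] to [2 x] at least a fixed proportion
    [k] of its final value, hence geometric growth along dyadic multiples. The comparison of [psi]
    with [Psistar] comes from [near_form_le_psi]. *)
Lemma C4_C3 : C4 g -> C3 g.
Proof.
move=> [T [c [T0 c1 H]]]; have c0 : 0 < c := lt_le_trans ltr01 c1.
have D0 : 0 < D := lt_le_trans ltr01 D1.
pose k := 3 / (4 * c * D).
have k0 : 0 < k by rewrite divr_gt0// !mulr_gt0.
have cD : 1 <= c * D by rewrite -[leLHS]mulr1 ler_pM.
have k1 : k < 1 by rewrite /k -mulrA ltr_pdivrMr; lra.
have Pk x : (T^-1 < (enorm x)%:E)%E -> Psistar g (enorm x) <= c * near_form g x.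
  by move=> /H; rewrite -near_formE.
have step x : (T^-1 < (enorm x)%:E)%E ->
    (1 - k)^-1 * capped_form g x <= capped_form g (2 *: x).
  move=> Tx; have x0 := inve_enorm_gt0 T0 Tx.
  have nx : enorm (2 *: x) = 2 * enorm x by rewrite enormZ ger0_norm.
  have x20 : 0 < enorm (2 *: x) by rewrite nx mulr_gt0.
  have h1 : Psistar g (enorm (2 *: x)) <= c * near_form g (2 *: x).
    apply: Pk; rewrite (lt_le_trans Tx)// lee_fin nx ler_peMl ?ler1n//; exact: ltW.
  have h2 := capped_form_le_Psistar g x20.
  have h3 := capped_form_double_ge g x.
  rewrite mulrC ler_pdivrMr ?subr_gt0//.
  have : k * capped_form g (2 *: x) <= 3 / 4 * near_form g (2 *: x).
    have h4 := le_trans h2 (ler_wpM2l (ltW D0) h1).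
    have := ler_wpM2l (ltW k0) h4.
    have -> : k * (D * (c * near_form g (2 *: x))) = 3 / 4 * near_form g (2 *: x).
      by rewrite /k; field; rewrite !gt_eqF.
    by [].
  by move: h3; move: (capped_form g x) (capped_form g (2 *: x)) => u v; lra.
have k1i : 1 < (1 - k)^-1 by rewrite invf_gt1 ?subr_gt0//; lra.
(* 32 is 2 for the doubling times 16 for [Psistar <= 8 c psi <= 16 c * capped_form]; [D] bounds
   [capped_form] by [Psistar] at the far end. *)
have [m hm] := @pow_unbounded _ (32 * c * D) k1i.
have Tle (x : 'cV[R]_d) n : (T^-1 < (enorm x)%:E)%E -> (T^-1 < (enorm (2 ^+ n *: x))%:E)%E.
  move=> Tx; have x0 := inve_enorm_gt0 T0 Tx; rewrite (lt_le_trans Tx)// lee_fin.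
  by rewrite enormZ ger0_norm ?exprn_ge0// ler_peMl ?(ltW x0)// exprn_ege1// ler1n.
have iter n x : (T^-1 < (enorm x)%:E)%E ->
    (1 - k)^-1 ^+ n * capped_form g x <= capped_form g (2 ^+ n *: x).
  move=> Tx; elim: n => [|n IH]; first by rewrite !expr0 mul1r scale1r.
  rewrite !exprS -mulrA -scalerA.
  apply: le_trans (step _ (Tle _ n Tx)).
  by rewrite ler_wpM2l// invr_ge0 subr_ge0 ltW.
have low x : (T^-1 < (enorm x)%:E)%E -> Psistar g (enorm x) <= 8 * c * psi g x.
  move=> Tx; rewrite (le_trans (Pk _ Tx))// -mulrA mulrCA ler_wpM2l ?(ltW c0)//.
  exact: near_form_le_psi.
(* The extra factor 2 in [2 ^+ m.+1] ensures [l >= 2] even for [m = 0]. *)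
have [||//|al al02 Hal] := @doubling_power_growth _ _ g T (2 ^+ m.+1).
- by rewrite exprS ler_peMr// exprn_ege1// ler1n.
- move=> r r0 Tr; have [x xr] := exists_enorm (ltW r0).
  rewrite -xr in Tr *; have x0 := inve_enorm_gt0 T0 Tr.
  have m0 : 0 < 2 ^+ m * enorm x by rewrite mulr_gt0// exprn_gt0.
  have nx : enorm (2 ^+ m *: x) = 2 ^+ m * enorm x.
    by rewrite enormZ ger0_norm ?exprn_ge0.
  apply: (@le_trans _ _ (Psistar g (2 ^+ m * enorm x))); last first.
    apply: Psistar_nd; rewrite ltW//= exprS -mulrA ler_peMl ?ler1n//; exact: ltW.
  have h1 := iter m x Tr; have h2 := psi_le_capped_form g x; have h3 := low _ Tr.
  have := capped_form_le_Psistar g (x := 2 ^+ m *: x); rewrite nx => /(_ m0) h4.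
  have C0 := capped_form_ge0 g x.
  have h5 := le_trans (ler_wpM2r C0 hm) (le_trans h1 h4).
  rewrite -(ler_pM2l D0); apply: le_trans h5; rewrite -/D.
  have := ler_wpM2l (_ : 0 <= 8 * c) h2; rewrite mulr_ge0 ?(ltW c0)// => /(_ isT) h6.
  have h7 := ler_wpM2l (ltW D0) (le_trans h3 h6).
  have -> : 32 * c * D * capped_form g x = 2 * (D * (8 * c * (2 * capped_form g x))) by ring.
  by rewrite mulrCA ler_wpM2l.
exists T, (8 * c)^-1, al; split => //.
  by rewrite invr_gt0 mulr_gt0//= invf_le1 ?mulr_gt0//; lra.
split=> [x Tx|L r L1 Tr].
  by rewrite mulrC ler_pdivrMr ?mulr_gt0// mulrC low.
apply: le_trans (Hal L r L1 Tr); have r0 := inve_enorm_gt0 T0 Tr.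
rewrite ler_wpM2r ?Psistar_ge0 ?(ltW r0)// ler_wpM2r ?powR_ge0//.
by rewrite lef_pV2 ?posrE ?mulr_gt0//; lra.
Qed.

End C3_C4.

(** * The equivalences *)

Section implications.
Context {R : realType} {d : nat} {disp : measure_display}
  {Omega : measurableType disp}.
Local Notation lam := (lebesgue_cV d).
Variables (P : probability Omega R) (Y : R -> Omega -> 'cV[R]_d).
Variable g : levy_triplet R d.
Hypothesis YP : levy_process_with P Y g.
Hypothesis hoo : h g r @[r --> 0^'+] --> +oo.

Lemma pos_ereal_lb (T : \bar R) : (0 < T)%E -> exists2 s : R, 0 < s & (s%:E <= T)%E.
Proof.
case: T => [s||]//= s0; first by exists s.
by exists 1 => //; rewrite leey.
Qed.

Lemma moment_C6 (T6 : \bar R) (C c : R) : 0 <= C -> spread_const d C <= c ->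
  (forall t, 0 < t -> lam.-integrable setT (EFin \o (fun z => expR (- (t * psi g z))))) ->
  (forall t r : R, 0 < t -> (t%:E < T6)%E -> 0 < r -> h g r = t^-1 ->
    (\int[lam]_z (expR (- (t * psi g z)) * (1 + r * enorm z))%:E <= (C * r ^- d)%:E)%E) ->
  C6_with P Y g T6 c.
Proof.
move=> C0 Cc ei mom.
exists (fun t => inversion_density (fun z => t * psi g z) (fun z => t * phase g z)).
split; first exact: transition_density_inversion.
move=> t t0 tT; have it : 0 < t^-1 by rewrite invr_gt0.
have hr := hinvK hoo it; have r0 := hinv_gt0 hoo it.
exact: (density_spread YP t0 r0 hr C0 (mom t _ t0 tT r0 hr)).
Qed.

(** [t < 1 / h (T3 / c6)] means [hinv g t^-1 < T3 / c6], which is at most [T3] as [c6 >= 1]: this is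
    the range of [C3_moment]. For [T3 = +oo] the bound on [t] is [+oo]. *)
Lemma C3_C6_with (c3 alpha : R) (T3 : \bar R) (c6 := spread_const d
    (moment_const d (growth_const d c3) alpha)) :
  0 < c3 <= 1 -> 0 < alpha -> (0 < T3)%E -> C3_with g T3 c3 alpha ->
  C6_with P Y g (h_ext g (T3 * c6^-1%:E))^-1%E c6.
Proof.
move=> c30 a0 T30 C3g.
have C0 : 0 <= moment_const d (growth_const d c3) alpha.
  by apply: moment_const_ge0; exact: growth_const_gt0.
have c61 : 1 <= c6 by exact: spread_const_ge1.
have c60 : 0 < c6 := lt_le_trans ltr01 c61.
apply: (moment_C6 C0 (lexx _)) => [t t0|t r t0 tT r0 hr].
  exact: (C3_exp_integrable T30 c30 a0 C3g hoo (measurable_psi YP)).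
apply: (C3_moment T30 c30 a0 C3g) => //; last exact: (measurable_psi YP).
move: tT; case: T3 T30 {C3g} => [s||]// s0; last by rewrite ltry.
rewrite lte_fin in s0; have sc : 0 < s * c6^-1 by rewrite mulr_gt0// invr_gt0.
have hs := h_gt0 hoo sc.
rewrite -EFinM /= inver gt_eqF// !lte_fin -[t]invrK -hr ltf_pV2 ?posrE ?(h_gt0 hoo)//.
rewrite h_lt_iff// => /lt_le_trans; apply.
by rewrite ler_piMr ?(ltW s0)// invf_le1.
Qed.

Lemma C3_C6 : C3 g -> C6 P Y g.
Proof.
move=> [T3 [c3 [al [T30 c30 /andP[a0 _] C3g]]]].
have H := C3_C6_with c30 a0 T30 C3g; set c6 := spread_const _ _ in H.
have c61 : 1 <= c6.
  by apply/spread_const_ge1/moment_const_ge0; exact: growth_const_gt0.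
have c60 : 0 < c6 := lt_le_trans ltr01 c61.
exists (h_ext g (T3 * c6^-1%:E))^-1%E, c6; split => //.
case: T3 T30 {C3g H} => [s||]// s0.
  rewrite lte_fin in s0; have hs : 0 < h g (s * c6^-1).
    by rewrite (h_gt0 hoo)// mulr_gt0// invr_gt0.
  by rewrite -EFinM /= inver gt_eqF// lte_fin invr_gt0.
by rewrite gt0_mulye ?lte_fin ?invr_gt0//= inve0.
Qed.

Lemma C3_C2 : C3 g -> C2 g.
Proof.
move=> [T3 [c3 [al [T30 c30 /andP[a0 _] C3g]]]].
have [r1 r10 r1T] : exists2 r1 : R, 0 < r1 & (r1%:E < T3)%E.
  have [s s0 sT] := pos_ereal_lb T30; exists (s / 2); first by rewrite divr_gt0.
  by rewrite (lt_le_trans _ sT)// lte_fin ltr_pdivrMr//; lra.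
have h1 := h_gt0 hoo r10.
(* (C2) asks for a positive constant, and [moment_const_ge0] gives only a nonnegative one, hence the
   added 1. *)
exists (h g r1)^-1%:E, (moment_const d (growth_const d c3) al + 1).
have C0 : 0 <= moment_const d (growth_const d c3) al.
  by apply: moment_const_ge0; exact: growth_const_gt0.
split; [by rewrite lte_fin invr_gt0|by rewrite ltr_wpDl|].
move=> t t0; rewrite lte_fin => tT; have it : 0 < t^-1 by rewrite invr_gt0.
have hr := hinvK hoo it; have r0 := hinv_gt0 hoo it.
have rT : ((hinv g t^-1)%:E < T3)%E.
  apply: lt_trans r1T; rewrite lte_fin -(h_lt_iff hoo)// hr.
  by rewrite -[ltLHS]invrK ltf_pV2 ?posrE ?invr_gt0.
have mp := measurable_psi YP.
have := C3_moment T30 c30 a0 C3g t0 r0 hr rT mp.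
move=> /(le_trans _) H; apply: (@le_trans _ _
  (moment_const d (growth_const d c3) al * hinv g t^-1 ^- d)%:E); last first.
  by rewrite lee_fin ler_wpM2r ?lerDl// invr_ge0 exprn_ge0// ltW.
apply: H; apply: ge0_le_integral => //.
- apply: mEFin; apply: measurableT_comp => //.
  by apply: measurable_funM => //; apply: measurableT_comp.
- by apply: mEFin; exact: measurable_moment.
move=> z _; rewrite lee_fin mulNr ler_peMr ?expR_ge0// lerDl.
by rewrite mulr_ge0 ?enorm_ge0// ltW.
Qed.

(** Times with [r = hinv g t^-1 >= T3] are compared with the earlier time of scale [r1 = T3 / 2],
    where [C3_moment] applies. The cost is [(r / r1)^(d + 1)]: [d] powers from [r^-d] and one from
    the weight [1 + r |z|]. It is bounded because [h g R6 <= T6^-1] forces [r < R6]. *)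
Lemma C3_C6_bounded (c3 alpha T3 T6 R6 : R) (c6 := spread_const d
    (moment_const d (growth_const d c3) alpha * (1 + 2 * R6 / T3) ^+ d.+1)) :
  0 < c3 <= 1 -> 0 < alpha -> 0 < T3 -> 0 < T6 -> 0 < R6 -> h g R6 <= T6^-1 ->
  C3_with g T3%:E c3 alpha -> C6_with P Y g T6%:E c6.
Proof.
move=> c30 a0 T30 T60 R60 hR6 C3g; set C' := moment_const _ _ _ in c6 *.
have T3e : (0 < T3%:E)%E by rewrite lte_fin.
have C0 : 0 <= C' by apply: moment_const_ge0; exact: growth_const_gt0.
have q0 : 0 <= 2 * R6 / T3 by rewrite divr_ge0 ?mulr_ge0// ltW.
have mp := measurable_psi YP.
apply: (moment_C6 _ (lexx _)) => [|t t0|t r t0 tT r0 hr].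
- by rewrite mulr_ge0// exprn_ge0// addr_ge0.
- exact: (C3_exp_integrable T3e c30 a0 C3g hoo mp).
rewrite lte_fin in tT.
have rd : 0 <= r ^- d by rewrite invr_ge0 exprn_ge0// ltW.
have rR6 : r < R6.
  by rewrite -(h_lt_iff hoo)// hr (le_lt_trans hR6)// ltf_pV2.
have [rT|Tr] := ltP r T3.
  apply: (le_trans (C3_moment T3e c30 a0 C3g t0 r0 hr _ mp)).
    by rewrite lte_fin.
  by rewrite lee_fin ler_wpM2r// ler_peMr// exprn_ege1// lerDl.
pose r1 := T3 / 2; have r10 : 0 < r1 by rewrite divr_gt0.
have r1T : r1 < T3 by rewrite ltr_pdivrMr//; lra.
have r1r : r1 <= r := le_trans (ltW r1T) Tr.
pose t1 := (h g r1)^-1; have h1 := h_gt0 hoo r10.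
have t10 : 0 < t1 by rewrite invr_gt0.
have t1t : t1 <= t.
  by rewrite -[t]invrK lef_pV2 ?posrE ?invr_gt0// -hr h_le// r10.
have := C3_moment T3e c30 a0 C3g t10 r10; rewrite invrK lte_fin.
move=> /(_ erefl r1T mp); rewrite -/C' => mom.
have rr1 : 0 <= r / r1 by rewrite divr_ge0// ltW.
apply: (@le_trans _ _ (\int[lam]_z ((r / r1)%:E *
    (expR (- (t1 * psi g z)) * (1 + r1 * enorm z))%:E))%E).
  apply: ge0_le_integral => //.
  - by move=> z _; rewrite lee_fin moment_ge0// ltW.
  - by apply: mEFin; exact: measurable_moment.
  - by apply: measurable_funeM; apply: mEFin; exact: measurable_moment.
  move=> z _; rewrite -EFinM lee_fin mulrCA; apply: ler_pM.
  - exact: expR_ge0.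
  - by rewrite addr_ge0// mulr_ge0 ?enorm_ge0 ?(ltW r0).
  - by rewrite ler_expR lerN2 ler_wpM2r// psi_ge0.
  - rewrite mulrDr mulr1 mulrA divfK ?gt_eqF// lerD2r.
    by rewrite ler_pdivlMr// mul1r.
rewrite ge0_integralZl_EFin//; first last.
- by apply: mEFin; exact: measurable_moment.
- by move=> z _; rewrite lee_fin moment_ge0// ltW.
apply: (le_trans (lee_wpmul2l _ mom)); first by rewrite lee_fin.
rewrite -EFinM lee_fin.
have -> : r / r1 * (C' * r1 ^- d) = C' * (r / r1) ^+ d.+1 * r ^- d.
  rewrite exprS (expr_div_n r r1).
  have : r ^+ d != 0 by rewrite expf_neq0// gt_eqF.
  have : r1 ^+ d != 0 by rewrite expf_neq0// gt_eqF.
  have : r1 != 0 by rewrite gt_eqF.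
  move: (r1 ^+ d) (r ^+ d) => u v r1n u0 v0.
  by field; rewrite r1n u0 v0.
rewrite ler_wpM2r// ler_wpM2l// lerXn2r ?nnegrE// ?addr_ge0//.
have -> : r / r1 = 2 * r / T3 by rewrite /r1; field; rewrite gt_eqF.
apply: (@le_trans _ _ (2 * R6 / T3)); last by rewrite lerDr.
by rewrite ler_wpM2r ?invr_ge0 ?(ltW T30)// ler_wpM2l// ltW.
Qed.

Hypothesis d0 : (0 < d)%N.

Lemma C2_C3 : C2 g -> C3 g.
Proof.
move=> [T2 [c2 [T20 c20 H]]]; have [T T0 TT2] := pos_ereal_lb T20.
apply: (@exp_bound_C3 R d g hoo (measurable_psi YP) T c2 T0 _ d0) => t t0 tT.
apply: le_trans (H t t0 _); last by rewrite (lt_le_trans _ TT2).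
have mp := measurable_psi YP.
apply: ge0_le_integral => //.
- by apply: mEFin; do 2! apply: measurableT_comp => //; do 2! apply: measurable_funM => //.
- apply: mEFin; apply: measurableT_comp => //.
  by apply: measurable_funM.
move=> z _; rewrite lee_fin ler_expR mulNr lerN2 -/(psi g z).
by rewrite ler_peMl ?ler1n// mulr_ge0 ?psi_ge0 ?(ltW t0).
Qed.

Lemma C1_C3 : C1 P Y g -> C3 g.
Proof.
move=> [p [dp [T1 [c1 [T10 c10 H]]]]]; have [T T0 TT1] := pos_ereal_lb T10.
apply: (@exp_bound_C3 R d g hoo (measurable_psi YP) T (c1 * (2 * pi) ^+ d) T0 _ d0).
move=> t t0 tT; have [mp p0 pE _] := dp t t0.
have r0 : 0 < hinv g t^-1 by rewrite (hinv_gt0 hoo)// invr_gt0.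
have cr0 : 0 <= c1 * hinv g t^-1 ^- d.
  by rewrite mulr_ge0 ?(ltW c10)// invr_ge0 exprn_ge0// ltW.
have tT1 : (t%:E < T1)%E by rewrite (lt_le_trans _ TT1).
have := bounded_density_integral (measurable_levy YP (ltW t0))
  (fun z a => levy_polar YP z a (ltW t0)) cr0.
rewrite mulrAC; apply => B mB.
rewrite pE// -integral_cst//; apply: ge0_le_integral => //.
- by move=> x _; rewrite lee_fin.
- by apply: measurable_funTS; exact: mEFin.
- move=> x _; apply: le_trans (H t t0 tT1).
  by apply: ereal_sup_ubound; exists x.
Qed.

Lemma C6_C1 : C6 P Y g -> C1 P Y g.
Proof.
move=> [T6 [c6 [T60 c61 [p [dp H]]]]]; exists p; split => //.
have c60 : 0 < c6 := lt_le_trans ltr01 c61.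
have dR : 0 < d%:R :> R by rewrite ltr0n.
(* As [d * a = 1 / c6], the cube of half-side [a * r] lies in the ball of radius [r / c6]. *)
pose a := (c6 * d%:R)^-1; have a0 : 0 < a by rewrite invr_gt0 mulr_gt0.
exists T6, (c6 / (2 * a) ^+ d); split => //.
  by rewrite divr_gt0// exprn_gt0// mulr_gt0.
move=> t t0 tT; have [mp p0 pE _] := dp t t0.
have r0 : 0 < hinv g t^-1 by rewrite (hinv_gt0 hoo)// invr_gt0.
have [xt [_ hxt]] := H t t0 tT; set r := hinv g t^-1 in r0 hxt *.
apply: ge_ereal_sup => _ [x _ <-].
set v := xt + t *: drift_r g r.
have ar0 : 0 < a * r by rewrite mulr_gt0.
have low y : cube v (a * r) y -> c6^-1 * p t x <= p t y.
  move=> /(cube_enorm (ltW ar0)) yv.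
  have := hxt (y - v); rewrite -addrA -/v subrK => /(_ _) hy.
  rewrite -lee_fin EFinM; apply: le_trans (hy _).
    apply: lee_wpmul2l; first by rewrite lee_fin invr_ge0 ltW.
    by apply: ereal_sup_ubound; exists x.
  rewrite (le_trans yv)// mulrA /a invfM mulrCA divff ?gt_eqF// mulr1.
  exact: lexx.
have k0 : 0 <= c6^-1 * p t x by rewrite mulr_ge0// invr_ge0 ltW.
have := ge_cst_integral lam (measurable_cube v (a * r)) mp p0 k0 low.
have : (\int[lam]_x (p t x)%:E <= 1)%E.
  by rewrite -pE// probability_le1// preimage_setT.
move=> h1 /le_trans /(_ h1).
rewrite [X in (_ * X)%E](lebesgue_cube v ar0) -EFinM !lee_fin.
have -> : (2 * (a * r)) ^+ d = (2 * a) ^+ d * r ^+ d by rewrite mulrA exprMn.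
move=> h2; rewrite -mulrA -invfM ler_pdivlMr; last first.
  by rewrite mulr_gt0// exprn_gt0// mulr_gt0.
by rewrite -(ler_pM2l (_ : 0 < c6^-1)) ?invr_gt0// mulVf ?gt_eqF// mulrA.
Qed.

End implications.

Theorem corollary3p6 (R : realType) (d : nat) (d_gt0 : (0 < d)%N) :
  [/\ (forall (disp : measure_display) (Omega : measurableType disp)
         (P : probability Omega R) (Y : R -> Omega -> 'cV[R]_d)
         (g : levy_triplet R d),
         levy_process_with P Y g -> h g r @[r --> 0^'+] --> +oo ->
         [/\ C1 P Y g <-> C6 P Y g, C2 g <-> C6 P Y g,
             C3 g <-> C6 P Y g & C4 g <-> C6 P Y g]),
      (forall c3 alpha3 : R, 0 < c3 <= 1 -> 0 < alpha3 <= 2 ->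
         exists c6 : R, 1 <= c6 /\
         forall (disp : measure_display) (Omega : measurableType disp)
           (P : probability Omega R) (Y : R -> Omega -> 'cV[R]_d)
           (g : levy_triplet R d) (T3 : \bar R),
           levy_process_with P Y g -> h g r @[r --> 0^'+] --> +oo ->
           (0 < T3)%E -> C3_with g T3 c3 alpha3 ->
           C6_with P Y g (h_ext g (T3 * c6^-1%:E))^-1%E c6) &
      (forall (c3 alpha3 T3 T6 : R) (h0 : R -> R),
         0 < c3 <= 1 -> 0 < alpha3 <= 2 -> 0 < T3 -> 0 < T6 ->
         exists c6 : R, 1 <= c6 /\
         forall (disp : measure_display) (Omega : measurableType disp)
           (P : probability Omega R) (Y : R -> Omega -> 'cV[R]_d)
           (g : levy_triplet R d),
           levy_process_with P Y g -> h g r @[r --> 0^'+] --> +oo ->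
           (forall r, 0 < r -> h g r = h0 r) ->
           C3_with g T3%:E c3 alpha3 ->
           C6_with P Y g T6%:E c6)].
Proof.
split.
- move=> disp Omega P Y g YP hoo.
  have c36 := C3_C6 YP hoo; have c61 := C6_C1 hoo d_gt0.
  have c13 := C1_C3 YP hoo d_gt0; have c23 := C2_C3 YP hoo d_gt0.
  have c32 := C3_C2 YP hoo; have c34 := @C3_C4 R d g.
  have c43 := @C4_C3 R d g d_gt0; split; split=> H; first exact/c36/c13.
  + exact: c61.
  + exact/c36/c23.
  + exact/c32/c13/c61.
  + exact: c36.
  + exact/c13/c61.
  + exact/c36/c43.
  + exact/c34/c13/c61.
- move=> c3 alpha c30 /andP[a0 _].
  exists (spread_const d (moment_const d (growth_const d c3) alpha)); split.
    by apply/spread_const_ge1/moment_const_ge0; exact: growth_const_gt0.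
  by move=> disp Omega P Y g T3 YP hoo T30 C3g; exact: C3_C6_with.
- move=> c3 alpha T3 T6 h0 c30 /andP[a0 _] T30 T60.
  (* The constant must be chosen from [h0] before any process is given. If [h0] never falls to
     [1 / T6], [h_surj] shows that no triplet has [h = h0], and any constant will do. *)
  have [[R6 [R60 hR6]]|noR6] := pselect (exists R6, 0 < R6 /\ h0 R6 <= T6^-1).
    eexists; split; last first.
      move=> disp Omega P Y g YP hoo hh0 C3g.
      by apply: (C3_C6_bounded YP hoo c30 a0 T30 T60 R60 _ C3g); rewrite hh0.
    apply: spread_const_ge1; rewrite mulr_ge0 ?exprn_ge0 ?addr_ge0//.
      by apply: moment_const_ge0; exact: growth_const_gt0.
    by rewrite divr_ge0 ?mulr_ge0// ltW.
  exists 1; split=> // disp Omega P Y g YP hoo hh0 _; exfalso; apply: noR6.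
  have iT : 0 < T6^-1 by rewrite invr_gt0.
  have [R6 R60 hR6] := h_surj hoo iT.
  by exists R6; rewrite -hh0// hR6.
Qed.
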